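(* For all integers $p\ge 1$ and $q\ge 3$, the jellyfish graph $JFG(p,q)$ is DQS.
   Context: All graphs are finite and simple. The jellyfish graph $JFG(p,q)$ is obtained from a cycle $C_q$ and $q$ copies of the star $K_{1,p}$ by identifying each vertex of $C_q$ with the center (vertex of maximum degree) of a distinct copy of $K_{1,p}$. The signless Laplacian matrix is $Q(G)=A(G)+D(G)$, with $A(G)$ the adjacency matrix and $D(G)$ the diagonal degree matrix. Two graphs are $Q$-cospectral if their signless Laplacian matrices have the same spectrum. A graph is DQS (determined by its signless Laplacian spectrum) if every graph $Q$-cospectral with it is isomorphic to it. *)

(* Defs.v *)
From mathcomp Require Import all_boot all_order all_algebra.
From mathcomp Require Import all_field.
Set Implicit Arguments. Unset Strict Implicit. Unset Printing Implicit Defensive.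
Import GRing.Theory Num.Theory.
Local Open Scope ring_scope.

Definition simple_graph (V : finType) (e : rel V) : Prop :=
  symmetric e /\ irreflexive e.

Definition deg (V : finType) (e : rel V) (x : V) : nat := #|[set y | e x y]|.

Definition Qmat (V : finType) (e : rel V) : 'M[algC]_#|V| :=
  \matrix_(i, j) let x := enum_val i in let y := enum_val j in
     ((e x y)%:R + (x == y)%:R * (deg e x)%:R).

Definition Qmult (V : finType) (e : rel V) (l : algC) : nat :=
  mup l (char_poly (Qmat e)).

Definition Q_cospectral (V W : finType) (e : rel V) (f : rel W) : Prop :=
  #|V| = #|W| /\ forall l : algC, Qmult e l = Qmult f l.

Definition graph_iso (V W : finType) (e : rel V) (f : rel W) : Prop :=
  exists g : V -> W, bijective g /\ forall x y, e x y = f (g x) (g y).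

Definition DQS (V : finType) (e : rel V) : Prop :=
  forall (W : finType) (f : rel W), simple_graph f -> Q_cospectral e f -> graph_iso e f.

(* Jellyfish graph JFG(p,q): vertex (i, 0) is the i-th cycle vertex (center of
   the i-th star); (i, k), 1 <= k <= p, are the pendant leaves of that star. *)
Definition jfg_adj (p q : nat) : rel ('I_q * 'I_p.+1) :=
  fun x y =>
    [|| [&& x.2 == ord0, y.2 == ord0 &
           ((val y.1 == (val x.1).+1 %% q)%N || (val x.1 == (val y.1).+1 %% q)%N)]
      | (x.1 == y.1) &&
          (((x.2 == ord0) && (y.2 != ord0)) || ((y.2 == ord0) && (x.2 != ord0)))].
Arguments jfg_adj : clear implicits.

(* Main.v *)
(* The eigenvalues of Q = Q(JFG(p,q)) are the roots of (x - 1)(x - p - 2 - t) = p,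
   t = 2 cos(2 pi j / q), and 1 with multiplicity q(p - 1). So they avoid the interval
   (1, p+1), exactly q of them exceed 1, the largest one is simple, and 0 occurs at most once.
   A Q-cospectral graph H is related to JFG(p,q) by an orthogonal map intertwining the two
   signless Laplacians, which transports quadratic forms in Q; moreover the traces of the
   powers of Q determine the first moments of the degrees of H.

   If H has no isolated vertex, the moments force all degrees to be 1 or p+2, but for a
   bipartite exception on six vertices, which would have the eigenvalue 0. A test function
   modelled on the Perron eigenvector then shows that the vertices of degree p+2 induce a
   2-regular connected graph with p leaves at each vertex: H is JFG(p,q).

   If H has an isolated vertex, it has only one, q is even, and (Q - 1)(Q - p - 1) >= 0
   together with the moments leaves finitely many degree patterns, with p <= 3. Those
   with p = 2, 3 contradict the inertia of Q - 1, tested on functions supported on leaves,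
   their neighbours and the remaining vertices of degree at least 2; those with p = 1
   contradict the trace of (Q^2 - 6Q)^2, the absence of the eigenvalue 1 and, if q = 4,
   the inertia of (Q - 2)^2 - 2. *)
Require Import Defs.
From mathcomp Require Import all_boot all_order all_algebra all_field.
From mathcomp Require Import ring lra zify.
From mathcomp Require Import fingroup perm.
Set Implicit Arguments. Unset Strict Implicit. Unset Printing Implicit Defensive.
Import Order.TTheory GRing.Theory Num.Theory.
Local Open Scope ring_scope.

(** The spectrum is never computed. Each spectral fact about the jellyfish graph is an identity
    between sums of squares in core and leaf coordinates, carried to H by the isometry, or a
    dimension count: with more functions on H than equations, some nontrivial combination has a
    pull-back that solves them. The real algebraic numbers form an ordered field with square roots
    of nonnegative elements and with all eigenvalues of symmetric matrices, so diagonalization stays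
    real.

    The obstacle is the isolated vertex. The sum of (d - 1)(d - p - 2) over the degrees is 0; the
    summand is negative strictly between 1 and p + 2, but equals p + 2 at d = 0, so an isolated
    vertex can pay for intermediate degrees. The bound p <= 3 arises because (Q - 1)(Q - p - 1) >=
    0, tested at one vertex, excludes the degrees 2 to p - 1 once p >= 4. For p = 1 the fourth-order
    trace decides, except that at q = 4 the 4-cycle of the jellyfish graph itself adds slack to
    it. *)

Local Notation R := algR.

(** * Orthogonal diagonalization *)

Lemma algR_sqrt (x : R) : 0 <= x -> exists2 y : R, 0 <= y & y ^+ 2 = x.
Proof.
move=> x0; have y0 : 0 <= sqrtC (algRval x) by rewrite sqrtC_ge0.
exists (in_algR (ger0_real y0)) => //.
apply/val_inj; rewrite expr2.
have -> : val (in_algR (ger0_real y0) * in_algR (ger0_real y0)) = sqrtC (algRval x) * sqrtC (algRval x) by [].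
by rewrite -expr2 sqrtCK.
Qed.

(** The complex spectral theorem supplies a real eigenvalue; being a root of the characteristic
    polynomial over [R], it also has an eigenvector over [R], which a square root normalizes. *)
Lemma sym_eigenvector n (A : 'M[R]_n.+1) : A^T = A ->
  exists (v : 'rV_n.+1) a, v *m A = a *: v /\ v *m v^T = 1%:M.
Proof.
move=> sA; pose B := map_mx algRval A.
have Bre : B \is a mxOver Num.real by apply/mxOverP=> i j; rewrite mxE; apply: algRvalP.
have Bh : B \is hermsymmx.
  apply: realsym_hermsym => //.
  by apply/is_hermitianmxP; rewrite expr0 scale1r map_mx_id // /B map_trmx sA.
have /mxOverP/(_ 0 0) := hermitian_spectral_diag_real Bh.
set a := spectral_diag B 0 0 => aR.
have rB : root (char_poly B) a.
  have /orthomx_spectralP BE := hermitian_normalmx Bh.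
  rewrite -eigenvalue_root_char; apply/eigenvalueP.
  exists (row 0 (spectralmx B)); last first.
    apply/eqP=> r0; have := row_unitarymxP (spectral_unitarymx B) 0 0.
    by rewrite r0 dotmxE mul0mx mxE /= => /esym/eqP; rewrite oner_eq0.
  rewrite {2}BE rowE !mulmxA -[delta_mx 0 0 *m _ *m _]mulmxA.
  rewrite mulmxV ?spectral_unit // mulmx1 scalemxAl; congr (_ *m _).
  apply/rowP=> j; rewrite mul_mx_diag !mxE.
  by case: (j =P 0) => [->|_]; rewrite !eqxx ?mulr1 ?mul1r // mul0r mulr0.
pose a' : R := in_algR aR.
have rA : root (char_poly A) a'.
  have : root (map_poly algRval (char_poly A)) (algRval a').
    by rewrite map_char_poly.
  by rewrite fmorph_root.
move: rA; rewrite -eigenvalue_root_char => /eigenvalueP[v vA v0].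
have vv i : 0 <= v 0 i * v 0 i by rewrite -expr2 sqr_ge0.
have s0 : 0 <= \sum_i v 0 i * v 0 i by apply: sumr_ge0.
have [y y0 yE] := algR_sqrt s0.
have yn0 : y != 0.
  apply: contraNneq v0 => yz; move: yE; rewrite yz expr2 mul0r => /esym/eqP.
  rewrite psumr_eq0 // => /allP v0; apply/eqP/rowP=> i; rewrite mxE.
  by have := v0 i (mem_index_enum _); rewrite /= mulf_eq0 orbb => /eqP.
exists (y^-1 *: v), a'; split.
  by rewrite -scalemxAl vA !scalerA mulrC.
apply/matrixP=> i j; rewrite !ord1 !mxE /=.
under eq_bigr do rewrite !mxE mulrACA.
by rewrite -mulr_sumr -yE expr2 mulrACA mulVf // mulr1.
Qed.

(* A Householder reflection exchanging v and the first basis vector. *)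
Lemma orthogonal_with_row0 n (v : 'rV[R]_n.+1) : v *m v^T = 1%:M ->
  exists H : 'M[R]_n.+1, H *m H^T = 1%:M /\ row 0 H = v.
Proof.
move=> vv; pose e : 'rV[R]_n.+1 := delta_mx 0 0; have [w wE] : exists w, w = e - v by exists (e - v).
have [w0|w0] := eqVneq w 0.
  exists 1%:M; rewrite trmx1 mulmx1; split=> //.
  by rewrite rowE mulmx1; apply/eqP; rewrite -subr_eq0 -/e -wE w0.
pose c := (w *m w^T) 0 0.
have wwc : w *m w^T = c%:M.
  by apply/matrixP=> i j; rewrite !ord1 [RHS]mxE eqxx.
(* Both [e] and [v] are unit vectors, so |e - v|^2 = 2 - 2<e, v> = 2<e, e - v>. *)
have cE : c = 2 * (e *m w^T) 0 0.
  have ev : (v *m e^T) 0 0 = (e *m v^T) 0 0.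
    by rewrite -[in RHS](trmxK e) -trmx_mul [in RHS]mxE.
  have ee : (e *m e^T) 0 0 = 1 by rewrite trmx_delta mul_delta_mx mxE !eqxx.
  rewrite /c wE linearB /= mulmxBl !mulmxBr vv.
  move: ee ev; rewrite !mxE => -> ->; rewrite eqxx mulr1n; set s := \sum_j _; ring.
have c0 : c != 0.
  apply: contraNneq w0 => /eqP; rewrite /c [(_ *m _) _ _]mxE psumr_eq0; last first.
    by move=> i _; rewrite [w^T _ _]mxE -expr2 sqr_ge0.
  move=> /allP w0; apply/eqP/rowP=> i; rewrite [RHS]mxE.
  by have := w0 i (mem_index_enum _); rewrite /= [w^T _ _]mxE mulf_eq0 orbb => /eqP.
pose H := 1%:M - (2 / c) *: (w^T *m w).
have HT : H^T = H.
  by rewrite /H linearB /= linearZ /= trmx1 trmx_mul trmxK.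
exists H; split.
  have MM : w^T *m w *m (w^T *m w) = c *: (w^T *m w).
    by rewrite mulmxA -[w^T *m w *m w^T]mulmxA wwc mul_mx_scalar -scalemxAl.
  rewrite HT /H mulmxBl mul1mx mulmxBr mulmx1 -scalemxAl -scalemxAr MM !scalerA.
  have -> : 2 / c * (2 / c) * c = 2 / c + 2 / c by field.
  by rewrite scalerDl opprB addrK subrK.
rewrite rowE -/e mulmxBr mulmx1 -scalemxAr mulmxA.
have -> : e *m w^T = (c / 2)%:M.
  apply/matrixP=> i j; rewrite !ord1 [RHS]mxE eqxx cE mulr1n.
  by field.
rewrite mul_scalar_mx scalerA.
have -> : 2 / c * (c / 2) = 1 by field.
by rewrite scale1r wE opprB addrC subrK.
Qed.

(** Deflation: a reflection moves an eigenvector to the first basis vector, symmetry clears the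
    first row and column, and the induction hypothesis applies to the remaining block. *)
Lemma sym_orthogonal_diag n (A : 'M[R]_n) : A^T = A ->
  exists (U : 'M[R]_n) D, U *m U^T = 1%:M /\ A = U^T *m diag_mx D *m U.
Proof.
elim: n A => [|n IHn] A sA.
  exists 1%:M, 0; rewrite trmx1 mulmx1; split=> //.
  by apply/matrixP=> -[].
have [v [a [vA vv]]] := sym_eigenvector sA.
have [H [HH rH]] := orthogonal_with_row0 vv.
have HH' : H^T *m H = 1%:M by apply: mulmx1C.
have [B BH] : exists B : 'M[R]_(1 + n), B = H *m A *m H^T by eexists.
have sB : B^T = B by rewrite BH !trmx_mul trmxK sA mulmxA.
have rB : row 0 B = a *: delta_mx 0 0.
  rewrite BH !row_mul rH vA -scalemxAl; congr (_ *: _).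
  by rewrite -rH rowE -mulmxA HH mulmx1.
have BE : B = block_mx a%:M 0 0 (drsubmx B).
  rewrite -[LHS]submxK; congr block_mx.
  - apply/matrixP=> i j; rewrite !ord1 !mxE.
    have /rowP/(_ 0) := rB; rewrite !mxE !eqxx mulr1 => <-.
    by congr (B _ _); apply/val_inj.
  - apply/matrixP=> i j; rewrite !ord1 !mxE.
    have /rowP/(_ (rshift 1 j)) := rB; rewrite !mxE /= ?andbF mulr0 => <-.
    by congr (B _ _); apply/val_inj.
  - apply/matrixP=> i j; rewrite !ord1 -sB !mxE.
    have /rowP/(_ (rshift 1 i)) := rB; rewrite !mxE /= ?andbF mulr0 => <-.
    by congr (B _ _); apply/val_inj.
have sB' : (drsubmx B)^T = drsubmx B by rewrite trmx_drsub sB.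
have [U [D [UU BD]]] := IHn _ sB'.
pose U1 : 'M[R]_(1 + n) := block_mx 1%:M 0 0 U.
pose D1 : 'rV[R]_(1 + n) := row_mx a%:M D.
have U1U : U1 *m U1^T = 1%:M.
  rewrite /U1 tr_block_mx !trmx0 trmx1 mulmx_block !mulmx0 !mul0mx mulmx1.
  by rewrite UU !addr0 add0r -scalar_mx_block.
have BD1 : B = U1^T *m diag_mx D1 *m U1.
  rewrite BE BD /U1 /D1 tr_block_mx !trmx0 trmx1 diag_mx_row.
  rewrite !mulmx_block !mulmx0 !mul0mx !addr0 !add0r mulmx1 mul1mx.
  rewrite ?mulmx0 ?mul0mx ?addr0; congr block_mx.
  by apply/matrixP=> i j; rewrite !ord1 !mxE eqxx.
exists (U1 *m H), D1; split.
  by rewrite trmx_mul mulmxA -(mulmxA _ H) HH mulmx1.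
rewrite trmx_mul !mulmxA -!(mulmxA H^T) -BD1 BH !mulmxA HH' mul1mx.
by rewrite -mulmxA HH' mulmx1.
Qed.

Lemma perm_of_count n (d d' : 'rV[R]_n) :
  (forall l, count_mem l [seq d 0 i | i <- enum 'I_n] = count_mem l [seq d' 0 i | i <- enum 'I_n]) ->
  exists s : 'S_n, forall i, d' 0 i = d 0 (s i).
Proof.
move=> cE; pose t := [tuple d 0 i | i < n]; pose t' := [tuple d' 0 i | i < n].
have : perm_eq t' t.
  apply/allP=> l _ /=; apply/eqP; have := cE l.
  by rewrite /= => ->.
case/tuple_permP=> s sE; exists s => i.
have : tnth t' i = tnth [tuple tnth t (s j) | j < n] i.
  by congr tnth; apply/val_inj.
by rewrite !tnth_mktuple.
Qed.

Lemma char_poly_orthogonal_diag n (A U : 'M[R]_n) D :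
  U *m U^T = 1%:M -> A = U^T *m diag_mx D *m U ->
  char_poly A = \prod_(i < n) ('X - (D 0 i)%:P).
Proof.
move=> UU AE; have UU' := mulmx1C UU.
have -> : \prod_(i < n) ('X - (D 0 i)%:P) = char_poly (diag_mx D).
  rewrite char_poly_trig ?diag_mx_is_trig //.
  by apply: eq_bigr => i _; rewrite !mxE eqxx.
rewrite /char_poly.
pose P := map_mx polyC U.
have PP : P^T *m P = 1%:M by rewrite /P map_trmx -map_mxM UU' map_mx1.
have -> : char_poly_mx A = P^T *m char_poly_mx (diag_mx D) *m P.
  rewrite /char_poly_mx mulmxBr mulmxBl AE !map_mxM -map_trmx -/P.
  by rewrite mul_mx_scalar -scalemxAl PP scalemx1.
by rewrite !det_mulmx mulrAC -det_mulmx PP det1 mul1r.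
Qed.

(** The two diagonal forms agree up to a permutation, so [K] is one diagonalizing matrix, then the
    permutation, then the inverse of the other. *)
Lemma orthogonally_similar n (A B : 'M[R]_n) : A^T = A -> B^T = B ->
  (forall l : algC, mup l (char_poly (map_mx algRval A)) =
                    mup l (char_poly (map_mx algRval B))) ->
  exists K : 'M[R]_n, K *m K^T = 1%:M /\ B = K *m A *m K^T.
Proof.
move=> sA sB mE.
have [U [D [UU AE]]] := sym_orthogonal_diag sA.
have [U' [D' [UU' BE]]] := sym_orthogonal_diag sB.
have cnt M d (X : 'M[R]_n) : X *m X^T = 1%:M -> M = X^T *m diag_mx d *m X ->
    forall l : R, mup (algRval l) (char_poly (map_mx algRval M)) =
             count_mem l [seq d 0 i | i <- enum 'I_n].
  move=> XX ME l; rewrite -map_char_poly (char_poly_orthogonal_diag XX ME).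
  have -> : \prod_(i < n) ('X - (d 0 i)%:P) =
            \prod_(x <- [seq d 0 i | i <- enum 'I_n]) ('X - x%:P).
    by rewrite big_map big_enum.
  rewrite rmorph_prod /=.
  under eq_bigr do rewrite rmorphB /= map_polyX map_polyC /=.
  rewrite -(big_map algRval xpredT (fun x => 'X - x%:P)) mu_prod_XsubC.
  rewrite [LHS]count_map; apply: eq_count => x /=.
  by apply/eqP/eqP=> [/val_inj|->].
have [s sE] : exists s : 'S_n, forall i, D' 0 i = D 0 (s i).
  by apply: perm_of_count => l; rewrite -(cnt _ _ _ UU AE) -(cnt _ _ _ UU' BE).
pose P : 'M[R]_n := perm_mx s.
have PP : P *m P^T = 1%:M by rewrite tr_perm_mx -perm_mxM mulgV perm_mx1.
have DD : diag_mx D' = P *m diag_mx D *m P^T.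
  apply/matrixP=> i j; rewrite tr_perm_mx -row_permE -col_permE !mxE sE.
  by rewrite (inj_eq perm_inj).
have U'U' := mulmx1C UU'.
exists (U'^T *m P *m U); split.
  rewrite !trmx_mul trmxK !mulmxA -(mulmxA _ U) UU mulmx1.
  by rewrite -(mulmxA _ P) PP mulmx1 U'U'.
rewrite !trmx_mul trmxK AE !mulmxA -(mulmxA _ U) UU mulmx1.
by rewrite -(mulmxA _ U) UU mulmx1 BE DD !mulmxA.
Qed.

(** * Orthogonal maps between cospectral graphs *)

Section Kernels.
Variable V : finType.
Implicit Types (A B : V -> V -> R) (g h : V -> R).

(** Kernels indexed by vertices stand in for matrices indexed by ordinals, so that the graph
    computations sum over vertices directly. *)
Definition kmul A B x y := \sum_z A x z * B z y.
Definition kop A g x := \sum_y A x y * g y.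
Definition dot g h := \sum_x g x * h x.

Lemma kop_kmul A B g : kop (kmul A B) g =1 kop A (kop B g).
Proof.
move=> x; rewrite /kop /kmul.
under eq_bigr do rewrite mulr_suml.
rewrite exchange_big /=; apply: eq_bigr => y _.
by rewrite mulr_sumr; apply: eq_bigr => z _; rewrite mulrA.
Qed.

End Kernels.

Definition Qker (V : finType) (e : rel V) (x y : V) : R :=
  (e x y)%:R + (x == y)%:R * (deg e x)%:R.

Definition Qop (V : finType) (e : rel V) := kop (Qker e).

(* The pull-back along an orthogonal matrix intertwining the two signless Laplacians. *)
Record Q_isometry (V W : finType) (e : rel V) (f : rel W) := QIsometry {
  pull :> (W -> R) -> V -> R;
  pull_ext : forall h h', h =1 h' -> pull h =1 pull h';
  pull_sum : forall (I : finType) (c : I -> R) (phi : I -> W -> R),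
    pull (fun w => \sum_i c i * phi i w) =1 (fun v => \sum_i c i * pull (phi i) v);
  pull_dot : forall h h', dot (pull h) (pull h') = dot h h';
  pull_Qop : forall h, Qop e (pull h) =1 pull (Qop f h)
}.

Section MatrixOfKernel.
Variables (n : nat) (V : finType) (al : 'I_n -> V).
Hypothesis al_bij : bijective al.
Implicit Types A B : V -> V -> R.

Definition mk A : 'M[R]_n := \matrix_(i, j) A (al i) (al j).

Lemma mk_mul A B : mk (kmul A B) = mk A *m mk B.
Proof.
apply/matrixP=> i j; rewrite !mxE /kmul (reindex al) /=; last exact: onW_bij.
by apply: eq_bigr => k _; rewrite !mxE.
Qed.

Lemma mk_tr A : \tr (mk A) = \sum_x A x x.
Proof.
rewrite (reindex al) /=; last exact: onW_bij.
by apply: eq_bigr => k _; rewrite !mxE.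
Qed.

End MatrixOfKernel.

Lemma char_poly_cast (F : comNzRingType) m n (E : n = m) (M : 'M[F]_m) :
  char_poly (\matrix_(i < n, j < n) M (cast_ord E i) (cast_ord E j)) = char_poly M.
Proof.
case: m / E M => M; congr char_poly.
by apply/matrixP=> i j; rewrite mxE !cast_ord_id.
Qed.

Lemma Qker_sym (V : finType) (e : rel V) : symmetric e -> forall x y, Qker e x y = Qker e y x.
Proof.
by move=> se x y; rewrite /Qker se eq_sym; case: eqP => [->|] //; rewrite !mul0r.
Qed.

(** One orthogonal matrix gives both the isometry and, by conjugation, the equality of traces of
    polynomials in Q. The last clause, the trace of (Q^2 - c Q)^2, is used with c = 6. *)
Lemma cospectral_isometry (V W : finType) (e : rel V) (f : rel W) :
  symmetric e -> symmetric f -> Q_cospectral e f ->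
  exists S : Q_isometry e f,
   [/\ \sum_w Qker f w w = \sum_v Qker e v v,
       \sum_w kmul (Qker f) (Qker f) w w = \sum_v kmul (Qker e) (Qker e) v v,
       \sum_w kmul (Qker f) (kmul (Qker f) (Qker f)) w w =
         \sum_v kmul (Qker e) (kmul (Qker e) (Qker e)) v v &
       forall c, let M (T : finType) (r : rel T) x y :=
           kmul (Qker r) (Qker r) x y - c * Qker r x y in
         \sum_w kmul (M W f) (M W f) w w = \sum_v kmul (M V e) (M V e) v v].
Proof.
move=> se sf [cVW mE]; pose n := #|V|.
pose al : 'I_n -> V := enum_val; pose be (i : 'I_n) : W := enum_val (cast_ord cVW i).
have al_bij : bijective al by exists enum_rank; [apply: enum_valK|apply: enum_rankK].
have be_bij : bijective be.
  exists (fun w => cast_ord (esym cVW) (enum_rank w)) => [i|w].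
    by rewrite /be enum_valK cast_ordK.
  by rewrite /be cast_ordKV enum_rankK.
have [] := @orthogonally_similar n (mk al (Qker e)) (mk be (Qker f)).
- by apply/matrixP=> i j; rewrite !mxE Qker_sym.
- by apply/matrixP=> i j; rewrite !mxE Qker_sym.
- move=> l; have := mE l; rewrite /Qmult.
  have -> : Qmat e = map_mx algRval (mk al (Qker e)).
    apply/matrixP=> i j; rewrite !mxE /Qker rmorphD rmorphM !rmorph_nat.
    by rewrite (inj_eq enum_val_inj).
  move=> ->; congr mup; rewrite -(char_poly_cast cVW); congr char_poly.
  apply/matrixP=> i j; rewrite !mxE /Qker rmorphD rmorphM !rmorph_nat.
  by rewrite (inj_eq enum_val_inj).
move=> K [KK QE].
have K'K := mulmx1C KK.
have cj2 A B A' B' : mk be A = K *m mk al A' *m K^T -> mk be B = K *m mk al B' *m K^T ->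
    mk be (kmul A B) = K *m mk al (kmul A' B') *m K^T.
  move=> HA HB; rewrite !mk_mul // HA HB !mulmxA -(mulmxA _ K^T) K'K mulmx1.
  by [].
have cjtr A A' : mk be A = K *m mk al A' *m K^T -> \sum_w A w w = \sum_v A' v v.
  move=> HA; rewrite -(mk_tr be_bij) -(mk_tr al_bij) HA mxtrace_mulC mulmxA K'K.
  by rewrite mul1mx.
pose rv (h : W -> R) : 'rV_n := \row_i h (be i).
pose S h v := (rv h *m K) 0 (enum_rank v).
have alK k : enum_rank (al k) = k by apply: enum_valK.
have onal (P : V -> Prop) : (forall k, P (al k)) -> forall v, P v.
  by move=> H v; rewrite -(enum_rankK v); apply: H.
have Se h h' : h =1 h' -> S h =1 S h'.
  move=> E v; rewrite /S; congr ((_ *m _) _ _).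
  by apply/rowP=> i; rewrite !mxE E.
have Ss (I : finType) (c : I -> R) (phi : I -> W -> R) :
    S (fun w => \sum_i c i * phi i w) =1 (fun v => \sum_i c i * S (phi i) v).
  move=> v; rewrite /S.
  have -> : rv (fun w => \sum_i c i * phi i w) = \sum_i c i *: rv (phi i).
    apply/rowP=> i; rewrite summxE !mxE; apply: eq_bigr => j _.
    by rewrite !mxE.
  rewrite mulmx_suml summxE; apply: eq_bigr => i _.
  by rewrite -scalemxAl mxE.
have Sd h h' : dot (S h) (S h') = dot h h'.
  rewrite /dot (reindex al) /=; last exact: onW_bij.
  rewrite [RHS](reindex be) /=; last exact: onW_bij.
  transitivity ((rv h *m K *m (rv h' *m K)^T) 0 0).
    by rewrite [RHS]mxE; apply: eq_bigr => k _; rewrite [_^T _ _]mxE /S alK.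
  rewrite trmx_mul mulmxA -(mulmxA _ K) KK mulmx1 mxE.
  by apply: eq_bigr => k _; rewrite !mxE.
have SQ h : Qop e (S h) =1 S (Qop f h).
  apply: onal => k; rewrite /S alK /Qop /kop (reindex al) /=; last exact: onW_bij.
  transitivity ((rv h *m K *m mk al (Qker e)) 0 k).
    rewrite [RHS]mxE; apply: eq_bigr => j _.
    by rewrite alK mulrC [mk _ _ _ _]mxE Qker_sym.
  have -> : rv (fun x => \sum_y Qker f x y * h y) = rv h *m mk be (Qker f).
    apply/rowP=> i; rewrite !mxE (reindex be) /=; last exact: onW_bij.
    by apply: eq_bigr => j _; rewrite !mxE mulrC Qker_sym.
  by rewrite QE !mulmxA -(mulmxA _ K^T) K'K mulmx1.
exists (QIsometry Se Ss Sd SQ); split.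
- exact: cjtr.
- exact/cjtr/cj2.
- exact/cjtr/cj2/cj2.
move=> c M.
have MQ : mk be (M W f) = K *m mk al (M V e) *m K^T.
  have -> : mk be (M W f) = mk be (kmul (Qker f) (Qker f)) - c *: mk be (Qker f).
    by apply/matrixP=> i j; rewrite !mxE.
  have -> : mk al (M V e) = mk al (kmul (Qker e) (Qker e)) - c *: mk al (Qker e).
    by apply/matrixP=> i j; rewrite !mxE.
  by rewrite (cj2 _ _ _ _ QE QE) QE mulmxBr mulmxBl -scalemxAr -scalemxAl.
exact/cjtr/(cj2 _ _ _ _ MQ MQ).
Qed.

Lemma nonzero_solution (I J : finType) (k : I -> J -> R) : (#|J| < #|I|)%N ->
  exists2 c : I -> R, exists i, c i != 0 & forall j, \sum_i c i * k i j = 0.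
Proof.
move=> lt_JI; pose A : 'M[R]_(#|I|, #|J|) := \matrix_(i, j) k (enum_val i) (enum_val j).
have : kermx A != 0.
  rewrite -mxrank_eq0 mxrank_ker subn_eq0 -ltnNge.
  exact: leq_ltn_trans (rank_leq_col _) lt_JI.
case/matrix0Pn => r [s rs0].
exists (fun i => kermx A r (enum_rank i)).
  by exists (enum_val s); rewrite enum_valK.
move=> j; have /matrixP/(_ r (enum_rank j)) := mulmx_ker A; rewrite !mxE => H; rewrite -[RHS]H.
rewrite [RHS](reindex (@enum_rank I)) /=; last first.
  by apply: onW_bij; exists enum_val; [apply: enum_rankK|apply: enum_valK].
by apply: eq_bigr => i _; rewrite [A _ _]mxE !enum_rankK.
Qed.

Section Isometry.
Variables (V W : finType) (e : rel V) (f : rel W) (S : Q_isometry e f).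
Implicit Types h : W -> R.

(* A subspace of functions on W whose dimension exceeds the number of constraints
   meets the constrained subspace of functions on V. *)
Lemma pull_constrained (B J : finType) (psi : B -> W -> R) (k : J -> V -> R) :
  (#|J| < #|B|)%N ->
  exists2 c : B -> R, exists b, c b != 0 &
    forall j, dot (k j) (S (fun w => \sum_b c b * psi b w)) = 0.
Proof.
move=> lt_JB; have [c c0 cE] := nonzero_solution (fun b j => dot (k j) (S (psi b))) lt_JB.
exists c => // j; rewrite -[RHS](cE j) /dot.
under eq_bigr do rewrite pull_sum mulr_sumr.
rewrite exchange_big /=; apply: eq_bigr => b _.
by rewrite mulr_sumr; apply: eq_bigr => v _; rewrite mulrCA.
Qed.

Lemma pull_linear a b h1 h2 :
  S (fun w => a * h1 w + b * h2 w) =1 (fun v => a * S h1 v + b * S h2 v).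
Proof.
move=> v; have /(_ v) := pull_sum S (fun t : bool => if t then a else b) (fun t => if t then h1 else h2).
rewrite big_bool /= => <-; apply: pull_ext => w.
by rewrite big_bool.
Qed.

Lemma pull_eq0 h : S h =1 (fun=> 0) -> h =1 (fun=> 0).
Proof.
move=> S0 w; have := pull_dot S h h; rewrite [LHS]big1 => [/esym/eqP|v _]; last by rewrite S0 mul0r.
rewrite psumr_eq0 => [/allP/(_ w (mem_index_enum _))|? _]; last by rewrite -expr2 sqr_ge0.
by rewrite /= mulf_eq0 orbb => /eqP.
Qed.

End Isometry.

Section QuadraticForms.
Variables (V : finType) (e : rel V).
Implicit Types g h : V -> R.

Lemma Qop_E g x : Qop e g x = (deg e x)%:R * g x + \sum_(y | e x y) g y.
Proof.
rewrite /Qop /kop /Qker; under eq_bigr do rewrite mulrDl.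
rewrite big_split /= addrC; congr (_ + _).
  rewrite (bigD1 x) //= eqxx mul1r big1 ?addr0 // => y yx.
  by rewrite eq_sym (negPf yx) !mul0r.
by rewrite [RHS]big_mkcond /=; apply: eq_bigr => y _; case: e; rewrite ?mul1r ?mul0r.
Qed.

Lemma dotC g h : dot g h = dot h g.
Proof. by apply: eq_bigr => x _; rewrite mulrC. Qed.

Lemma eq_dot g g' h h' : g =1 g' -> h =1 h' -> dot g h = dot g' h'.
Proof. by move=> E E'; apply: eq_bigr => x _; rewrite E E'. Qed.

Hypothesis se : symmetric e.

Lemma Qop_sym g h : dot (Qop e g) h = dot g (Qop e h).
Proof.
rewrite /dot /Qop /kop; under eq_bigr do rewrite mulr_suml.
under [RHS]eq_bigr do rewrite mulr_sumr.
rewrite exchange_big /=; apply: eq_bigr => x _; apply: eq_bigr => y _.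
by rewrite (Qker_sym se) mulrCA mulrA mulrC.
Qed.

(* Every edge is counted twice. *)
Lemma Qform_edges g :
  2 * dot g (Qop e g) = \sum_x \sum_(y | e x y) (g x + g y) ^+ 2.
Proof.
have E1 : \sum_x \sum_(y | e x y) (g x) ^+ 2 = \sum_x (deg e x)%:R * (g x) ^+ 2.
  by apply: eq_bigr => x _; rewrite sumr_const /deg cardsE mulr_natl.
have E2 : \sum_x \sum_(y | e x y) (g y) ^+ 2 = \sum_x (deg e x)%:R * (g x) ^+ 2.
  rewrite -E1 (exchange_big_dep predT) //=; apply: eq_bigr => x _.
  by apply: eq_bigl => y; rewrite se.
under [RHS]eq_bigr do under eq_bigr do rewrite sqrrD addrAC.
under [RHS]eq_bigr do rewrite !big_split /=.
rewrite !big_split /= E1 E2 /dot mulr_sumr -big_split /= -big_split /=.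
rewrite -big_split /=; apply: eq_bigr => x _; rewrite Qop_E -mulr_sumr; ring.
Qed.

Lemma Qform_ge0 g : 0 <= dot g (Qop e g).
Proof.
suff : 0 <= 2 * dot g (Qop e g) by rewrite pmulr_rge0.
by rewrite Qform_edges; apply: sumr_ge0 => x _; apply: sumr_ge0 => y _; apply: sqr_ge0.
Qed.

End QuadraticForms.

Lemma deg_sum (V : finType) (e : rel V) x : deg e x = (\sum_(y | e x y) 1)%N.
Proof. by rewrite sum1_card /deg cardsE. Qed.

(** * The jellyfish graph *)

Section Jellyfish.
Variables p q : nat.
Hypothesis q3 : (3 <= q)%N.
Local Notation V := ('I_q * 'I_p.+1)%type.
Local Notation e := (jfg_adj p q).

Definition core (i : 'I_q) : V := (i, ord0).
Definition leaf (i : 'I_q) (k : 'I_p) : V := (i, lift ord0 k).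

Lemma jfg_simple : simple_graph e.
Proof.
split=> [[i k] [j l]|[i k]]; rewrite /jfg_adj /=.
  by rewrite (eq_sym j i); congr orb; [rewrite andbCA; do 2 congr andb; rewrite orbC|congr andb; rewrite orbC].
rewrite eqxx andbN orbb andbF /=.
rewrite orbF; suff -> : (val i == i.+1 %% q)%N = false by rewrite !andbF.
have := ltn_ord i; case: (ltnP i.+1 q) => [lt|ge] iq; first by rewrite modn_small // ltn_eqF.
have E : i.+1 = q by apply/eqP; rewrite eqn_leq iq.
by rewrite E modnn; apply/eqP=> i0; move: q3; rewrite -E i0.
Qed.

Lemma sum_jfg (M : nmodType) (F : V -> M) :
  \sum_v F v = \sum_i (F (core i) + \sum_k F (leaf i k)).
Proof.
rewrite (eq_bigr (fun v : V => F (v.1, v.2))) => [|[i k] _ //].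
rewrite -(pair_bigA _ (fun i k => F (i, k))) /=.
by apply: eq_bigr => i _; rewrite big_ord_recl.
Qed.

Lemma ordS_pred_neq (i : 'I_q) : ordS i != ord_pred i.
Proof.
apply/negP=> /eqP/(congr1 (@ordS q)); rewrite ord_predK => /(congr1 val) /=.
have iq := ltn_ord i.
case: (ltnP i.+1 q) => [lt|ge].
  rewrite (modn_small lt); case: (ltnP i.+2 q) => [lt2|ge2]; first by rewrite modn_small //; lia.
  have -> : i.+2 = q by lia.
  rewrite modnn; lia.
have -> : i.+1 = q by lia.
rewrite modnn modn_small; lia.
Qed.

Lemma jfg_core_core i j : e (core i) (core j) = (j == ordS i) || (j == ord_pred i).
Proof.
rewrite /jfg_adj /= andbF orbF; congr orb.
by rewrite -(inj_eq (@ordS_inj q)) ord_predK eq_sym.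
Qed.

Lemma jfg_core_leaf i j k : e (core i) (leaf j k) = (i == j).
Proof. by rewrite /jfg_adj /= andbT. Qed.

Lemma jfg_leaf_core i j k : e (leaf j k) (core i) = (i == j).
Proof. by rewrite /jfg_adj /= andbT eq_sym. Qed.

Lemma jfg_leaf_leaf i j k l : e (leaf i k) (leaf j l) = false.
Proof. by rewrite /jfg_adj /= andbF. Qed.

Lemma nbr_core (M : nmodType) (F : V -> M) i :
  \sum_(y | e (core i) y) F y =
  F (core (ordS i)) + F (core (ord_pred i)) + \sum_k F (leaf i k).
Proof.
rewrite big_mkcond sum_jfg big_split /=; congr (_ + _).
  under eq_bigr do rewrite jfg_core_core.
  rewrite -big_mkcond (bigD1 (ordS i)) ?eqxx //=; congr (_ + _).
  rewrite (bigD1 (ord_pred i)) ?eqxx ?orbT /= 1?eq_sym ?ordS_pred_neq // big1 ?addr0 //.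
  by move=> j /andP[/andP[/orP[]->]].
rewrite (bigD1 i) //= [X in _ + X]big1 ?addr0 => [|j ji].
  by apply: eq_bigr => k _; rewrite jfg_core_leaf eqxx.
by rewrite big1 // => k _; rewrite jfg_core_leaf eq_sym (negPf ji).
Qed.

Lemma nbr_leaf (M : nmodType) (F : V -> M) i k :
  \sum_(y | e (leaf i k) y) F y = F (core i).
Proof.
rewrite big_mkcond sum_jfg (bigD1 i) //= jfg_leaf_core eqxx.
rewrite big1 ?addr0 => [|l _]; last by rewrite jfg_leaf_leaf.
rewrite big1 ?addr0 // => j ji; rewrite jfg_leaf_core (negPf ji) add0r.
by rewrite big1 // => l _; rewrite jfg_leaf_leaf.
Qed.

Lemma deg_core i : deg e (core i) = p.+2.
Proof.
rewrite deg_sum; have /= -> := nbr_core (M := nat) (fun=> 1%N) i.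
by rewrite sumr_const card_ord -[_ *+ p]/(p%:R) natn.
Qed.

Lemma deg_leaf i k : deg e (leaf i k) = 1%N.
Proof. by rewrite deg_sum; have /= -> := nbr_leaf (M := nat) (fun=> 1%N) i k. Qed.

Lemma Qop_core (g : V -> R) i :
  Qop e g (core i) = p.+2%:R * g (core i) + (g (core (ordS i)) + g (core (ord_pred i)) + \sum_k g (leaf i k)).
Proof. by rewrite Qop_E deg_core nbr_core. Qed.

Lemma Qop_leaf (g : V -> R) i k : Qop e g (leaf i k) = g (leaf i k) + g (core i).
Proof. by rewrite Qop_E deg_leaf nbr_leaf mul1r. Qed.

Lemma dot_jfg (g h : V -> R) :
  dot g h = \sum_i (g (core i) * h (core i) + \sum_k g (leaf i k) * h (leaf i k)).
Proof. exact: sum_jfg. Qed.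

Lemma sum_ordS (M : nmodType) (F : 'I_q -> M) : \sum_i F (ordS i) = \sum_i F i.
Proof. by rewrite [RHS](reindex_inj (@ordS_inj q)). Qed.

End Jellyfish.

(** * Functions on the cycle *)

Section CyclicOrdinals.
Variable q : nat.
Implicit Types (i j : 'I_q) (u v : 'I_q -> R).

Lemma iter_ordS k i : val (iter k (@ordS q) i) = ((i + k) %% q)%N.
Proof.
have q0 : (0 < q)%N by apply: leq_ltn_trans (ltn_ord i).
elim: k => [|k IHk] /=; first by rewrite addn0 modn_small.
by rewrite IHk -addn1 modnDml addn1 addnS.
Qed.

Lemma ordS_reach i j : exists k, j = iter k (@ordS q) i.
Proof.
exists (j + (q - i))%N; apply/val_inj; rewrite iter_ordS.
rewrite addnCA subnKC; last exact/ltnW.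
by rewrite modnDr modn_small.
Qed.

Lemma iter_ordS_eigen (c : R) u k i :
  (forall i, u (ordS i) = c * u i) -> u (iter k (@ordS q) i) = c ^+ k * u i.
Proof. by move=> uS; elim: k => [|k IHk] /=; rewrite ?mul1r // uS IHk exprS mulrA. Qed.

(** One value determines a function that is multiplied by [c] at each step round the cycle. The case
    [c = 1] serves the largest eigenvalue, [c = -1] the kernel; both are thereby simple. *)
Lemma ordS_eigen_proportional (c : R) u v i j :
  (forall i, u (ordS i) = c * u i) -> (forall i, v (ordS i) = c * v i) ->
  u i * v j = u j * v i.
Proof.
move=> uS vS; have [k ->] := ordS_reach i j.
by rewrite (iter_ordS_eigen _ _ uS) (iter_ordS_eigen _ _ vS); ring.
Qed.

(** The signless Laplacian form of the cycle; the next lemma is its Laplacian form. Their positivity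
    amounts to |t| <= 2 for the adjacency eigenvalues t of the cycle. *)
Lemma sum_cyc_add u :
  \sum_i (u i * (u (ordS i) + u (ord_pred i)) + 2 * u i ^+ 2) = \sum_i (u i + u (ordS i)) ^+ 2.
Proof.
have E1 : \sum_i u i * u (ord_pred i) = \sum_i u i * u (ordS i).
  rewrite -(sum_ordS (fun i => u i * u (ord_pred i))).
  by apply: eq_bigr => i _; rewrite ordSK mulrC.
have E2 : \sum_i u (ordS i) ^+ 2 = \sum_i u i ^+ 2 := sum_ordS (fun i => u i ^+ 2).
under eq_bigr do rewrite mulrDr.
under [RHS]eq_bigr do rewrite sqrrD.
rewrite !big_split /= E1 E2 -mulr_sumr; ring.
Qed.

Lemma sum_cyc_sub u :
  \sum_i (2 * u i ^+ 2 - u i * (u (ordS i) + u (ord_pred i))) = \sum_i (u i - u (ordS i)) ^+ 2.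
Proof.
have := sum_cyc_add u; have E2 : \sum_i u (ordS i) ^+ 2 = \sum_i u i ^+ 2 := sum_ordS (fun i => u i ^+ 2).
under [\sum_i (u i + _) ^+ 2]eq_bigr do rewrite sqrrD.
under [\sum_i (u i - _) ^+ 2]eq_bigr do rewrite sqrrB.
rewrite !big_split /= !sumrN E2 !big_split /= -!mulr_sumr => H.

by lra.
Qed.

End CyclicOrdinals.

(** * Sums of squares on the jellyfish graph *)

Definition gap_form (V : finType) (e : rel V) (c : R) (g : V -> R) : R :=
  dot (fun x => Qop e g x - g x) (fun x => Qop e g x - c * g x).

(* The largest signless Laplacian eigenvalue of the jellyfish graph. *)
Lemma spectral_radius_exists (p : nat) : (1 <= p)%N ->
  exists2 l : R, 1 < l < p%:R + 5 & (l - 1) * (l - p%:R - 4) = p%:R.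
Proof.
move=> p1; have p1R : (1 : R) <= p%:R by rewrite (ler_nat _ 1).
(* Expanded, the equation is l^2 - (p + 5) l + 4 = 0, with this discriminant. *)
have [s s0 sE] : exists2 s : R, 0 <= s & s ^+ 2 = (p%:R + 5) ^+ 2 - 16.
  by apply: algR_sqrt; nra.
exists ((p%:R + 5 + s) / 2); last by nra.
by apply/andP; split; nra.
Qed.

Section JellyfishForms.
Variables p q : nat.
Hypothesis q3 : (3 <= q)%N.
Local Notation V := ('I_q * 'I_p.+1)%type.
Local Notation e := (jfg_adj p q).
Variable g : V -> R.
Let x i := g (core p i).
Let y i k := g (@leaf p q i k).

Lemma jfg_form : dot g (Qop e g) =
  \sum_i (p.+2%:R * x i ^+ 2 + x i * (x (ordS i) + x (ord_pred i))
          + \sum_k (2 * x i * y i k + y i k ^+ 2)).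
Proof.
rewrite dot_jfg; apply: eq_bigr => i _.
rewrite Qop_core // -/(x i) -/(x (ordS i)) -/(x (ord_pred i)).
under [\sum_k g _ * Qop _ _ _]eq_bigr do rewrite Qop_leaf // -/(x i) -/(y i _).
under [\sum_k g (leaf i k)]eq_bigr do rewrite -/(y i _).
rewrite !big_split /= -!mulr_sumr.
under [\sum_k y i k * (_ + _)]eq_bigr do rewrite mulrDr.
rewrite big_split /= -mulr_suml.
under [\sum_k y i k * y i k]eq_bigr do rewrite -expr2.
ring.
Qed.

Lemma jfg_sq : dot g g = \sum_i (x i ^+ 2 + \sum_k y i k ^+ 2).
Proof. exact: dot_jfg. Qed.

(** At a leaf, (Q - 1) g is the core value. The leaf terms cancel the mixed term in the core
    product, which leaves one square and p times the signless Laplacian form of the cycle.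
    Nonnegativity expresses the absence of eigenvalues in (1, p + 1). *)
Lemma jfg_gap : gap_form e (p%:R + 1) g =
  \sum_i ((x (ordS i) + x (ord_pred i) + x i + \sum_k y i k) ^+ 2
          + p%:R * (x i * (x (ordS i) + x (ord_pred i)) + 2 * x i ^+ 2)).
Proof.
rewrite /gap_form dot_jfg; apply: eq_bigr => i _.
rewrite Qop_core // -/(x i) -/(x (ordS i)) -/(x (ord_pred i)).
under [\sum_k (Qop _ _ _ - _) * _]eq_bigr do rewrite Qop_leaf // -/(x i) -/(y i _).
under [\sum_k g (leaf i k)]eq_bigr do rewrite -/(y i _).
have -> : \sum_k (y i k + x i - y i k) * (y i k + x i - (p%:R + 1) * y i k) =
   p%:R * x i ^+ 2 - p%:R * x i * \sum_k y i k.
  rewrite mulr_sumr -sumrN -[p in p%:R * _ ^+ 2]card_ord mulr_natl -sumr_const -big_split /=.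
  by apply: eq_bigr => k _; ring.
rewrite -!natr1; ring.
Qed.

Lemma jfg_gap_ge0 : 0 <= gap_form e (p%:R + 1) g.
Proof.
rewrite jfg_gap big_split /= -mulr_sumr (sum_cyc_add x).
apply: addr_ge0; first by apply: sumr_ge0 => i _; apply: sqr_ge0.
by apply: mulr_ge0; [apply: ler0n|apply: sumr_ge0 => i _; apply: sqr_ge0].
Qed.

(** The equation for [l] is exactly what balances the coefficient of x_i^2. The right side vanishes
    only for core values constant along the cycle and leaf values smaller by the factor l - 1, that
    is on multiples of the Perron eigenvector. *)
Lemma jfg_radius l : 1 < l -> (l - 1) * (l - p%:R - 4) = p%:R ->
  l * dot g g - dot g (Qop e g) =
  \sum_i ((x i - x (ordS i)) ^+ 2 + (l - 1) * \sum_k (y i k - (l - 1)^-1 * x i) ^+ 2).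
Proof.
move=> l1 lE; have l10 : l - 1 != 0 by rewrite subr_eq0 gt_eqF.
rewrite big_split /= -(sum_cyc_sub x) -big_split /= jfg_sq jfg_form mulr_sumr -sumrB.
apply: eq_bigr => i _.
have -> : (l - 1) * \sum_k (y i k - (l - 1)^-1 * x i) ^+ 2 =
  (l - 1) * (\sum_k y i k ^+ 2) - 2 * x i * \sum_k y i k + (l - p%:R - 4) * x i ^+ 2.
  have -> : (l - p%:R - 4) * x i ^+ 2 = \sum_(k < p) (l - 1)^-1 * x i ^+ 2.
    rewrite sumr_const card_ord -[RHS]mulr_natl mulrA; congr (_ * _).
    by apply: (mulfI l10); rewrite lE; field; exact: l10.
  rewrite !mulr_sumr -sumrN -!big_split /=; apply: eq_bigr => k _; field; exact: l10.
rewrite big_split /= -mulr_sumr -!natr1; ring.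
Qed.

End JellyfishForms.

(** * Quadratic forms on a cospectral graph *)

Section CospectralMate.
Variables p q : nat.
Hypothesis q3 : (3 <= q)%N.
Variables (W : finType) (f : rel W) (S : Q_isometry (jfg_adj p q) f).
Implicit Types h : W -> R.
Local Notation e := (jfg_adj p q).

Lemma pull_form h : dot (S h) (Qop e (S h)) = dot h (Qop f h).
Proof. by rewrite -(pull_dot S); apply: eq_dot => // v; apply: pull_Qop. Qed.

Lemma mate_gap_ge0 h : 0 <= gap_form f (p%:R + 1) h.
Proof.
have E c : (fun v => Qop e (S h) v - c * S h v) =1 S (fun w => Qop f h w - c * h w).
  move=> v; rewrite pull_Qop.
  have -> : S (fun w => Qop f h w - c * h w) v = S (fun w => 1 * Qop f h w + (- c) * h w) v.
    by apply: pull_ext => w; ring.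
  by rewrite pull_linear; ring.
have -> : gap_form f (p%:R + 1) h = gap_form e (p%:R + 1) (S h); last exact: jfg_gap_ge0.
rewrite /gap_form -(pull_dot S); apply: eq_dot => v; last by rewrite E.
by rewrite -[S h v]mul1r E; apply: pull_ext => w; rewrite mul1r.
Qed.

(** The pull-back is injective: if [S h v] is nonzero, then [S h v * h' - S h' v * h] has image
    zero, hence is zero. *)
Lemma pull_proportional h h' :
  (forall v v', S h v * S h' v' = S h v' * S h' v) ->
  forall w w', h w * h' w' = h w' * h' w.
Proof.
move=> SS w w'; have [/existsP[v v0]|/existsPn S0] := boolP [exists v, S h v != 0].
  have E : (fun w => S h v * h' w + (- S h' v) * h w) =1 fun=> 0.
    apply: (pull_eq0 (S := S)) => v'; rewrite pull_linear.
    by rewrite SS; ring.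
  have Ew := E w; have Ew' := E w'.
  apply: (mulfI v0).
  have -> : S h v * (h w * h' w') = h w * (S h v * h' w' - S h' v * h w') + S h' v * h w * h w' by ring.
  have -> : S h v * (h w' * h' w) = h w' * (S h v * h' w - S h' v * h w) + S h' v * h w * h w' by ring.
  by rewrite -!mulNr Ew Ew' !mulr0.
have h0 : h =1 fun=> 0 by apply: (pull_eq0 (S := S)) => v; apply/eqP; have := S0 v; rewrite negbK.
by rewrite !h0 !mul0r.
Qed.

Section Radius.
Variable l : R.
Hypotheses (l1 : 1 < l) (lE : (l - 1) * (l - p%:R - 4) = p%:R).

Lemma mate_radius h : 0 <= l * dot h h - dot h (Qop f h).
Proof.
rewrite -(pull_dot S) -pull_form (jfg_radius _ _ l1 lE) //.
apply: sumr_ge0 => i _; apply: addr_ge0; first exact: sqr_ge0.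
apply: mulr_ge0; first by rewrite subr_ge0 ltW.
by apply: sumr_ge0 => k _; apply: sqr_ge0.
Qed.

Lemma radius_eq h : l * dot h h = dot h (Qop f h) ->
  (forall i, S h (core p (ordS i)) = S h (core p i)) /\
  (forall i k, S h (leaf i k) = (l - 1)^-1 * S h (core p i)).
Proof.
move=> /eqP; rewrite -subr_eq0 -(pull_dot S) -pull_form (jfg_radius _ _ l1 lE) //.
have l10 : 0 < l - 1 by rewrite subr_gt0.
rewrite psumr_eq0 => [/allP H|i _]; last first.
  apply: addr_ge0; first exact: sqr_ge0.
  by apply: mulr_ge0; [exact: ltW|apply: sumr_ge0 => k _; apply: sqr_ge0].
have H1 i : (S h (core p i) - S h (core p (ordS i))) ^+ 2 == 0 /\
     (l - 1) * \sum_k (S h (leaf i k) - (l - 1)^-1 * S h (core p i)) ^+ 2 == 0.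
  have /= := H i (mem_index_enum _); rewrite paddr_eq0 ?sqr_ge0 // => [/andP[]//|].
  by apply: mulr_ge0; [exact: ltW|apply: sumr_ge0 => k _; apply: sqr_ge0].
split=> [i|i k].
  by have [+ _] := H1 i; rewrite sqrf_eq0 subr_eq0 => /eqP.
have [_ +] := H1 i; rewrite mulf_eq0 gt_eqF //= psumr_eq0 => [/allP|? _]; last exact: sqr_ge0.
by move=> /(_ k (mem_index_enum _)) /=; rewrite sqrf_eq0 subr_eq0 => /eqP.
Qed.

(** Equality in the Rayleigh bound makes every square of [jfg_radius] vanish, and the pull-back then
    satisfies the eigenvalue equation at each core and leaf. *)
Lemma mate_radius_eigen h : l * dot h h = dot h (Qop f h) -> Qop f h =1 fun w => l * h w.
Proof.
move=> /radius_eq[Hc Hl].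
have E : (fun w => 1 * Qop f h w + (- l) * h w) =1 fun=> 0.
  apply: (pull_eq0 (S := S)) => -[i k]; rewrite pull_linear -pull_Qop.
  have l10 : l - 1 != 0 by rewrite subr_eq0 gt_eqF.
  case: (unliftP ord0 k) => [k'|] ->.
    rewrite -[(i, lift _ _)]/(leaf i k') Qop_leaf Hl; field; exact: l10.
  rewrite (Qop_core q3) -/(core p i) Hc -(Hc (ord_pred i)) ord_predK.
  under eq_bigr do rewrite Hl.
  rewrite sumr_const card_ord -[_ *+ p]mulr_natl.
  have -> : p%:R * ((l - 1)^-1 * S h (core p i)) = (l - p%:R - 4) * S h (core p i).
    by apply: (mulfI l10); rewrite [RHS]mulrA lE; field; exact: l10.
  rewrite -!natr1; ring.
by move=> w; have := E w => /eqP; rewrite mul1r mulNr subr_eq0 => /eqP.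
Qed.

Lemma mate_radius_simple h h' :
  l * dot h h = dot h (Qop f h) -> l * dot h' h' = dot h' (Qop f h') ->
  forall w w', h w * h' w' = h w' * h' w.
Proof.
move=> /radius_eq[Hc Hl] /radius_eq[Hc' Hl'].
have P i j := @ordS_eigen_proportional q 1 _ _ i j (fun i => etrans (Hc i) (esym (mul1r _)))
  (fun i => etrans (Hc' i) (esym (mul1r _))).
apply: pull_proportional => -[i k] [j m].
case: (unliftP ord0 k) => [k'|] ->; case: (unliftP ord0 m) => [m'|] ->;
  rewrite -?/(leaf i _) -?/(leaf j _) -?/(core p i) -?/(core p j) ?Hl ?Hl'.
- by rewrite mulrACA P mulrACA.
- by rewrite -mulrA P; ring.
- by rewrite mulrCA P; ring.
- exact: P.
Qed.

End Radius.

(** The leaf equations make each leaf value minus its core value. The core equations become those of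
    the signless Laplacian of the cycle, so every (x_i + x_{i+1})^2 vanishes. *)
Lemma kernel_eq h : Qop f h =1 (fun=> 0) ->
  (forall i, S h (core p (ordS i)) = -1 * S h (core p i)) /\
  (forall i k, S h (leaf i k) = -1 * S h (core p i)).
Proof.
move=> H0; have Q0 v : Qop e (S h) v = 0.
  have /(_ v) := pull_Qop S h => ->.
  have -> : S (Qop f h) v = S (fun w => 0 * h w + 0 * h w) v.
    by apply: pull_ext => w; rewrite H0 !mul0r addr0.
  by rewrite pull_linear !mul0r addr0.
have Hl i k : S h (leaf i k) = -1 * S h (core p i).
  by have := Q0 (leaf i k); rewrite Qop_leaf // mulN1r => /eqP; rewrite addr_eq0 => /eqP.
split=> // i; have := sum_cyc_add (fun i => S h (core p i)).
rewrite [LHS]big1 => [/esym/eqP|j _]; last first.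
  have := Q0 (core p j); rewrite Qop_core //.
  under eq_bigr do rewrite Hl.
  rewrite sumr_const card_ord mulN1r -[_ *+ p]mulr_natl -!natr1 => E.
  rewrite -[RHS](mulr0 (S h (core p j))) -E; ring.
rewrite psumr_eq0 => [/allP/(_ i (mem_index_enum _))|? _]; last exact: sqr_ge0.
by rewrite /= sqrf_eq0 addrC addr_eq0 mulN1r => /eqP.
Qed.

(** Core values change sign at each step, and q steps return to the start. *)
Lemma mate_kernel_odd h : odd q -> Qop f h =1 (fun=> 0) -> h =1 fun=> 0.
Proof.
move=> oq /kernel_eq[Hc Hl].
have c0 i : S h (core p i) = 0.
  have := iter_ordS_eigen q i Hc; have -> : iter q (@ordS q) i = i.
    by apply/val_inj; rewrite iter_ordS modnDr modn_small.
  by rewrite -signr_odd oq expr1 => E; lra.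
apply: (pull_eq0 (S := S)) => -[i k].
by case: (unliftP ord0 k) => [k'|] ->; rewrite -?/(leaf i _) -?/(core p i) ?Hl c0 ?mulr0.
Qed.

Lemma mate_kernel_simple h h' : Qop f h =1 (fun=> 0) -> Qop f h' =1 (fun=> 0) ->
  forall w w', h w * h' w' = h w' * h' w.
Proof.
move=> /kernel_eq[Hc Hl] /kernel_eq[Hc' Hl'].
have P i j := @ordS_eigen_proportional q (-1) _ _ i j Hc Hc'.
apply: pull_proportional => -[i k] [j m].
case: (unliftP ord0 k) => [k'|] ->; case: (unliftP ord0 m) => [m'|] ->;
  rewrite -?/(leaf i _) -?/(leaf j _) -?/(core p i) -?/(core p j) ?Hl ?Hl'.
- by rewrite mulrACA P mulrACA.
- by rewrite -mulrA P; ring.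
- by rewrite mulrCA P; ring.
- exact: P.
Qed.

End CospectralMate.

(** * Dimension counts for the form of Q - 1 *)

Lemma dot_delta (V : finType) (v : V) (g : V -> R) : dot (fun w => (w == v)%:R) g = g v.
Proof.
rewrite /dot (bigD1 v) //= eqxx mul1r big1 ?addr0 // => w wv.
by rewrite (negPf wv) mul0r.
Qed.

Section CospectralDimensions.
Variables p q : nat.
Hypothesis q3 : (3 <= q)%N.
Variables (W : finType) (f : rel W) (S : Q_isometry (jfg_adj p q) f).
Local Notation e := (jfg_adj p q).
Variables (B : finType) (psi : B -> W -> R).

Local Notation comb c := (fun w => \sum_b c b * psi b w).
Local Notation excess h := (dot h (Qop f h) - dot h h).

Lemma pull_excess h : excess h =
  \sum_i ((p%:R + 1) * S h (core p i) ^+ 2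
    + S h (core p i) * (S h (core p (ordS i)) + S h (core p (ord_pred i)))
    + 2 * S h (core p i) * \sum_k S h (leaf i k)).
Proof.
rewrite -(pull_form S) -(pull_dot S) jfg_form // jfg_sq -sumrB.
apply: eq_bigr => i _; rewrite big_split /= -mulr_sumr -!natr1; ring.
Qed.

(** Functions vanishing on the core have excess 0 and are cut out by q equations, so no space of
    dimension above q has positive excess. *)
Lemma mate_excess_le0 : (q < #|B|)%N ->
  exists2 c : B -> R, exists b, c b != 0 & excess (comb c) <= 0.
Proof.
move=> qB; have [|c c0 cE] := pull_constrained S psi (fun i v => (v == core p i)%:R).
  by rewrite card_ord.
exists c => //; rewrite pull_excess big1 // => i _.
have E j := cE j; have {}E j : S (comb c) (core p j) = 0 by have := E j; rewrite dot_delta.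
by rewrite !E; ring.
Qed.

(** The opposite count: q p equations cut out a q-dimensional space on which the excess is negative
    definite, so a space with nonnegative excess has dimension at most q p. *)
Lemma mate_excess_lt0 : (1 <= p)%N -> (q * p < #|B|)%N ->
  exists2 c : B -> R, exists b, c b != 0 & 0 <= excess (comb c) -> comb c =1 fun=> 0.
Proof.
(* The equations give the first leaf of each star -(p + 2) times its core value and all other leaves
   0. The excess becomes -(p + 1) sum x_i^2 - sum (x_i - x_{i+1})^2. *)
move=> p1 qB; have [|c c0 cE] := pull_constrained S psi
  (fun (j : 'I_q * 'I_p) v => (v == leaf j.1 j.2)%:R
        + (val j.2 == 0%N)%:R * (p.+2%:R * (v == core p j.1)%:R)).
  by rewrite card_prod !card_ord.
exists c => // E0; set h := comb c in E0 *.
have yE i k : S h (leaf i k) = - ((val k == 0%N)%:R * (p.+2%:R * S h (core p i))).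
  have := cE (i, k); rewrite /dot; under eq_bigr do rewrite mulrDl -!mulrA.
  rewrite big_split /= -!mulr_sumr.
  have := dot_delta (leaf i k) (S h); have := dot_delta (core p i) (S h).
  by rewrite /dot => -> -> /eqP; rewrite addr_eq0 => /eqP.
have YE i : \sum_k S h (leaf i k) = - (p.+2%:R * S h (core p i)).
  rewrite (bigD1 (Ordinal p1)) //= yE eqxx mul1r big1 ?addr0 // => k k0.
  rewrite yE; have -> : (val k == 0%N) = false by apply/negP=> /eqP H; case/eqP: k0; apply/val_inj.
  by rewrite mul0r oppr0.
have xs : 0 <= - \sum_i (p%:R + 1) * S h (core p i) ^+ 2.
  apply: le_trans E0 _; rewrite pull_excess.
  have := sum_cyc_sub (fun i => S h (core p i)).
  set s1 := \sum_i _ => Es.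
  have s0 : 0 <= s1 by rewrite Es; apply: sumr_ge0 => i _; apply: sqr_ge0.
  rewrite -subr_ge0 (_ : _ - _ = s1) // -sumrN -sumrB; apply: eq_bigr => i _.
  rewrite YE -!natr1; ring.
have x0 i : S h (core p i) = 0.
  have p0 : 0 < p%:R + 1 :> R by rewrite ltr_wpDl ?ler0n ?ltr01.
  move: xs; rewrite oppr_ge0 => xs.
  have /eqP := le_anti (introT andP (conj xs (sumr_ge0 _ (fun i _ => mulr_ge0 (ltW p0) (sqr_ge0 (S h (core p i))))))).
  rewrite psumr_eq0 => [/allP/(_ i (mem_index_enum _))|? _]; last by apply: mulr_ge0; rewrite ?sqr_ge0 // ltW.
  by rewrite /= mulf_eq0 gt_eqF //= sqrf_eq0 => /eqP.
apply: (pull_eq0 (S := S)) => -[i k].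
case: (unliftP ord0 k) => [k'|] ->; rewrite -?/(leaf i _) -?/(core p i) ?yE x0 //.
by rewrite !mulr0 oppr0.
Qed.

End CospectralDimensions.

(** The leaf equation forces core value 0; the core equation then makes the sum of its leaves 0, and
    there is only one leaf. *)
Lemma mate_eigen1_p1 q (W : finType) (f : rel W) (S : Q_isometry (jfg_adj 1 q) f) h :
  (3 <= q)%N -> Qop f h =1 h -> h =1 fun=> 0.
Proof.
move=> q3 H; have Q1 v : Qop (jfg_adj 1 q) (S h) v = S h v.
  by have /(_ v) := pull_Qop S h => ->; apply: pull_ext.
have x0 i : S h (core 1 i) = 0.
  by have := Q1 (leaf i ord0); rewrite Qop_leaf => /eqP; rewrite -subr_eq0 addrAC subrr add0r => /eqP.
apply: (pull_eq0 (S := S)) => -[i k].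
case: (unliftP ord0 k) => [k'|] ->; rewrite -?/(leaf i _) -?/(core 1 i) ?x0 //.
have := Q1 (core 1 i); rewrite Qop_core // !x0 mulr0 !add0r => /esym.
by rewrite big_ord1 => ->; rewrite (ord1 k').
Qed.

(** * Moments of the degrees *)

(** In a simple graph this counts common neighbours off the diagonal and is the degree on it;
    [closed3] is then twice the number of triangles at a vertex. *)
Definition codeg (V : finType) (e : rel V) (x y : V) : nat := (\sum_(z | e x z) e z y)%N.
Definition closed3 (V : finType) (e : rel V) (x : V) : nat := (\sum_(y | e x y) codeg e x y)%N.

Section Moments.
Variables (V : finType) (e : rel V).
Hypotheses (se : symmetric e) (ie : irreflexive e).
Local Notation d := (deg e).

Lemma codegC x y : codeg e x y = codeg e y x.
Proof.
rewrite /codeg big_mkcond [RHS]big_mkcond; apply: eq_bigr => z _.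
by rewrite (se x z) (se z y); case: (e z x); case: (e y z).
Qed.

Lemma codeg_diag x : codeg e x x = d x.
Proof. by rewrite deg_sum; apply: eq_bigr => z; rewrite se => ->. Qed.

Lemma sum_codeg : (\sum_x \sum_y codeg e x y = \sum_x d x ^ 2)%N.
Proof.
have E x : (\sum_y codeg e x y = \sum_(z | e x z) d z)%N.
  rewrite /codeg exchange_big /=; apply: eq_bigr => z _.
  by rewrite deg_sum [RHS]big_mkcond; apply: eq_bigr => y _; case: e.
under eq_bigr do rewrite E.
rewrite (exchange_big_dep predT) //=; apply: eq_bigr => z _.
rewrite sum_nat_const expnS expn1; congr muln.
by rewrite /deg cardsE; apply: eq_card => x; apply: se.
Qed.

Lemma Qker2_E x y : kmul (Qker e) (Qker e) x y =
  (codeg e x y)%:R + (e x y)%:R * (d x + d y)%:R + (x == y)%:R * (d x ^ 2)%:R.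
Proof.
rewrite /kmul /Qker; under eq_bigr do rewrite mulrDl !mulrDr.
rewrite !big_split /=.
have -> : \sum_z (e x z)%:R * (e z y)%:R = (codeg e x y)%:R :> R.
  rewrite /codeg natr_sum [RHS]big_mkcond; apply: eq_bigr => z _.
  by case: (e x z); rewrite ?mul1r ?mul0r.
have -> : \sum_z (e x z)%:R * ((z == y)%:R * (d z)%:R) = (e x y)%:R * (d y)%:R :> R.
  rewrite (bigD1 y) //= eqxx mul1r big1 ?addr0 // => z zy.
  by rewrite (negPf zy) mul0r mulr0.
have -> : \sum_z (x == z)%:R * (d x)%:R * (e z y)%:R = (e x y)%:R * (d x)%:R :> R.
  rewrite (bigD1 x) //= eqxx mul1r big1 ?addr0 1?mulrC // => z zx.
  by rewrite eq_sym (negPf zx) !mul0r.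
have -> : \sum_z (x == z)%:R * (d x)%:R * ((z == y)%:R * (d z)%:R) = (x == y)%:R * (d x ^ 2)%:R :> R.
  rewrite (bigD1 x) //= eqxx mul1r big1 ?addr0 => [|z zx].
    by rewrite mulrCA; congr (_ * _); rewrite -natrM mulnn.
  by rewrite eq_sym (negPf zx) !mul0r.
rewrite natrD; ring.
Qed.

Lemma trace1_E : \sum_x Qker e x x = (\sum_x d x)%:R.
Proof.
rewrite natr_sum; apply: eq_bigr => x _.
by rewrite /Qker ie eqxx add0r mul1r.
Qed.

Lemma trace2_E : \sum_x kmul (Qker e) (Qker e) x x = (\sum_x (d x + d x ^ 2))%:R.
Proof.
rewrite natr_sum; apply: eq_bigr => x _.
by rewrite Qker2_E ie eqxx mul0r addr0 mul1r codeg_diag natrD.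
Qed.

Lemma sum_nbr_const (M : nmodType) (F : V -> M) x : \sum_(y | e x y) F x = F x *+ d x.
Proof. by rewrite sumr_const /deg cardsE. Qed.

Lemma sum_nbr_sym (M : nmodType) (F : V -> V -> M) :
  \sum_x \sum_(y | e x y) F x y = \sum_x \sum_(y | e x y) F y x.
Proof.
rewrite (exchange_big_dep predT) //=; apply: eq_bigr => z _.
by apply: eq_bigl => x; rewrite se.
Qed.

Lemma trace3_E : \sum_x kmul (Qker e) (kmul (Qker e) (Qker e)) x x =
  (\sum_x (d x ^ 3 + 3 * d x ^ 2 + closed3 e x))%:R.
Proof.
have E x : kmul (Qker e) (kmul (Qker e) (Qker e)) x x =
    (d x)%:R * (d x + d x ^ 2)%:R + (closed3 e x)%:R + \sum_(y | e x y) (d x + d y)%:R.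
  rewrite {1}/kmul (bigD1 x) //= {1}/Qker ie eqxx add0r mul1r.
  rewrite Qker2_E ie eqxx mul0r addr0 mul1r codeg_diag -natrD -addrA; congr (_ + _).
  rewrite /closed3 natr_sum -big_split /= big_mkcond [RHS]big_mkcond /=.
  apply: eq_bigr => y _; case: eqP => [->|/eqP yx] /=; first by rewrite ie.
  rewrite /Qker eq_sym (negPf yx) mul0r addr0 Qker2_E (se y) (negPf yx) mul0r addr0.
  by case: (e x y); rewrite ?mul0r // !mul1r codegC addnC.
rewrite (eq_bigr _ (fun x _ => E x)) big_split /=.
have -> : \sum_x \sum_(y | e x y) (d x + d y)%:R = \sum_x (2 * d x ^ 2)%:R :> R.
  under eq_bigr do under eq_bigr do rewrite natrD.
  under eq_bigr do rewrite big_split /=.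
  rewrite big_split /= -(sum_nbr_sym (fun x y => (d x)%:R)) -big_split /=.
  apply: eq_bigr => x _; rewrite (sum_nbr_const (fun x => (d x)%:R)).
  by rewrite -mulr2n -!mulrnA; congr (_ *+ _); rewrite -mulnn; lia.
rewrite -big_split natr_sum; apply: eq_bigr => x _ /=.
rewrite -natrM -!natrD; congr (_%:R); lia.
Qed.

(** The deviation from 3, the core degree when p = 1. *)
Definition defect x : R := 3 - (d x)%:R.
(** Eight times the number of 4-cycles: each has four ordered pairs of opposite vertices, with two
    orders of the common neighbours. *)
Definition excess_codeg : nat := (\sum_x \sum_(y | y != x) codeg e x y * (codeg e x y).-1)%N.

(** On an edge, Q^2 has the entry [codeg] + d_x + d_y, so subtracting 6 Q leaves [codeg] minus both
    defects: 6 is the constant that cancels the degrees between vertices of degree 3. The trace sums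
    the squared entries, and c^2 = c + c (c - 1) separates the 4-cycles from the degrees. *)
Lemma trace4_E : let M x y := kmul (Qker e) (Qker e) x y - 6 * Qker e x y in
  \sum_x kmul M M x x =
  \sum_x (((d x)%:R ^+ 2 - 5 * (d x)%:R) ^+ 2 + (d x)%:R ^+ 2 - (d x)%:R
          + 2 * (d x)%:R * defect x ^+ 2 - 4 * defect x * (closed3 e x)%:R)
  + 2 * (\sum_x \sum_(y | e x y) defect x * defect y) + excess_codeg%:R.
Proof.
move=> M.
have Mxx x : M x x = (d x)%:R ^+ 2 - 5 * (d x)%:R.
  rewrite /M Qker2_E /Qker ie eqxx codeg_diag !mul0r !mul1r natrX /=; ring.
have Mxy x y : y != x -> M x y = (codeg e x y)%:R - (e x y)%:R * (defect x + defect y).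
  move=> yx; rewrite /M Qker2_E /Qker eq_sym (negPf yx) !mul0r !addr0 natrD /defect; ring.
have E x : kmul M M x x = ((d x)%:R ^+ 2 - 5 * (d x)%:R) ^+ 2
    + \sum_(y | y != x) ((codeg e x y)%:R + (codeg e x y * (codeg e x y).-1)%:R)
    + \sum_(y | e x y) (- 2 * (codeg e x y)%:R * (defect x + defect y) + (defect x + defect y) ^+ 2).
  rewrite /kmul (bigD1 x) //= !Mxx -expr2 -addrA; congr (_ + _).
  rewrite [\sum_(y | e x y) _]big_mkcond [X in _ = _ + X](bigD1 x) //= ie add0r -big_split /=.
  apply: eq_bigr => y yx; rewrite Mxy // Mxy 1?eq_sym // codegC se.
  have -> : (codeg e y x)%:R + (codeg e y x * (codeg e y x).-1)%:R = (codeg e y x)%:R ^+ 2 :> R.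
    by rewrite -natrD -natrX; congr (_%:R); case: (codeg e y x) => // n; rewrite /= -mulnS mulnn.
  by case: (e y x); rewrite ?mul1r ?mul0r ?subr0 ?addr0; ring.
rewrite (eq_bigr _ (fun x _ => E x)) [in LHS]big_split [in LHS]big_split /=.
have -> : \sum_x \sum_(y | y != x) ((codeg e x y)%:R + (codeg e x y * (codeg e x y).-1)%:R) =
   \sum_x ((d x)%:R ^+ 2 - (d x)%:R) + excess_codeg%:R :> R.
  under eq_bigr do rewrite big_split /=.
  rewrite big_split /= /excess_codeg [in RHS]natr_sum; congr (_ + _); last first.
    by apply: eq_bigr => x _; rewrite natr_sum.
  have : \sum_x \sum_y (codeg e x y)%:R = \sum_x (d x)%:R ^+ 2 :> R.
    under eq_bigr do rewrite -natr_sum; rewrite -natr_sum sum_codeg natr_sum.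
    by apply: eq_bigr => x _; rewrite natrX.
  rewrite sumrB => <-; rewrite -sumrB; apply: eq_bigr => x _.
  by rewrite [in RHS](bigD1 x) //= codeg_diag addrC addrK.
have -> : \sum_x \sum_(y | e x y) (- 2 * (codeg e x y)%:R * (defect x + defect y) + (defect x + defect y) ^+ 2) =
   \sum_x (2 * (d x)%:R * defect x ^+ 2 - 4 * defect x * (closed3 e x)%:R)
   + 2 * (\sum_x \sum_(y | e x y) defect x * defect y).
  pose F x y := - 2 * (codeg e x y)%:R * defect x + defect x ^+ 2 + defect x * defect y.
  transitivity (\sum_x \sum_(y | e x y) F x y + \sum_x \sum_(y | e x y) F y x).
    rewrite -big_split; apply: eq_bigr => x _; rewrite -big_split.
    by apply: eq_bigr => y _; rewrite /F /= (codegC y x); ring.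
  rewrite -(sum_nbr_sym F).
  have -> : \sum_x \sum_(y | e x y) F x y =
      \sum_x ((d x)%:R * defect x ^+ 2 - 2 * defect x * (closed3 e x)%:R)
      + \sum_x \sum_(y | e x y) defect x * defect y.
    rewrite -big_split; apply: eq_bigr => x _ /=.
    rewrite /F !big_split /= (sum_nbr_const (fun x => defect x ^+ 2)).
    rewrite -mulr_suml -mulr_sumr -natr_sum -/(closed3 e x) -[defect x ^+ 2 *+ _]mulr_natl.
    ring.
  have -> : \sum_x (2 * (d x)%:R * defect x ^+ 2 - 4 * defect x * (closed3 e x)%:R) =
      2 * \sum_x ((d x)%:R * defect x ^+ 2 - 2 * defect x * (closed3 e x)%:R).
    by rewrite mulr_sumr; apply: eq_bigr => x _; ring.
  ring.
have -> : \sum_x (((d x)%:R ^+ 2 - 5 * (d x)%:R) ^+ 2 + (d x)%:R ^+ 2 - (d x)%:R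
          + 2 * (d x)%:R * defect x ^+ 2 - 4 * defect x * (closed3 e x)%:R) =
   \sum_x ((d x)%:R ^+ 2 - 5 * (d x)%:R) ^+ 2 + \sum_x ((d x)%:R ^+ 2 - (d x)%:R)
   + \sum_x (2 * (d x)%:R * defect x ^+ 2 - 4 * defect x * (closed3 e x)%:R) :> R.
  by rewrite -!big_split; apply: eq_bigr => x _ /=; ring.
ring.
Qed.

End Moments.

(** * Moments of the jellyfish graph and of its mates *)

Lemma iter_ordS_id q k (i : 'I_q) : iter k (@ordS q) i = i -> (q %| k)%N.
Proof.
move=> /(congr1 val) /=; rewrite iter_ordS -[in RHS](modn_small (ltn_ord i)) => /eqP.
by rewrite -[X in _ == (X %% _)%N]addn0 eqn_modDl mod0n.
Qed.

Section JellyfishMoments.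
Variables p q : nat.
Hypothesis q3 : (3 <= q)%N.
Local Notation e := (jfg_adj p q).
Implicit Types i j : 'I_q.

Lemma sum_jfg_deg (M : nmodType) (F : nat -> M) :
  \sum_x F (deg e x) = F p.+2 *+ q + F 1%N *+ (q * p).
Proof.
rewrite sum_jfg big_split /=; congr (_ + _).
  by under eq_bigr do rewrite deg_core //; rewrite sumr_const card_ord.
under eq_bigr do under eq_bigr do rewrite deg_leaf //.
by under eq_bigr do rewrite sumr_const card_ord; rewrite sumr_const card_ord mulnC mulrnA.
Qed.

Lemma codeg_leaf i k y : codeg e (leaf i k) y = e (core p i) y.
Proof. exact: (nbr_leaf (M := nat) (fun z => nat_of_bool (e z y))). Qed.

Lemma codeg_core i y : codeg e (core p i) y =
  (e (core p (ordS i)) y + e (core p (ord_pred i)) y + \sum_k e (leaf i k) y)%N.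
Proof. exact: (nbr_core q3 (M := nat) (fun z => nat_of_bool (e z y))). Qed.

Lemma ordS_neq i : (i == ordS i) = false.
Proof.
have [_ /(_ (core p i))] := jfg_simple p q3.
by rewrite jfg_core_core // => /norP[/negPf].
Qed.

Lemma ord_pred_neq i : (i == ord_pred i) = false.
Proof. by rewrite -(inj_eq (@ordS_inj q)) ord_predK eq_sym ordS_neq. Qed.

Lemma codeg_core_core i j : i != j -> codeg e (core p i) (core p j) =
  ((j == ordS (ordS i)) + (j == ord_pred (ord_pred i)))%N.
Proof.
move=> ij; rewrite codeg_core !jfg_core_core // ordSK ord_predK.
rewrite [j == i]eq_sym (negPf ij) orbF /= big1 ?addn0 // => k _.
by rewrite jfg_leaf_core eq_sym (negPf ij).
Qed.

Lemma ordS2_pred i : (ordS (ordS i) == ord_pred i) = (q == 3).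
Proof.
have -> : (ordS (ordS i) == ord_pred i) = (iter 3 (@ordS q) i == i).
  by rewrite -(inj_eq (@ordS_inj q)) ord_predK.
apply/eqP/eqP => [/iter_ordS_id /dvdn_leq|E].
  by move/(_ isT) => q3'; apply/eqP; rewrite eqn_leq q3 q3'.
have F k : k = q -> iter k (@ordS q) i = i.
  by move=> ->; apply/val_inj; rewrite iter_ordS modnDr modn_small.
exact: F (esym E).
Qed.

Lemma closed3_core i : closed3 e (core p i) = (2 * (q == 3))%N.
Proof.
have -> : closed3 e (core p i) = (codeg e (core p i) (core p (ordS i)) +
    codeg e (core p i) (core p (ord_pred i)) + \sum_k codeg e (core p i) (leaf i k))%N.
  exact: (nbr_core q3 (M := nat) (fun z => codeg e (core p i) z)).
have [se ie] := jfg_simple p q3.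
rewrite big1 ?addn0 => [|k _]; last by rewrite codegC // codeg_leaf ie.
rewrite !codeg_core_core ?ordS_neq ?ord_pred_neq //.
rewrite ?ordS_neq ?ord_pred_neq [ord_pred i == _]eq_sym ordS2_pred addn0 add0n.
by rewrite -[ordS i == _](inj_eq (@ordS_inj q)) ord_predK ordS2_pred; case: eqP.
Qed.

Lemma closed3_leaf i k : closed3 e (leaf i k) = 0%N.
Proof.
have -> : closed3 e (leaf i k) = codeg e (leaf i k) (core p i).
  exact: (nbr_leaf (M := nat) (fun z => codeg e (leaf i k) z)).
by rewrite codeg_leaf; have [_ ->] := jfg_simple p q3.
Qed.

Lemma sum_closed3_jfg : (\sum_x closed3 e x = 2 * (q == 3) * q)%N.
Proof.
rewrite (sum_jfg (M := nat)).
transitivity (\sum_(i < q) (2 * (q == 3)))%N; last by rewrite sum_nat_const card_ord mulnC.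
apply: eq_bigr => i _; rewrite closed3_core big1 => [|k _]; first exact: addn0.
exact: closed3_leaf.
Qed.

End JellyfishMoments.

(** A leaf shares at most one neighbour with any vertex, and two core vertices share two only when
    opposite on a cycle of length 4. *)
Lemma excess_codeg_jfg q : (4 <= q)%N -> (excess_codeg (jfg_adj 1 q) <= 8 * (q == 4))%N.
Proof.
move=> q4; have q3 : (3 <= q)%N by apply: ltnW.
have [se ie] := jfg_simple 1 q3.
set e := jfg_adj 1 q in se ie *.
have S4 (i : 'I_q) : (ordS (ordS i) == ord_pred (ord_pred i)) = (q == 4).
  have -> : (ordS (ordS i) == ord_pred (ord_pred i)) = (iter 4 (@ordS q) i == i).
    by rewrite -(inj_eq (@ordS_inj q)) ord_predK -(inj_eq (@ordS_inj q)) ord_predK.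
  apply/eqP/eqP => [/iter_ordS_id /dvdn_leq|E].
    by move/(_ isT) => q4'; apply/eqP; rewrite eqn_leq q4 q4'.
  have F k : k = q -> iter k (@ordS q) i = i.
    by move=> ->; apply/val_inj; rewrite iter_ordS modnDr modn_small.
  exact: F (esym E).
pose b x y := (codeg e x y * (codeg e x y).-1)%N.
have b_le1 x y : (codeg e x y <= 1)%N -> b x y = 0%N.
  by rewrite /b; case: (codeg e x y) => [|[]].
have bl (i : 'I_q) k y : b (leaf i k) y = 0%N by apply: b_le1; rewrite codeg_leaf leq_b1.
have bl' (i : 'I_q) k y : b y (leaf i k) = 0%N by rewrite /b codegC //; apply: bl.
have bc (i : 'I_q) : (\sum_(y | y != core 1 i) b (core 1 i) y <= 2 * (q == 4))%N.
  rewrite big_mkcond (sum_jfg (M := nat)) /=.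
  have -> : (2 * (q == 4) = \sum_(j < q) (if j == ordS (ordS i) then 2 * (q == 4) else 0))%N.
    by rewrite -big_mkcond big_pred1_eq.
  apply: leq_sum => j _; rewrite big1 => [|k _]; last by rewrite bl'; case: ifP.
  rewrite addr0; case: eqP => //= /eqP ji.
  have ij : i != j by apply: contraNneq ji => ->.
  rewrite /b codeg_core_core //; case: (j =P ordS (ordS i)) => [->|_].
    by rewrite S4; case: eqP.
  by case: eqP.
rewrite /excess_codeg (sum_jfg (M := nat)).
apply: (@leq_trans (\sum_(i < q) 2 * (q == 4))%N).
  apply: leq_sum => i _; rewrite [X in _ + X]big1 => [|k _]; first by rewrite addr0; apply: bc.
  by apply: big1 => y _; apply: bl.
by rewrite sum_nat_const card_ord; case: eqP => [->|]; rewrite ?muln0.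
Qed.

(** The traces of Q, Q^2 and Q^3 in linear combination, so that each use can choose a cubic in the
    degree with convenient zeros; over the integers, for the sake of integrality arguments. *)
Lemma mate_moments p q (W : finType) (f : rel W) : (3 <= q)%N ->
  simple_graph f -> Q_cospectral (jfg_adj p q) f ->
  forall a b c k : int,
  \sum_w (a * ((deg f w)%:R ^+ 3 + (closed3 f w)%:R) + b * (deg f w)%:R ^+ 2 + c * (deg f w)%:R + k) =
  q%:R * (a * p.+2%:R ^+ 3 + b * p.+2%:R ^+ 2 + c * p.+2%:R + k)
  + q%:R * p%:R * (a + b + c + k) + a * (2 * (q == 3) * q)%N%:R.
Proof.
move=> q3 [sf jf] cos a b c k; have [se je] := jfg_simple p q3.
have [S [t1 t2 t3 _]] := cospectral_isometry se sf cos.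
have natI m n : m%:R = n%:R :> R -> m%:R = n%:R :> int.
  by move=> /eqP; rewrite eqr_nat => /eqP->.
have card_eq : #|W| = (q + q * p)%N.
  by case: cos => <- _; rewrite card_prod !card_ord mulnS.
move: t1 t2 t3; rewrite !trace1_E // !trace2_E // !trace3_E //.
move=> /natI t1 /natI t2 /natI t3.
have jfg_sum (F : nat -> int) :
    \sum_x F (deg (jfg_adj p q) x) = q%:R * F p.+2 + q%:R * p%:R * F 1%N.
  by rewrite (sum_jfg_deg p q3) -[_ *+ q]mulr_natl -[_ *+ (q * p)]mulr_natl natrM.
have D1 : \sum_w (deg f w)%:R = q%:R * p.+2%:R + q%:R * p%:R :> int.
  by rewrite -natr_sum t1 natr_sum (jfg_sum (fun d => d%:R)) mulr1.
have D2 : \sum_w (deg f w)%:R ^+ 2 = q%:R * p.+2%:R ^+ 2 + q%:R * p%:R :> int.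
  move: t2; rewrite !natr_sum; under eq_bigr do rewrite natrD natrX.
  under [RHS]eq_bigr do rewrite natrD natrX.
  rewrite (jfg_sum (fun d => d%:R + d%:R ^+ 2)) big_split /= D1 => H.
  by apply: (addrI (q%:R * p.+2%:R + q%:R * p%:R)); rewrite H expr1n; ring.
have D3 : \sum_w ((deg f w)%:R ^+ 3 + (closed3 f w)%:R) =
    q%:R * p.+2%:R ^+ 3 + q%:R * p%:R + (2 * (q == 3) * q)%N%:R :> int.
  have E d : (d ^ 3 + 3 * d ^ 2)%N%:R = d%:R ^+ 3 + 3%:R * d%:R ^+ 2 :> int.
    by rewrite natrD natrX natrM natrX.
  move: t3; rewrite !natr_sum; under eq_bigr do rewrite natrD E addrAC.
  under [RHS]eq_bigr do rewrite natrD E.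
  rewrite [RHS]big_split /= -[\sum_x (closed3 _ x)%:R]natr_sum (sum_closed3_jfg p q3).
rewrite (jfg_sum (fun d => d%:R ^+ 3 + 3%:R * d%:R ^+ 2)) big_split /= -mulr_sumr D2 => H.
  apply: (addIr (3%:R * (q%:R * p.+2%:R ^+ 2 + q%:R * p%:R))); rewrite H !expr1n; ring.
rewrite !big_split /= -!mulr_sumr D1 D2 D3 sumr_const card_eq.
rewrite -[k *+ _]mulr_natl natrD natrM; ring.
Qed.

Lemma closed3_eq0 (W : finType) (f : rel W) w x y :
  closed3 f w = 0%N -> f w x -> f w y -> f y x = false.
Proof.
move=> /eqP; rewrite sum_nat_eq0 => /forallP/(_ x) /implyP H wx wy.
have /eqP := H wx; rewrite /codeg => /eqP; rewrite sum_nat_eq0 => /forallP/(_ y).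
by rewrite wy /= eqb0 => /negPf.
Qed.

(* A triangle-free graph on six vertices with a vertex of degree four is bipartite. *)
Lemma bipartite_six (W : finType) (f : rel W) w : simple_graph f ->
  #|W| = 6%N -> deg f w = 4%N -> closed3 f w = 0%N ->
  exists2 h : W -> R, Qop f h =1 (fun=> 0) & h w != 0.
Proof.
move=> [sf jf] W6 dw cw; exists (fun x => if f w x then -1 else 1); last first.
  by rewrite jf oner_eq0.
move=> x; rewrite Qop_E; set s := if f w x then _ else _.
have E y : f x y -> (if f w y then -1 else 1) = - s :> R.
  move=> xy; rewrite /s; case: ifP => wy; case: ifP => wx; rewrite ?opprK //.
    by have := closed3_eq0 cw wy wx; rewrite xy.
  (* Only two vertices lie outside the neighbourhood of [w], and [w] is one of them, so an edge
     cannot have both ends there. *)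
  pose A := ~: [set y | f w y].
  have A2 : #|A| = 2%N by have := cardsC [set y | f w y]; rewrite -/A -/(deg f w) dw W6 => -[].
  have xy' : x != y by apply: contraTneq xy => ->; rewrite jf.
  have [wx' wy'] : w != x /\ w != y.
    by split; apply: contraTneq xy => <-; rewrite ?wy // sf wx.
  have : (w |: [set x; y] \subset A)%N.
    by apply/subsetP=> z; rewrite !inE => /or3P[]/eqP->; rewrite ?jf ?wx ?wy.
  move/subset_leq_card; rewrite A2 cardsU1 !inE cards2 xy'.
  by rewrite (negPf wx') (negPf wy').
rewrite (eq_bigr _ E) (sum_nbr_const _ (fun=> - s)) mulNrn -[s *+ _]mulr_natl.
exact: subrr.
Qed.

(** With D = p + 2, the terms (d - 1)(d - D)(d - D + 1) + [closed3] are nonnegative, as (d - D)(d -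
    D + 1) is a product of consecutive integers, and their sum is 6 if q = 3 and 0 otherwise. A
    degree above D contributes at least 2 D >= 6, which leaves only six vertices with p = 1. If no
    degree exceeds D, the terms (d - 1)(d - D) are nonpositive with sum 0. *)
Lemma degrees_no_isolated p q (W : finType) (f : rel W) :
  (1 <= p)%N -> (3 <= q)%N -> simple_graph f -> Q_cospectral (jfg_adj p q) f ->
  (forall w, 0 < deg f w)%N -> forall w, (deg f w == 1%N) || (deg f w == p.+2).
Proof.
move=> p1 q3 sif cos d0.
pose D : int := p.+2%:R; pose d w : int := (deg f w)%:R.
have D3 : 3 <= D by rewrite /D; lia.
have d1 w : 1 <= d w by have := d0 w; rewrite /d; lia.
have E1 : \sum_w (d w - 1) * (d w - D) = 0.
  have := mate_moments q3 sif cos 0 1 (- (D + 1)) D.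
  under eq_bigr do rewrite mul0r add0r mul1r -/(d _).
  rewrite -/D => H; transitivity (\sum_w (d w ^+ 2 + - (D + 1) * d w + D)).
    by apply: eq_bigr => w _; ring.
  rewrite H; ring.
have E2 : \sum_w ((d w - 1) * (d w - D) * (d w - D + 1) + (closed3 f w)%:R) = (2 * (q == 3) * q)%N%:R.
  have := mate_moments q3 sif cos 1 (- (2 * D)) (D ^+ 2 + D - 1) (- D * (D - 1)).
  under eq_bigr do rewrite -/(d _).
  rewrite -/D => H; transitivity (\sum_w (1 * (d w ^+ 3 + (closed3 f w)%:R) + - (2 * D) * d w ^+ 2
       + (D ^+ 2 + D - 1) * d w + - D * (D - 1))).
    by apply: eq_bigr => w _; ring.
  rewrite H; ring.
have t0 w : 0 <= (d w - 1) * (d w - D) * (d w - D + 1) + (closed3 f w)%:R.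
  have H1 := d1 w; apply: addr_ge0; last exact: ler0n.
  rewrite -mulrA; apply: mulr_ge0; first by lia.
  by case: (lerP D (d w)) => H; nia.
have small : (forall w, d w <= D) -> forall w, (deg f w == 1%N) || (deg f w == p.+2).
  move=> dD w; have /eqP := E1; rewrite -oppr_eq0 -sumrN psumr_eq0 => [|v _]; last first.
    by have := d1 v; have := dD v; nia.
  move=> /allP/(_ w (mem_index_enum _)) /=; rewrite oppr_eq0 mulf_eq0 !subr_eq0 /d /D.
  by rewrite pnatr_eq1 eqr_nat.
have [/existsP[w wD]|/existsPn H] := boolP [exists w, D < d w]; last first.
  by apply: small => w; have := H w; rewrite -leNgt.
have tw : 2 * D <= (d w - 1) * (d w - D) * (d w - D + 1).
  have H2 : 2 <= (d w - D) * (d w - D + 1) by nia.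
  rewrite -mulrA mulrC; have H1 : D <= d w - 1 by lia.
  nia.
move: E2; rewrite (bigD1 w) //=; set r := \sum_(i | _) _ => E2.
have r0 : 0 <= r by apply: sumr_ge0.
have c0 : 0 <= (closed3 f w)%:R :> int by [].
have q3' : q = 3%N.
  apply/eqP; apply: contraT => nq; move: E2; rewrite (negPf nq) muln0 mul0n; lia.
have [dw cw p1'] : [/\ deg f w = 4%N, closed3 f w = 0%N & p = 1%N].
  move: E2; rewrite q3' /= => E2.
  have p1' : p = 1%N by rewrite /D in tw wD; lia.
  have D3' : D = 3 by rewrite /D p1'.
  split=> //; last by lia.
  rewrite D3' in tw wD E2.
  have : d w = 4 by nia.
  by rewrite /d; lia.
have W6 : #|W| = 6%N by case: cos => <- _; rewrite card_prod !card_ord p1' q3'.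
have [h h0 hw] := bipartite_six sif W6 dw cw.
have [sf _] := sif; have [se _] := jfg_simple p q3.
have [S _] := cospectral_isometry se sf cos.
have := mate_kernel_odd q3 S _ h0 => /(_ _ w) H.
by move: hw; rewrite H ?eqxx // q3'.
Qed.

(** * Graphs with degrees 1 and p + 2 *)

Section TwoRegular.
Variables (W : finType) (f : rel W) (C : {set W}).
Hypotheses (sf : symmetric f) (jf : irreflexive f).
Local Notation N x := [set y in C | f x y].
Hypothesis N2 : forall x, x \in C -> #|N x| = 2%N.
Hypothesis connC : forall A : {set W}, A \subset C -> A != set0 ->
  (forall x y, x \in A -> y \in C -> f x y -> y \in A) -> A = C.

(** The continuation at [b] of a walk arriving from [a]. The default [b] never occurs when [b] is in
    [C], since [N b] has two elements. *)
Definition other (b a : W) : W := odflt b [pick y in N b | y != a].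

Lemma otherP b a : b \in C -> a \in C -> f b a ->
  [/\ other b a \in C, f b (other b a), other b a != a &
    forall y, y \in C -> f b y -> y = a \/ y = other b a].
Proof.
move=> bC aC ba; have aN : a \in N b by rewrite inE aC.
rewrite /other; case: pickP => [y /andP[yN ya]|H] /=; last first.
  have /subset_leq_card : N b \subset [set a].
    by apply/subsetP=> y yN; rewrite inE; have := H y; rewrite yN /= => /negbFE.
  by rewrite N2 // cards1.
have NE : N b = [set a; y].
  apply/esym/eqP; rewrite eqEcard N2 // cards2 eq_sym ya andbT.
  by apply/subsetP=> z; rewrite in_set2 => /orP[]/eqP->.
move: (yN); rewrite inE => /andP[yC by_]; split=> // z zC bz.
have : z \in N b by rewrite inE zC.
by rewrite NE in_set2 => /orP[]/eqP; [left|right].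
Qed.

Section Walk.
Variables x0 x1 : W.
Hypotheses (x0C : x0 \in C) (x1C : x1 \in C) (x01 : f x0 x1).

Definition walk (n : nat) : W := (iter n (fun d : W * W => (d.2, other d.2 d.1)) (x0, x1)).1.

Lemma walkSS n : walk n.+2 = other (walk n.+1) (walk n).
Proof. by []. Qed.

Lemma walk_adj n : [/\ walk n \in C, walk n.+1 \in C & f (walk n) (walk n.+1)].
Proof.
elim: n => [|n [H0 H1 H2]] //; rewrite walkSS.
by have [] := otherP H1 H0 (etrans (sf _ _) H2).
Qed.

Lemma walk_nbr n y : y \in C -> f (walk n.+1) y -> y = walk n \/ y = walk n.+2.
Proof.
have [H0 H1 H2] := walk_adj n; rewrite walkSS.
by have [_ _ _] := otherP H1 H0 (etrans (sf _ _) H2); apply.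
Qed.

Lemma walk_neq2 n : walk n.+2 != walk n.
Proof.
have [H0 H1 H2] := walk_adj n; rewrite walkSS.
by have [] := otherP H1 H0 (etrans (sf _ _) H2).
Qed.

Lemma walk_neq1 n : walk n.+1 != walk n.
Proof. by have [_ _] := walk_adj n; apply: contraTneq => ->; rewrite jf. Qed.

Lemma walk_repeats : exists m, walk m \in mkseq walk m.
Proof.
case: (boolP [exists m : 'I_#|W|.+1, walk m \in mkseq walk m]) => [/existsP[m Hm]|/existsPn H].
  by exists m.
have : uniq (mkseq walk #|W|.+1).
  have : forall k, (k <= #|W|.+1)%N -> uniq (mkseq walk k).
    elim=> // k IHk kW; rewrite mkseqS rcons_uniq IHk ?(ltnW kW) // andbT.
    exact: H (Ordinal kW).
  exact.
move/card_uniqP; rewrite size_mkseq => E.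
by have := max_card (mem (mkseq walk #|W|.+1)); rewrite E ltnn.
Qed.

(** The first repetition hits the start: were it [walk i.+1], the predecessor of the repeated vertex
    would be [walk i] or [walk i.+2], against minimality. The visited set is then closed under
    adjacency in [C], hence all of [C]. *)
Lemma walk_closes : exists m, [/\ (0 < m)%N, walk m = walk 0, uniq (mkseq walk m) &
  [set x in mkseq walk m] = C].
Proof.
have := ex_minnP walk_repeats; case=> m mr mmin.
have um : uniq (mkseq walk m).
  have : forall k, (k <= m)%N -> uniq (mkseq walk k).
    elim=> // k IHk km; rewrite mkseqS rcons_uniq IHk ?(ltnW km) // andbT.
    by apply/negP=> /mmin; rewrite leqNgt km.
  exact.
have inj i j : (i < m)%N -> (j < m)%N -> walk i = walk j -> i = j.
  move=> im jm E; apply/eqP; rewrite -(nth_uniq x0 _ _ um) ?size_mkseq //.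
  by rewrite !nth_mkseq // E.
have m0 : (0 < m)%N by case: (m) mr.
have w0 : walk m = walk 0.
  have /mapP[i] := mr; rewrite mem_iota add0n => /andP[_ im] E.
  case: i im E => [//|i] im E.
  have [n mn] : exists n, m = n.+1 by exists m.-1; rewrite prednK.
  have [nC n1C nn1] := walk_adj n.
  have : f (walk i.+1) (walk n) by rewrite -E mn sf.
  case/walk_nbr => // En.
    by have := inj _ _ _ _ En; rewrite mn in im *; lia.
  case: (ltngtP i.+2 m) => [lt|gt|eq].
  - have := inj _ _ _ lt En; rewrite mn ltnS leqnn => /(_ isT) ni.
    by have := walk_neq2 i.+1; rewrite -ni -mn E eqxx.
  - by rewrite ltnNge im in gt.
  - by have := walk_neq1 i.+1; rewrite eq E eqxx.
exists m; split=> //; apply: connC.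
- by apply/subsetP=> x; rewrite inE => /mapP[i _ ->]; have [] := walk_adj i.
- apply/set0Pn; exists (walk 0); rewrite inE; apply/mapP; exists 0%N => //.
  by rewrite mem_iota.
move=> x y; rewrite !inE => /mapP[i]; rewrite mem_iota add0n => /andP[_ im] -> yC.
have mem k : (k < m)%N -> walk k \in mkseq walk m.
  by move=> km; apply/mapP; exists k => //; rewrite mem_iota.
have memS k : (k < m)%N -> walk k.+1 \in mkseq walk m.
  rewrite leq_eqVlt => /orP[/eqP->|]; last exact: mem.
  by rewrite w0 mem.
case: i im => [|i] im.
  have [n mn] : exists n, m = n.+1 by exists m.-1; rewrite prednK.
  have [_ w1C w01] := walk_adj 0.
  (* [walk_nbr] describes the neighbours of the start only through its second occurrence
     [walk n.+1], so the walk has to be seen to continue as it began. *)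
  have w1 : walk n.+2 = walk 1.
    have : f (walk n.+1) (walk 1) by rewrite -mn w0.
    case/walk_nbr => // E; case: n mn E => [|[|n]] mn E.
    - by have := walk_neq1 0; rewrite E eqxx.
    - by have := walk_neq2 0; rewrite -mn w0 eqxx.
    - by have := inj _ _ _ _ E; rewrite mn; lia.
  rewrite -w0 {1}mn => /walk_nbr[] // ->; first by apply: mem; rewrite mn.
  by rewrite w1; apply: memS.
by case/walk_nbr => // ->; [apply: mem; apply: ltnW|apply: memS].
Qed.

End Walk.

Lemma two_regular_cycle : (0 < #|C|)%N ->
  exists s : 'I_#|C| -> W, [/\ injective s, forall i, s i \in C & forall i, f (s i) (s (ordS i))].
Proof.
case/card_gt0P => x0 x0C.
have /card_gt0P[x1] : (0 < #|N x0|)%N by rewrite N2.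
rewrite inE => /andP[x1C x01].
have [m [m0 w0 um CE]] := walk_closes x0C x1C x01.
have mC : #|C| = m by rewrite -CE cardsE (card_uniqP um) size_mkseq.
rewrite mC; exists (fun i => walk x0 x1 i); split.
- move=> i j E; apply/val_inj/eqP; rewrite -(nth_uniq x0 _ _ um) ?size_mkseq ?ltn_ord //.
  by rewrite !nth_mkseq ?ltn_ord // E.
- by move=> i; have [] := walk_adj x0C x1C x01 i.
move=> i; have [_ _ H] := walk_adj x0C x1C x01 i.
have := ltn_ord i; rewrite leq_eqVlt => /orP[/eqP E|lt].
  have -> : val (ordS i) = 0%N by rewrite /= E modnn.
  by move: H; rewrite E w0.
by have -> : val (ordS i) = i.+1 by rewrite /= modn_small.
Qed.

End TwoRegular.

(** * Core and leaves of a mate, recognized by the Perron eigenvector *)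

Section TwoDegrees.
Variables p q : nat.
Hypotheses (p1 : (1 <= p)%N) (q3 : (3 <= q)%N).
Variables (W : finType) (f : rel W).
Hypotheses (sif : simple_graph f) (cos : Q_cospectral (jfg_adj p q) f).
Hypothesis degs : forall w, (deg f w == 1%N) || (deg f w == p.+2).
Local Notation C := [set w | deg f w == p.+2].
Local Notation N x := [set y in C | f x y].

Let sf : symmetric f := proj1 sif.
Let jf : irreflexive f := proj2 sif.

Lemma leaf_deg w : w \notin C -> deg f w = 1%N.
Proof. by rewrite inE => H; have := degs w; rewrite (negPf H) orbF => /eqP. Qed.

Lemma sum_nbr_leaf (M : nmodType) (F : W -> M) w z : deg f w = 1%N -> f w z ->
  \sum_(y | f w y) F y = F z.
Proof.
move=> dw wz; have /eqP/cards1P[z' E] : #|[set y | f w y]| = 1%N := dw.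
have E' y : f w y = (y == z').
  by have := congr1 (fun A : {set W} => y \in A) E; rewrite !inE.
have zz y : f w y = (y == z) by rewrite E'; move: wz; rewrite E' => /eqP->.
by rewrite (eq_bigl _ _ zz) big_pred1_eq.
Qed.

Lemma card_core : #|C| = q.
Proof.
have := mate_moments q3 sif cos 0 0 1 (-1).
rewrite (eq_bigr (fun w => if w \in C then (p.+1)%:R else 0 : int)) => [|w _]; last first.
  case: ifPn => [|/leaf_deg ->]; rewrite ?inE; last by rewrite !mul0r !add0r mul1r subrr.
  by move=> /eqP->; rewrite !mul0r !add0r mul1r -(natr1 p.+1) addrK.
rewrite -big_mkcond sumr_const => H.
have : #|C|%:R * p.+1%:R = q%:R * p.+1%:R :> int.
  transitivity (p.+1%:R *+ #|C| : int); first by rewrite mulrC mulr_natr.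
  by rewrite H -(natr1 p.+1); ring.
by move/mulIf => H2; apply/eqP; rewrite -(eqr_nat int); apply/eqP/H2; rewrite pnatr_eq0.
Qed.

Lemma card_leaves : #|~: C| = (q * p)%N.
Proof.
have := cardsC C; rewrite card_core; case: cos => <- _; rewrite card_prod !card_ord mulnS; lia.
Qed.

Lemma deg_core_split w : w \in C -> (#|N w| + #|[set y in ~: C | f w y]|)%N = p.+2.
Proof.
rewrite inE => /eqP dw; rewrite -[RHS]dw /deg -[in RHS](cardsID C [set y | f w y]).
by congr (_ + _)%N; apply: eq_card => y; rewrite !inE andbC.
Qed.

(* Each core vertex sends p+2-|N w| edges to leaves, and a leaf receives at most one. *)
Lemma sum_core_nbrs : (2 * q <= \sum_(w in C) #|N w|)%N.
Proof.
have H1 : (\sum_(w in C) (#|N w| + #|[set y in ~: C | f w y]|) = q * p.+2)%N.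
  by rewrite (eq_bigr _ deg_core_split) sum_nat_const card_core.
have H2 : (\sum_(w in C) #|[set y in ~: C | f w y]| <= q * p)%N.
  rewrite -card_leaves -sum1_card.
  under eq_bigr do rewrite -sum1dep_card big_mkcondr /=.
  rewrite exchange_big /=; apply: leq_sum => y yC.
  have dy : deg f y = 1%N by apply: leaf_deg; rewrite -in_setC.
  rewrite -[X in (_ <= X)%N]dy deg_sum [X in (_ <= X)%N]big_mkcond big_mkcond /=.
  rewrite [X in (X <= _)%N]big_mkcond; apply: leq_sum => w _.
  by rewrite sf; case: ifP.
rewrite big_split /= in H1; lia.
Qed.

Lemma leaf_nbr w : w \notin C -> exists2 z, f w z &
  forall (M : nmodType) (F : W -> M), \sum_(y | f w y) F y = F z.
Proof.
move=> wC; have dw := leaf_deg wC.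
have /card_gt0P[z] : (0 < #|[set y | f w y]|)%N by rewrite -/(deg f w) dw.
by rewrite inE => wz; exists z => // M F; apply: sum_nbr_leaf.
Qed.

Section Eigenfunction.
Variable l : R.
Hypotheses (l1 : 1 < l) (lE : (l - 1) * (l - p%:R - 4) = p%:R).
Local Notation y := ((l - 1)^-1).

(* The Perron eigenvector of the jellyfish graph, restricted to the part of the core in A. *)
Definition core_fun (A : {set W}) (x : W) : R :=
  if x \in C then (x \in A)%:R else y * \sum_(z | f x z) (z \in A)%:R.

Let l10 : l - 1 != 0. Proof. by rewrite subr_eq0 gt_eqF. Qed.

(** The eigenvalue equation at a core vertex of value 1: its degree, two core neighbours of value 1
    and p leaves of value [y]. *)
Lemma radius_split : l = p.+2%:R + 2 + p%:R * y.
Proof.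
have -> : p%:R * y = l - p%:R - 4 by apply: (mulfI l10); rewrite lE mulrCA mulfV ?mulr1.
rewrite -!natr1; ring.
Qed.

Lemma inv_lt1 : 0 < 1 - y.
Proof.
have p0 : 0 < p%:R :> R by rewrite ltr0n.
have l5 : 0 < l - p%:R - 4.
  by rewrite -(pmulr_rgt0 _ (x := l - 1)) ?lE // subr_gt0.
rewrite subr_gt0 invf_lt1; lra.
Qed.

Variable A : {set W}.
Hypotheses (sAC : A \subset C)
  (clA : forall x z, x \in A -> z \in C -> f x z -> z \in A).

Lemma Qop_core_fun_leaf x : x \notin C -> Qop f (core_fun A) x = l * core_fun A x.
Proof.
move=> xC; have [z xz H] := leaf_nbr xC.
rewrite Qop_E leaf_deg // H {1 3}/core_fun (negPf xC) !H.
(* If [z] is itself a leaf, then [x] and [z] form an isolated edge outside [A], and both sides are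
   0. *)
have -> : core_fun A z = (z \in A)%:R.
  rewrite /core_fun; case: ifPn => // zC; have [t zt Ht] := leaf_nbr zC.
  have Hx : \sum_(y | f z y) (y \in A)%:R = (x \in A)%:R :> R.
    by apply: sum_nbr_leaf; rewrite ?leaf_deg // sf.
  have out u : u \notin C -> (u \in A)%:R = 0 :> R.
    by move=> uC; rewrite (contraNF (subsetP sAC u) uC).
  by rewrite Hx !out ?mulr0.
by field.
Qed.

Lemma Qop_core_fun_core x : x \in C -> Qop f (core_fun A) x =
  (x \in A)%:R * (p.+2%:R + #|N x|%:R + (p.+2%:R - #|N x|%:R) * y).
Proof.
move=> xC; rewrite Qop_E {1}/core_fun xC.
have -> : deg f x = p.+2 by move: xC; rewrite inE => /eqP.
have E t : f x t -> core_fun A t = (x \in A)%:R * (if t \in C then 1 else y).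
  move=> xt; rewrite /core_fun; case: ifPn => tC.
    rewrite mulr1; congr (nat_of_bool _)%:R.
    by apply/idP/idP => [tA|xA]; [apply: clA tA xC _; rewrite sf|apply: clA xA tC xt].
  by rewrite (sum_nbr_leaf _ (leaf_deg tC) (z := x)) 1?sf // mulrC.
rewrite (eq_bigr _ E) -mulr_sumr.
have -> : \sum_(t | f x t) (if t \in C then 1 else y) = #|N x|%:R + (p.+2%:R - #|N x|%:R) * y.
  have -> : p.+2%:R - #|N x|%:R = #|[set z in ~: C | f x z]|%:R :> R.
    by apply/eqP; rewrite subr_eq -natrD addnC deg_core_split.
  rewrite (bigID (mem C)) /=; congr (_ + _).
    rewrite -sum1dep_card natr_sum.
    rewrite (eq_bigl (fun t => (t \in C) && f x t)) => [|t]; last by rewrite andbC.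
    by apply: eq_bigr => t /andP[-> _].
  rewrite -sum1dep_card natr_sum mulr_suml.
  rewrite (eq_bigl (fun t => (t \in ~: C) && f x t)) => [|t]; last by rewrite andbC in_setC.
  by apply: eq_bigr => t; rewrite in_setC => /andP[/negPf-> _]; rewrite mul1r.
ring.
Qed.

(** The eigenvalue equation holds outside [A]. At a vertex of [A] it fails by 1 - y for each core
    neighbour missing from, or in excess of, the expected two, since a leaf of value [y] then
    replaces a core vertex of value 1 or conversely. *)
Lemma core_fun_excess : l * dot (core_fun A) (core_fun A) - dot (core_fun A) (Qop f (core_fun A)) =
  (1 - y) * \sum_(x in A) (2 - #|N x|%:R).
Proof.
rewrite /dot mulr_sumr -sumrB mulr_sumr [RHS]big_mkcond /=; apply: eq_bigr => x _.
case: (boolP (x \in C)) => xC; last first.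
  rewrite Qop_core_fun_leaf // (contraNF (subsetP sAC x) xC); ring.
rewrite Qop_core_fun_core // /core_fun xC; case: (x \in A); last by rewrite !mul0r mulr0 subrr.
rewrite /=; move: radius_split; set z := y => ->; ring.
Qed.

End Eigenfunction.

Section Conclusion.
Variable S : Q_isometry (jfg_adj p q) f.
Variable l : R.
Hypotheses (l1 : 1 < l) (lE : (l - 1) * (l - p%:R - 4) = p%:R).
Local Notation y := ((l - 1)^-1).

(** The difference is nonnegative because [l] bounds the spectrum and nonpositive because the core
    neighbours in [A] average at least two. *)
Lemma core_fun_eq_excess (A : {set W}) : A \subset C ->
  (forall x z, x \in A -> z \in C -> f x z -> z \in A) ->
  (2 * #|A| <= \sum_(x in A) #|N x|)%N ->
  l * dot (core_fun l A) (core_fun l A) = dot (core_fun l A) (Qop f (core_fun l A)).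
Proof.
move=> sAC clA le; apply/eqP; rewrite -subr_eq0 eq_le (mate_radius q3 S l1 lE) andbT.
rewrite core_fun_excess //; apply: mulr_ge0_le0; first by apply/ltW/inv_lt1.
rewrite sumrB sumr_const subr_le0 -natr_sum -[2 *+ _]mulr_natl -natrM ler_nat mulnC.
exact: le.
Qed.

(** By [sum_core_nbrs] the function of the whole core attains the maximum, so it is an eigenvector,
    and its equation at [w] reads (2 - |N w|)(1 - y) = 0. *)
Lemma core_nbrs w : w \in C -> #|N w| = 2%N.
Proof.
move=> wC; have eq0 := core_fun_eq_excess (subxx C) (fun x z _ zC _ => zC).
have := mate_radius_eigen q3 S l1 lE (eq0 _) w.
rewrite card_core sum_core_nbrs => /(_ isT).
rewrite Qop_core_fun_core // /core_fun wC /= mul1r mulr1.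
have := inv_lt1 l1 lE; have := radius_split l1 lE; set z := y => lD z1.
set n : R := #|_|%:R; rewrite [X in _ = X -> _]lD => E.
have : (2 - n) * (1 - z) = 0.
  have -> : (2 - n) * (1 - z) = (p.+2%:R + 2 + p%:R * z) - (p.+2%:R + n + (p.+2%:R - n) * z) by ring.
  by rewrite E subrr.
by move/eqP; rewrite mulf_eq0 (gt_eqF z1) orbF subr_eq0 /n eqr_nat => /eqP.
Qed.

(** A proper union of components would carry a second eigenvector for the simple eigenvalue [l]. *)
Lemma core_connected (A : {set W}) : A \subset C -> A != set0 ->
  (forall x z, x \in A -> z \in C -> f x z -> z \in A) -> A = C.
Proof.
move=> sAC /set0Pn[a aA] clA; apply/eqP; rewrite eqEsubset sAC /=; apply/subsetP=> w wC.
have cnt (B : {set W}) : B \subset C -> (2 * #|B| <= \sum_(x in B) #|N x|)%N.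
  move=> BC; rewrite (eq_bigr (fun=> 2%N)) => [|x xB]; last exact: core_nbrs (subsetP BC x xB).
  by rewrite sum_nat_const mulnC.
have EA := core_fun_eq_excess sAC clA (cnt _ sAC).
have EC := core_fun_eq_excess (subxx C) (fun x z _ zC _ => zC) (cnt _ (subxx C)).
have := mate_radius_simple q3 S l1 lE EC EA w a.
rewrite /core_fun wC (subsetP sAC _ aA) aA /= !mul1r.
by case: (w \in A) => // /eqP; rewrite oner_eq0.
Qed.

End Conclusion.

Lemma two_degrees_iso : graph_iso (jfg_adj p q) f.
Proof.
have [se _] := jfg_simple p q3; have [S _] := cospectral_isometry se sf cos.
have [l /andP[l1 _] lE] := spectral_radius_exists p1.
have Nb2 := core_nbrs S l1 lE; have cC := core_connected S l1 lE.
have := two_regular_cycle sf jf Nb2 cC; rewrite card_core.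
case=> [|s [si sC sS]]; first by apply: leq_trans q3.
have NE i : N (s i) = [set s (ordS i); s (ord_pred i)].
  apply/esym/eqP; rewrite eqEcard Nb2 // cards2 (inj_eq si) ordS_pred_neq // andbT.
  apply/subsetP=> z; rewrite in_set2 in_set => /orP[]/eqP->; rewrite sC ?sS //.
  by rewrite sf -{2}(ord_predK i) sS.
have fss i j : f (s i) (s j) = (j == ordS i) || (j == ord_pred i).
  have : (s j \in N (s i)) = (s j \in [set s (ordS i); s (ord_pred i)]) by rewrite NE.
  by rewrite in_set sC in_set2 !(inj_eq si).
pose Lf i := [set z in ~: C | f (s i) z].
have cLf i : #|Lf i| = p.
  by have := deg_core_split (sC i); rewrite Nb2 // add2n => -[].
pose lf i (k : 'I_p) := nth (s i) (enum (Lf i)) k.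
have lfP i k : lf i k \notin C /\ f (s i) (lf i k).
  have : lf i k \in Lf i by rewrite -mem_enum mem_nth // -cardE cLf.
  by case/setIdP; rewrite in_setC.
have fl i k w : f (lf i k) w = (w == s i).
  have [lC il] := lfP i k; have /leaf_nbr[z lz H] := lC.
  have zi : z = s i.
    apply/eqP; have := sum_nbr_leaf (fun y => (y == s i)%:R : R) (leaf_deg lC) lz.
    rewrite (sum_nbr_leaf _ (leaf_deg lC) (z := s i)) 1?sf // eqxx.
    by case: eqP => // _ /eqP; rewrite oner_eq0.
  apply/idP/eqP => [lw|->]; last by rewrite sf.
  apply/eqP; have := sum_nbr_leaf (fun y => (y == s i)%:R : R) (leaf_deg lC) lw.
  rewrite (sum_nbr_leaf _ (leaf_deg lC) (z := s i)) 1?sf // eqxx.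
  by case: eqP => // _ /eqP; rewrite oner_eq0.
pose g (v : 'I_q * 'I_p.+1) := if unlift ord0 v.2 is Some k then lf v.1 k else s v.1.
have gc i : g (core p i) = s i by rewrite /g /= unlift_none.
have gl i k : g (leaf i k) = lf i k by rewrite /g /= liftK.
have lfs i k j : (lf i k == s j) = false.
  by have [lC _] := lfP i k; apply: contraNF lC => /eqP->; apply: sC.
have VP (P : 'I_q * 'I_p.+1 -> Prop) : (forall i, P (core p i)) ->
    (forall i k, P (leaf i k)) -> forall v, P v.
  by move=> Pc Pl [i k]; case: (unliftP ord0 k) => [k'|] ->; [apply: Pl|apply: Pc].
have gi : injective g.
  apply: (VP _) => [i|i k]; apply: (VP _) => [j|j m]; rewrite ?gc ?gl.
  - by move/si->.
  - by move/eqP; rewrite eq_sym lfs.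
  - by move/eqP; rewrite lfs.
  - move=> E; have ij : i = j.
      by apply: si; apply/eqP; rewrite -(fl j m) -E fl.
    move: E; rewrite -ij /lf => /eqP; rewrite nth_uniq ?enum_uniq // -?cardE ?cLf //.
    by move=> /eqP/val_inj->.
exists g; split.
  by apply: inj_card_bij gi _; case: cos => ->.
apply: (VP _) => [i|i k]; apply: (VP _) => [j|j m]; rewrite ?gc ?gl.
- by rewrite jfg_core_core // fss.
- by rewrite jfg_core_leaf sf fl (inj_eq si).
- by rewrite jfg_leaf_core fl (inj_eq si).
- by rewrite jfg_leaf_leaf fl lfs.
Qed.

End TwoDegrees.

Lemma set_family (W : finType) (A : {set W}) (c : 'I_#|A| -> R) : (exists i, c i != 0) ->
  exists c' : W -> R, [/\ exists w, c' w != 0, forall w, w \notin A -> c' w = 0 &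
    forall (psi : W -> W -> R) w, \sum_i c i * psi (enum_val i) w = \sum_b c' b * psi b w].
Proof.
case=> i0 ci0; pose c' w := \sum_(i | enum_val i == w) c i.
have cE i : c' (enum_val i) = c i.
  by rewrite /c' (eq_bigl _ _ (fun j => inj_eq enum_val_inj j i)) big_pred1_eq.
have c0 w : w \notin A -> c' w = 0.
  move=> wA; apply: big1 => i /eqP iw; move: wA.
  by rewrite -iw (enum_valP i).
exists c'; split=> //; first by exists (enum_val i0); rewrite cE.
move=> psi w; rewrite (bigID (mem A)) /= [X in _ + X]big1 ?addr0 => [|b bA]; last first.
  by rewrite c0 ?mul0r.
rewrite [RHS]big_enum_val /=; by apply: eq_bigr => i _; rewrite cE.
Qed.

(** * Inertia of Q - 1 *)

Section Excess.
Variables (W : finType) (f : rel W).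
Hypothesis sf : symmetric f.
Implicit Types g h u v x y : W -> R.

Definition bil u v : R := dot u (Qop f v) - dot u v.
Definition excess h := bil h h.

Lemma bil_E u v : bil u v =
  \sum_x ((deg f x)%:R - 1) * (u x * v x) + \sum_x u x * \sum_(y | f x y) v y.
Proof.
rewrite /bil /dot -sumrB -big_split; apply: eq_bigr => x _.
by rewrite Qop_E /=; ring.
Qed.

Lemma bil_sym u v : bil u v = bil v u.
Proof. by rewrite /bil -(Qop_sym sf) dotC (dotC u v). Qed.

Lemma eq_excess g h : g =1 h -> excess g = excess h.
Proof.
move=> E; rewrite /excess !bil_E; congr (_ + _); apply: eq_bigr => x _; first by rewrite E.
by rewrite E; congr (_ * _); apply: eq_bigr.
Qed.

Lemma excessD u v : excess (fun w => u w + v w) = excess u + 2 * bil u v + excess v.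
Proof.
have E : excess (fun w => u w + v w) = bil u u + bil u v + (bil v u + bil v v).
  rewrite /excess !bil_E; under [\sum_x (u x + v x) * _]eq_bigr do rewrite big_split mulrDl !mulrDr /=.
  have -> : \sum_x ((deg f x)%:R - 1) * ((u x + v x) * (u x + v x)) =
    \sum_x (((deg f x)%:R - 1) * (u x * u x) + ((deg f x)%:R - 1) * (u x * v x) +
     (((deg f x)%:R - 1) * (v x * u x) + ((deg f x)%:R - 1) * (v x * v x))).
    by apply: eq_bigr => x _; ring.
  rewrite !big_split /=; ring.
by rewrite E (bil_sym v u) /excess; ring.
Qed.

(** Each edge inside [S], completed to a square, uses up one unit of degree at both ends; what
    remains of d - 1 is the coefficient of y_u^2. Edges are counted twice. *)
Lemma excess_supported (S : {set W}) y : (forall w, w \notin S -> y w = 0) ->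
  2 * excess y = \sum_(u in S) \sum_(v in S | f u v) (y u + y v) ^+ 2
    + 2 * \sum_(u in S) ((deg f u)%:R - 1 - #|[set v in S | f u v]|%:R) * y u ^+ 2.
Proof.
move=> y0; rewrite /excess bil_E.
have -> : \sum_x ((deg f x)%:R - 1) * (y x * y x) = \sum_(x in S) ((deg f x)%:R - 1) * y x ^+ 2.
  rewrite [RHS]big_mkcond; apply: eq_bigr => x _; case: ifPn => // /y0 ->.
  by rewrite mul0r mulr0.
have -> : \sum_x y x * (\sum_(z | f x z) y z) = \sum_(x in S) \sum_(z in S | f x z) y x * y z.
  rewrite [RHS]big_mkcond; apply: eq_bigr => x _; case: ifPn => [xS|/y0 ->]; last by rewrite mul0r.
  rewrite mulr_sumr (bigID (mem S)) /= [X in _ + X]big1 ?addr0 => [|z /andP[_ /y0 ->]]; last by rewrite mulr0.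
  by apply: eq_bigl => z; rewrite andbC.
have E1 : \sum_(x in S) \sum_(z in S | f x z) y x ^+ 2 = \sum_(u in S) #|[set v in S | f u v]|%:R * y u ^+ 2.
  apply: eq_bigr => x _; rewrite sumr_const cardsE mulr_natl; congr (_ *+ _).
have E2 : \sum_(x in S) \sum_(z in S | f x z) y z ^+ 2 = \sum_(u in S) #|[set v in S | f u v]|%:R * y u ^+ 2.
  rewrite -E1 (exchange_big_dep (mem S)) /=; last by move=> i j _ /andP[].
  by apply: eq_bigr => x xS; apply: eq_bigl => z; rewrite sf xS.
have -> : \sum_(u in S) \sum_(v in S | f u v) (y u + y v) ^+ 2 =
   \sum_(x in S) \sum_(z in S | f x z) y x ^+ 2 + \sum_(x in S) \sum_(z in S | f x z) y z ^+ 2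
   + 2 * \sum_(x in S) \sum_(z in S | f x z) y x * y z.
  rewrite mulr_sumr -!big_split; apply: eq_bigr => x _ /=.
  rewrite mulr_sumr -!big_split; apply: eq_bigr => z _ /=; ring.
rewrite E1 E2.
have -> : \sum_(u in S) ((deg f u)%:R - 1 - #|[set v in S | f u v]|%:R) * y u ^+ 2 =
  \sum_(x in S) ((deg f x)%:R - 1) * y x ^+ 2 - \sum_(u in S) #|[set v in S | f u v]|%:R * y u ^+ 2.
  by rewrite -sumrB; apply: eq_bigr => x _; ring.
ring.
Qed.

End Excess.

Section SubspaceBounds.
Variables p q : nat.
Hypotheses (p1 : (1 <= p)%N) (q3 : (3 <= q)%N).
Variables (W : finType) (f : rel W).
Hypotheses (sif : simple_graph f) (S : Q_isometry (jfg_adj p q) f).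
Hypothesis leaf_edge : forall w z, deg f w = 1%N -> f w z -> (2 <= deg f z)%N.

Let sf : symmetric f := proj1 sif.
Let jf : irreflexive f := proj2 sif.

Definition leaves := [set w | deg f w == 1%N].
Definition inner := [set w | (2 <= deg f w)%N].
Definition bearing := [set w in inner | [exists l in leaves, f w l]].
Definition bare := inner :\: bearing.

Lemma leaves_inner w : w \in leaves -> w \notin inner.
Proof. by rewrite !inE => /eqP->. Qed.

Lemma bare_leaf w l : w \in bare -> l \in leaves -> f w l = false.
Proof.
rewrite in_setD in_set => /andP[wM wK] lL; apply: contraNF wM => wl.
by rewrite wK; apply/existsP; exists l; rewrite lL.
Qed.

Lemma leaf_sum (M : nmodType) (F : W -> M) w z : w \in leaves -> f w z ->
  \sum_(y | f w y) F y = F z.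
Proof.
rewrite inE => /eqP dw wz; have /eqP/cards1P[z' E] : #|[set y | f w y]| = 1%N := dw.
have E' y : f w y = (y == z').
  by have := congr1 (fun A : {set W} => y \in A) E; rewrite !inE.
have zz y : f w y = (y == z) by rewrite E'; move: wz; rewrite E' => /eqP->.
by rewrite (eq_bigl _ _ zz) big_pred1_eq.
Qed.

Lemma leaf_inner l w : l \in leaves -> f l w -> w \in inner.
Proof. by rewrite !inE => /eqP; apply: leaf_edge. Qed.

(** The factor d - 1 vanishes at a leaf, and no edge joins two leaves. *)
Lemma excess_leaves h : (forall w, w \notin leaves -> h w = 0) -> excess f h = 0.
Proof.
move=> h0; rewrite /excess bil_E !big1 ?addr0 // => x _.
  case: (boolP (x \in leaves)) => [xL|/h0->]; last by rewrite mul0r.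
  rewrite big1 ?mulr0 // => y xy; apply: h0.
  by apply: contraL (leaf_inner xL xy) => /leaves_inner.
case: (boolP (x \in leaves)) => [|/h0->]; last by rewrite !mul0r mulr0.
by rewrite inE => /eqP->; rewrite subrr mul0r.
Qed.

Lemma bil_leaves y h : (forall w, w \notin inner -> y w = 0) ->
  (forall w, w \notin leaves -> h w = 0) ->
  bil f y h = \sum_(x in inner) y x * \sum_(z | f x z) h z.
Proof.
move=> y0 h0; rewrite bil_E big1 ?add0r => [|x _]; last first.
  case: (boolP (x \in leaves)) => [/leaves_inner/y0->|/h0->]; first by rewrite mul0r mulr0.
  by rewrite !mulr0.
rewrite [RHS]big_mkcond; apply: eq_bigr => x _; case: ifPn => // /y0->.
by rewrite mul0r.
Qed.

(** Functions on the leaves are isotropic for the excess and orthogonal to functions on bare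
    vertices. Adding them to [T] keeps the excess nonnegative, and such a space has dimension at
    most q p. *)
Lemma nonneg_bound (T : {set W}) : T \subset bare ->
  (forall y, (forall w, w \notin T -> y w = 0) -> 0 <= excess f y) ->
  (#|leaves| + #|T| <= q * p)%N.
Proof.
move=> TZ pos; rewrite leqNgt; apply/negP=> lt.
have LT : leaves :&: T = set0.
  apply/setP=> w; rewrite !inE; apply/negP=> /andP[/eqP dw /(subsetP TZ)].
  by rewrite !inE dw andbF.
have card : #|leaves :|: T| = (#|leaves| + #|T|)%N by rewrite cardsU LT cards0 subn0.
have [|c0 c0n cE] := mate_excess_lt0 q3 S
  (fun (i : 'I_#|leaves :|: T|) w => (w == enum_val i)%:R) p1; first by rewrite card_ord card.
have [c [[w cw] csup cc]] := set_family c0n.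
have hE : (fun w => \sum_i c0 i * (w == enum_val i)%:R) =1 c.
  move=> v; rewrite (cc (fun b w => (w == b)%:R)) (bigD1 v) //= eqxx mulr1 big1 ?addr0 // => b bv.
  by rewrite eq_sym (negPf bv) mulr0.
suff : c w = 0 by apply/eqP.
rewrite -hE; apply: cE; rewrite -[X in 0 <= X]/(excess f (fun w => \sum_i c0 i * (w == enum_val i)%:R)).
rewrite (eq_excess _ hE).
pose y w := if w \in T then c w else 0; pose m w := if w \in leaves then c w else 0.
have -> : excess f c = excess f (fun w => y w + m w).
  apply: eq_excess => v; rewrite /y /m.
  have : v \notin leaves :&: T by rewrite LT inE.
  have := csup v; rewrite in_setU in_setI.
  by case: (v \in T); case: (v \in leaves) => //= H _; rewrite ?addr0 ?add0r //; apply: H.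
have y0 v : v \notin T -> y v = 0 by rewrite /y => /negPf->.
have m0 v : v \notin leaves -> m v = 0 by rewrite /m => /negPf->.
rewrite excessD // (excess_leaves m0) addr0 bil_leaves // => [|v vK]; last first.
  by apply: y0; apply: contra vK => /(subsetP TZ); rewrite in_setD => /andP[].
rewrite big1 => [|v _]; first by rewrite mulr0 addr0; apply: pos.
case: (boolP (v \in T)) => [vT|/y0->]; last by rewrite mul0r.
rewrite big1 ?mulr0 // => z vz; apply: m0; apply: contraTN vz => zL.
by rewrite (bare_leaf (subsetP TZ v vT) zL).
Qed.

(* One leaf l at each bearing vertex v gets the value h v - sum of h over the bare
   neighbours of v: this makes the bearing and the bare part orthogonal for excess. *)
Lemma pos_bound (T : {set W}) : T \subset bare ->
  (forall y, (forall w, w \notin T -> y w = 0) -> (exists w, y w != 0) -> 0 < excess f y) ->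
  (#|bearing| + #|T| <= q)%N.
Proof.
move=> TZ pos; rewrite leqNgt; apply/negP=> lt.
have MT : bearing :&: T = set0.
  apply/setP=> w; rewrite [RHS]inE; apply/negP=> /setIP[wM /(subsetP TZ)].
  by rewrite in_setD wM.
have MK : bearing \subset inner by apply/subsetP=> w; rewrite in_set => /andP[].
have card : #|bearing :|: T| = (#|bearing| + #|T|)%N by rewrite cardsU MT cards0 subn0.
pose ch v := odflt v [pick l in leaves | f v l].
(* The leaf correction of the basis function of [b]: 1 at the chosen leaf of [b] if [b] is bearing,
   -1 at the chosen leaves of the neighbours of [b] if [b] is in [T]. *)
pose ka b w : R := (w \in leaves)%:R * \sum_(v | f w v) (w == ch v)%:R *
  ((b \in bearing)%:R * (b == v)%:R - (b \in T)%:R * (f v b)%:R).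
have [|c0 c0n cE] := mate_excess_le0 q3 S
  (fun (i : 'I_#|bearing :|: T|) w => (w == enum_val i)%:R + ka (enum_val i) w).
  by rewrite card_ord card.
have [c [[w0 cw0] csup cc]] := set_family c0n.
pose x w := if w \in bearing then c w else 0; pose y w := if w \in T then c w else 0.
pose m w := \sum_b c b * ka b w.
have x0 v : v \notin bearing -> x v = 0 by rewrite /x => /negPf->.
have y0 v : v \notin T -> y v = 0 by rewrite /y => /negPf->.
have m0 v : v \notin leaves -> m v = 0.
  by move=> vL; rewrite /m big1 // => b _; rewrite /ka (negPf vL) mul0r mulr0.
have cxy v : c v = x v + y v.
  rewrite /x /y; have : v \notin bearing :&: T by rewrite MT inE.
  have := csup v; rewrite in_setU in_setI.
  by case: (v \in bearing); case: (v \in T) => //= H _; rewrite ?addr0 ?add0r //; apply: H.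
have mE w v : w \in leaves -> f w v -> m w = (w == ch v)%:R * (x v - \sum_(z | f v z) y z).
  move=> wL wv; rewrite /m.
  under eq_bigr do rewrite /ka wL mul1r (leaf_sum _ wL wv) mulrCA.
  rewrite -mulr_sumr; congr (_ * _); under eq_bigr do rewrite mulrBr.
  rewrite sumrB; congr (_ - _).
    rewrite (bigD1 v) //= eqxx mulr1 big1 ?addr0 => [|b bv]; last by rewrite (negPf bv) !mulr0.
    by rewrite /x; case: ifP; rewrite ?mulr1 ?mulr0.
  rewrite [RHS]big_mkcond; apply: eq_bigr => b _; rewrite /y.
  by case: (f v b); case: (b \in T); rewrite ?mulr1 ?mulr0 ?mul0r ?mulr0.
have ms v : v \in bearing -> \sum_(w | f v w) m w = x v - \sum_(z | f v z) y z.
  rewrite in_set => /andP[vK /existsP[l /andP[lL vl]]].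
  have [chL vch] : ch v \in leaves /\ f v (ch v).
    by rewrite /ch; case: pickP => [u /andP[]|/(_ l)] //=; rewrite lL vl.
  rewrite (bigD1 (ch v)) //= (mE _ v) // 1?sf // eqxx mul1r [X in _ + X]big1 ?addr0 // => w /andP[vw wch].
  case: (boolP (w \in leaves)) => [wL|/m0//].
  by rewrite (mE _ v) // 1?sf // (negPf wch) mul0r.
have hE : (fun w => \sum_i c0 i * ((w == enum_val i)%:R + ka (enum_val i) w)) =1
    (fun w => (x w + y w) + m w).
  move=> v; rewrite (cc (fun b w => (w == b)%:R + ka b w)).
  under eq_bigr do rewrite mulrDr.
  rewrite big_split -/(m v) -cxy; congr (_ + _).
  rewrite (bigD1 v) //= eqxx mulr1 big1 ?addr0 // => b bv.
  by rewrite eq_sym (negPf bv) mulr0.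
have TK v : v \notin inner -> y v = 0.
  by move=> vK; apply: y0; apply: contra vK => /(subsetP TZ); rewrite in_setD => /andP[].
have XK v : v \notin inner -> x v = 0.
  by move=> vK; apply: x0; apply: contra vK => /(subsetP MK).
move: cE; rewrite -[X in X <= 0]/(excess f (fun w => \sum_i c0 i * ((w == enum_val i)%:R + ka (enum_val i) w))).
rewrite (eq_excess _ hE) excessD // (excess_leaves m0) addr0 bil_leaves // => [|v vK]; last first.
  by rewrite TK // XK // addr0.
have -> : \sum_(v in inner) (x v + y v) * (\sum_(z | f v z) m z) =
    \sum_v x v * (x v - \sum_(z | f v z) y z).
  rewrite big_mkcond; apply: eq_bigr => v _.
  case: (boolP (v \in bearing)) => [vM|vM].
    rewrite (subsetP MK v vM) ms //; case: (boolP (v \in T)) => [vT|/y0->]; last by rewrite addr0.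
    by have := in_set0 v; rewrite -MT in_setI vM vT.
  rewrite (x0 v vM) add0r mul0r; case: ifP => // vK.
  rewrite big1 ?mulr0 // => z vz; apply: m0; apply: contraTN vz => zL.
  by rewrite (bare_leaf _ zL) // in_setD vM vK.
rewrite excessD // [bil f x y]bil_E [\sum_v ((deg f v)%:R - 1) * (x v * y v)]big1 => [|v _]; last first.
  case: (boolP (v \in bearing)) => [vM|/x0->]; last by rewrite mul0r mulr0.
  rewrite y0 ?mulr0 //; apply/negP=> vT.
  by have := in_set0 v; rewrite -MT in_setI vM vT.
under [\sum_v x v * (x v - _)]eq_bigr do rewrite mulrBr.
rewrite sumrB add0r.
have -> : \sum_v x v * x v = dot x x by [].
have Ex : excess f x = dot x (Qop f x) - dot x x by [].
have fx : 0 <= dot x (Qop f x) by apply: Qform_ge0.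
have dx : 0 <= dot x x by apply: sumr_ge0 => v _; rewrite -expr2 sqr_ge0.
set sxy := \sum_x0 _ => H.
(* The correction cancels the mixed terms in [x] and [y] and adds 2 |x|^2 to the excess of [x],
   which is <x, Qx> - |x|^2. *)
have H1 : dot x (Qop f x) + dot x x + excess f y <= 0 by rewrite Ex in H; lra.
have [/existsP[w yw]|/existsPn Y0] := boolP [exists w, y w != 0].
  have := pos y y0 (ex_intro _ w yw); lra.
have Y0' v : y v = 0 by apply/eqP; have := Y0 v; rewrite negbK.
have ey : excess f y = 0.
  by rewrite /excess bil_E !big1 ?addr0 // => v _; rewrite !Y0' ?mul0r ?mulr0.
have dx0 : dot x x = 0 by apply/eqP; rewrite eq_le dx andbT; lra.
move: cw0; rewrite cxy Y0' addr0; move/eqP: dx0; rewrite psumr_eq0 => [/allP/(_ w0 (mem_index_enum _))|v _].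
  by rewrite /= mulf_eq0 orbb => ->.
by rewrite -expr2 sqr_ge0.
Qed.

End SubspaceBounds.

(** * Degrees in the presence of an isolated vertex *)

Section DegreeBounds.
Variables p q : nat.
Hypotheses (p1 : (1 <= p)%N) (q3 : (3 <= q)%N).
Variables (W : finType) (f : rel W).
Hypotheses (sif : simple_graph f) (S : Q_isometry (jfg_adj p q) f).

Let sf : symmetric f := proj1 sif.
Let jf : irreflexive f := proj2 sif.

Lemma Qop_delta w x : Qop f (fun v => (v == w)%:R) x =
  (deg f x)%:R * (x == w)%:R + (f x w)%:R.
Proof.
rewrite Qop_E big_mkcond /= (bigD1 w) //= eqxx big1 ?addr0 => [|v vw].
  by case: (f x w).
by rewrite (negPf vw); case: ifP.
Qed.

Lemma gap_deg w : (deg f w * p.+1 <= deg f w ^ 2 + p.+1)%N.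
Proof.
have := mate_gap_ge0 q3 S (fun v => (v == w)%:R).
rewrite /gap_form /dot; set d : R := (deg f w)%:R.
have -> : \sum_x (Qop f (fun v => (v == w)%:R) x - (x == w)%:R) *
     (Qop f (fun v => (v == w)%:R) x - (p%:R + 1) * (x == w)%:R) =
     (d - 1) * (d - (p%:R + 1)) + d.
  rewrite (bigD1 w) //= !Qop_delta eqxx jf !mulr1 !addr0 -/d; congr (_ + _).
  transitivity (\sum_(x | x != w) (f w x)%:R : R).
    by apply: eq_bigr => x xw; rewrite !Qop_delta (negPf xw) !mulr0 !subr0 add0r sf; case: (f w x); rewrite ?mulr1 ?mulr0.
  rewrite /d deg_sum natr_sum [RHS]big_mkcond [RHS](bigD1 w) //= jf add0r.
  by apply: eq_bigr => x _; case: (f w x).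
rewrite -(ler_nat R) natrD natrM natrX -/d -natr1 => H; lra.
Qed.

(** The test function is the Perron eigenvector of the star at [w], whose eigenvalue is d + 1. Hence
    d + 1 <= l < p + 5. *)
Lemma max_deg w : (deg f w <= p.+3)%N.
Proof.
have [l /andP[l1 l5] lE] := spectral_radius_exists p1.
have [->//|d0] := posnP (deg f w).
pose d : R := (deg f w)%:R; have dp : 0 < d by rewrite ltr0n.
pose h v : R := d * (v == w)%:R + (f w v)%:R.
have hw : h w = d by rewrite /h eqxx jf mulr1 addr0.
have hn v : f w v -> h v = 1.
  move=> wv; rewrite /h wv; case: eqP => [vw|]; first by move: wv; rewrite vw jf.
  by rewrite mulr0 add0r.
have hh : dot h h = d ^+ 2 + d.
  rewrite /dot (bigD1 w) //= hw -expr2; congr (_ + _).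
  rewrite /d deg_sum natr_sum [RHS]big_mkcond [RHS](bigD1 w) //= jf add0r.
  apply: eq_bigr => x xw; rewrite /h (negPf xw) mulr0 add0r.
  by case: (f w x); rewrite ?mulr1 ?mulr0.
have hQ : 2 * (d * (d + 1) ^+ 2) <= 2 * dot h (Qop f h).
  rewrite (Qform_edges sf) (bigD1 w) //=.
  have -> : \sum_(v | f w v) (h w + h v) ^+ 2 = d * (d + 1) ^+ 2.
    rewrite (eq_bigr (fun=> (d + 1) ^+ 2)) => [|v /hn->]; last by rewrite hw.
    by rewrite (sum_nbr_const f (fun=> (d + 1) ^+ 2)) mulr_natl.
  have -> : 2 * (d * (d + 1) ^+ 2) = d * (d + 1) ^+ 2 + \sum_(v | f w v) (d + 1) ^+ 2.
    by rewrite (sum_nbr_const f (fun=> (d + 1) ^+ 2)) -[(d + 1) ^+ 2 *+ _]mulr_natl -/d; ring.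
  rewrite lerD2l [X in _ <= X](bigID (f w)) /=.
  rewrite -[X in X <= _]addr0; apply: lerD; last first.
    by apply: sumr_ge0 => v _; apply: sumr_ge0 => u _; apply: sqr_ge0.
  rewrite [X in _ <= X](eq_bigl (f w)) => [|v]; last first.
    by rewrite andb_idl //; apply: contraTneq => ->; rewrite jf.
  apply: ler_sum => v wv; rewrite (bigD1 w) 1?sf //= hw hn //.
  by rewrite [1 + d]addrC lerDl; apply: sumr_ge0 => u _; apply: sqr_ge0.
have := mate_radius q3 S l1 lE h; rewrite hh => H.
have H2 : d + 1 <= l.
  have H3 : 0 <= (l - (d + 1)) * (d * (d + 1)) by nra.
  by rewrite -subr_ge0 -(pmulr_lge0 _ (x := d * (d + 1))) // mulr_gt0 // addr_gt0.
have : d < p.+4%:R by rewrite -!natr1; lra.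
by rewrite /d ltr_nat ltnS.
Qed.

Variable w0 : W.
Hypothesis dw0 : deg f w0 = 0%N.

Lemma isolated_nbr x : f x w0 = false.
Proof.
apply/negP=> xw; have : x \in [set y | f w0 y] by rewrite inE sf.
by move/eqP: dw0; rewrite cards_eq0 => /eqP->; rewrite inE.
Qed.

Lemma isolated_kernel : Qop f (fun v => (v == w0)%:R) =1 fun=> 0.
Proof.
move=> x; rewrite Qop_delta isolated_nbr addr0.
by case: eqP => [->|]; rewrite ?dw0 ?mul0r ?mulr0.
Qed.

Lemma isolated_even : ~~ odd q.
Proof.
apply/negP=> oq; have := mate_kernel_odd q3 S oq isolated_kernel w0.
by rewrite eqxx => /eqP; rewrite oner_eq0.
Qed.

Lemma isolated_kernel_simple h : Qop f h =1 (fun=> 0) -> forall w, w != w0 -> h w = 0.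
Proof.
move=> h0 w ww0; have := mate_kernel_simple q3 S h0 isolated_kernel w w0.
by rewrite eqxx (negPf ww0) mulr1 mulr0.
Qed.

(** An isolated edge would carry a second kernel function, with the values 1 and -1 at its ends. *)
Lemma isolated_leaf_edge w z : deg f w = 1%N -> f w z -> (2 <= deg f z)%N.
Proof.
move=> dw wz; have dz : (0 < deg f z)%N.
  by apply/card_gt0P; exists w; rewrite inE sf.
rewrite leqNgt ltnS; apply/negP=> dz1; have {dz dz1} dz : deg f z = 1%N by apply/eqP; rewrite eqn_leq dz1.
have nb u v x : deg f u = 1%N -> f u v -> f u x = (x == v).
  move=> du uv; have /eqP/cards1P[z' E] : #|[set y | f u y]| = 1%N := du.
  have E' y : f u y = (y == z').
    by have := congr1 (fun A : {set W} => y \in A) E; rewrite !inE.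
  by rewrite E'; move: uv; rewrite E' => /eqP->.
have zw : z != w by apply: contraTneq wz => ->; rewrite jf.
have := @isolated_kernel_simple (fun v => 1 * (v == w)%:R + -1 * (v == z)%:R) _ w.
rewrite eqxx [w == z]eq_sym (negPf zw) => H.
have /eqP : (1 : R) * 1 + -1 * 0 = 0.
  apply: H; last by apply/eqP=> ww; move: dw; rewrite ww dw0.
  move=> x; rewrite Qop_E big_split /= -!mulr_sumr.
  have E u : \sum_(y | f x y) (y == u)%:R = (f x u)%:R :> R.
    by rewrite big_mkcond (bigD1 u) //= eqxx big1 ?addr0 => [|v /negPf->]; case: (f x _).
  rewrite !E (sf x w) (sf x z) (nb _ _ _ dw wz) (nb z w) // 1?sf //.
  have [->|xw] := eqVneq x w; first by rewrite dw eq_sym (negPf zw); ring.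
  have [->|xz] := eqVneq x z; first by rewrite dz; ring.
  ring.
by rewrite mulr0 addr0 mulr1 oner_eq0.
Qed.

Lemma isolated_unique w : deg f w = 0%N -> w = w0.
Proof.
move=> dw; apply/eqP; apply: contraT => ww0.
have H : Qop f (fun v => (v == w)%:R) =1 fun=> 0.
  move=> x; rewrite Qop_delta; have -> : f x w = false.
    apply/negP=> xw; have : x \in [set y | f w y] by rewrite inE sf.
    by move/eqP: dw; rewrite cards_eq0 => /eqP->; rewrite inE.
  by case: eqP => [->|]; rewrite ?dw ?mul0r ?mulr0 addr0.
by have /eqP := isolated_kernel_simple H ww0; rewrite eqxx oner_eq0.
Qed.

End DegreeBounds.

(** * Solving the moment equations for the numbers of vertices of each degree *)

Definition ndeg (W : finType) (f : rel W) (k : nat) : nat := #|[set w | deg f w == k]|.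

Lemma sum_deg_count (A : comNzRingType) (W : finType) (f : rel W) (s : seq nat) (F : nat -> A) :
  uniq s -> (forall w, deg f w \in s) ->
  \sum_w F (deg f w) = \sum_(k <- s) (ndeg f k)%:R * F k.
Proof.
move=> us ds; transitivity (\sum_w \sum_(k <- s) (deg f w == k)%:R * F k).
  apply: eq_bigr => w _; rewrite (bigD1_seq (deg f w)) //= eqxx mul1r big1 ?addr0 // => k.
  by rewrite eq_sym => /negPf->; rewrite mul0r.
rewrite exchange_big /=; apply: eq_bigr => k _.
rewrite -mulr_suml -natr_sum /ndeg -sum1dep_card [in RHS]big_mkcond; congr (_%:R * _).
Qed.

Lemma eq_transport (M : zmodType) (a b u v : M) : a = b -> u - v = a - b -> u = v.
Proof. by move=> ->; rewrite subrr => /eqP; rewrite subr_eq0 => /eqP. Qed.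

(* u, w, s and n count the vertices of degree P-1, P, P+1 and P+2. *)
Lemma no_isolated_arith (P Q c1 u w s n t : int) :
  5 <= P -> 0 <= u -> 0 <= w -> 0 <= n -> 0 <= t ->
  1 + c1 + u + w + s + n = Q * P ->
  c1 + (P - 1) * u + P * w + (P + 1) * s + (P + 2) * n = 2 * Q * P ->
  2 * (P - 2) * u + (P - 1) * w = (P + 1) * (1 + n) ->
  2 * (P - 1) * (P - 2) * u + P * (P - 1) * w = (P + 2) * (P + 1) * n + t ->
  False.
Proof.
move=> P5 u0 w0 n0 t0 e0 e1 h1 h2.
(* The number of vertices of degree at least 2, minus q. *)
pose X := u + w + s + n - Q.
have EX : P * X = 1 + 2 * u + w - n.
  apply: (eq_transport (congr2 (fun a b => a - b) e1 e0)); rewrite /X; ring.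
have EU : P * ((P - 1) * X - 2) = 2 * (u + n).
  apply: (eq_transport (congr2 (fun a b => (P - 1) * a + b) EX h1)); ring.
have EN : 2 * (P - 2) * u = P * (P + 1) - 2 * (P + 1) * n - t.
  apply: (eq_transport (congr2 (fun a b => P * a - b) h1 h2)); ring.
have X1 : 1 <= X.
  have : 0 <= P * ((P - 1) * X - 2) by lia.
  rewrite pmulr_rge0; last lia.
  move=> H; rewrite leNgt; apply/negP=> X0; have : (P - 1) * X <= 0 by apply: mulr_ge0_le0; lia.
  lia.
have EU1 : P * (P - 3) <= 2 * (u + n).
  have H : (P - 1) * 1 <= (P - 1) * X by apply: ler_wpM2l; lia.
  by rewrite -EU; apply: ler_wpM2l; lia.
have H1 : (P - 2) * (P * (P - 3)) <= (P - 2) * (2 * (u + n)) by apply: ler_wpM2l => //; lia.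
(* The inner factor is (P - 1)(P - 5), so P = 5 and n = t = 0; then u = 5, which is too much for
   [h1]. *)
have H2 : P * ((P - 2) * (P - 3) - (P + 1)) + 6 * n + t <= 0.
  have -> : P * ((P - 2) * (P - 3) - (P + 1)) + 6 * n + t =
     (P - 2) * (P * (P - 3)) - (P - 2) * (2 * (u + n)) + (2 * (P - 2) * u - (P * (P + 1) - 2 * (P + 1) * n - t)) by ring.
  by rewrite EN subrr addr0 subr_le0.
have P5' : P = 5.
  apply/eqP; rewrite eq_le P5 andbT leNgt; apply/negP=> P6.
  have H3 : 4 * (P - 3) <= (P - 2) * (P - 3) by apply: ler_wpM2r; lia.
  have H4 : P * 1 <= P * ((P - 2) * (P - 3) - (P + 1)) by apply: ler_wpM2l; lia.
  lia.
rewrite P5' in H2 EN h1.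
lia.
Qed.

Section IsolatedCounts.
Variables p q : nat.
Hypotheses (p1 : (1 <= p)%N) (q3 : (3 <= q)%N).
Variables (W : finType) (f : rel W).
Hypotheses (sif : simple_graph f) (cos : Q_cospectral (jfg_adj p q) f)
  (S : Q_isometry (jfg_adj p q) f).
Variable w0 : W.
Hypothesis dw0 : deg f w0 = 0%N.
Local Notation c := (fun k => (ndeg f k)%:R : int).
Local Notation T := ((\sum_w closed3 f w)%N%:R : int).

Lemma ndeg0 : ndeg f 0 = 1%N.
Proof.
rewrite /ndeg (_ : [set w | _] = [set w0]) ?cards1 //; apply/setP=> w; rewrite !inE.
by apply/eqP/eqP=> [/(isolated_unique q3 sif S dw0)|->].
Qed.

Lemma isolated_moments (s : seq nat) : uniq s -> (forall w, deg f w \in s) ->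
  forall a b k1 k0 : int,
  \sum_(k <- s) c k * (a * k%:R ^+ 3 + b * k%:R ^+ 2 + k1 * k%:R + k0) + a * T =
  q%:R * (a * p.+2%:R ^+ 3 + b * p.+2%:R ^+ 2 + k1 * p.+2%:R + k0) + q%:R * p%:R * (a + b + k1 + k0).
Proof.
move=> us ds a b k1 k0; have := mate_moments q3 sif cos a b k1 k0.
have -> : (q == 3) = false.
  by apply/eqP=> q3'; have := isolated_even q3 sif S dw0; rewrite q3'.
rewrite muln0 mul0n mulr0 addr0 => <-.
rewrite -(sum_deg_count (fun k => a * k%:R ^+ 3 + b * k%:R ^+ 2 + k1 * k%:R + k0) us ds).
by rewrite natr_sum mulr_sumr -big_split; apply: eq_bigr => w _ /=; ring.
Qed.

Lemma isolated_small_p : (p <= 3)%N.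
Proof.
rewrite leqNgt; apply/negP=> p4.
pose s := [:: 0%N; 1%N; p; p.+1; p.+2; p.+3].
have us : uniq s by rewrite /= !inE; lia.
have ds w : deg f w \in s.
  have := gap_deg q3 sif S w; have := max_deg p1 q3 sif S w; rewrite /s !inE.
  move: (deg f w) => d dm gd; have : (d <= 1)%N || (p <= d)%N by nia.
  lia.
have E := isolated_moments us ds.
have e0 := E 0 0 0 1; have e1 := E 0 0 1 0.
(* These are (d - 1)(d - p - 2) and, next, d (d - 1)(d - p - 2), zero at both degrees of the
   jellyfish graph. *)
have h1 := E 0 1 (- (p%:R + 3%:R)) (p%:R + 2%:R).
have h2 := E 1 (- (p%:R + 3%:R)) (p%:R + 2%:R) 0.
move: e0 e1 h1 h2; rewrite !big_cons !big_nil ndeg0 -!natr1.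
set c1 : int := c 1%N; set u : int := c p; set w : int := c p.+1.
set s5 : int := c p.+2; set n : int := c p.+3.
set t : int := T; set x : int := p%:R; set y : int := q%:R => e0 e1 h1 h2.
apply: (@no_isolated_arith (x + 1) y c1 u w s5 n t); rewrite ?ler0n //.
- by rewrite /x; lia.
- apply: (eq_transport e0); ring.
- apply: (eq_transport e1); ring.
- apply/esym/(eq_transport h1); ring.
- apply/esym/(eq_transport h2); ring.
Qed.

Lemma inner_count (s : seq nat) : uniq s -> (forall w, deg f w \in s) ->
  #|inner f|%:R = \sum_(k <- s) c k * ((2 <= k)%N%:R : int).
Proof.
move=> us ds; rewrite -(sum_deg_count (fun k => (2 <= k)%N%:R : int) us ds).
by rewrite -natr_sum /inner -sum1dep_card big_mkcond; congr (_%:R); apply: eq_bigr => w _; case: leqP.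
Qed.

Lemma isolated_p3 : p = 3%N ->
  [/\ ndeg f 2 = 0%N, #|inner f| = (q + 1)%N & ndeg f 1 = (3 * q - 2)%N].
Proof.
move=> p3; pose s := iota 0 7.
have ds w : deg f w \in s by have := max_deg p1 q3 sif S w; rewrite p3 mem_iota; lia.
have E := isolated_moments (isT : uniq s) ds.
have := inner_count (isT : uniq s) ds.
have := E 0 0 0 1; have := E 0 0 1 0; have := E 0 1 0 0; have := E 1 0 0 0.
rewrite /s /= !big_cons !big_nil ndeg0 p3.
set c1 := ndeg f 1; set c2 := ndeg f 2; set c3 := ndeg f 3; set c4 := ndeg f 4.
set c5 := ndeg f 5; set c6 := ndeg f 6; set t := (\sum_w _)%N => e3 e2 e1 e0 eK.
have f0 : (1 + c1 + c2 + c3 + c4 + c5 + c6 = 4 * q)%N by lia.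
have f1 : (c1 + 2 * c2 + 3 * c3 + 4 * c4 + 5 * c5 + 6 * c6 = 8 * q)%N by lia.
have f2 : (c1 + 4 * c2 + 9 * c3 + 16 * c4 + 25 * c5 + 36 * c6 = 28 * q)%N by lia.
have f3 : (c1 + 8 * c2 + 27 * c3 + 64 * c4 + 125 * c5 + 216 * c6 + t = 128 * q)%N by lia.
have fK : (#|inner f| = c2 + c3 + c4 + c5 + c6)%N by lia.
rewrite fK; move: f0 f1 f2 f3; clear; clearbody c1 c2 c3 c4 c5 c6 t => f0 f1 f2 f3.
(* The sums of (d - 1)(d - 5) and, next, d (d - 1)(d - 5); neither involves q, so a finite search
   remains. The cases p = 2 and p = 1 proceed alike with 4 and 3 in place of 5. *)
have g1 : (3 * c2 + 4 * c3 + 3 * c4 = 5 + 5 * c6)%N by lia.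
have g2 : (6 * c2 + 12 * c3 + 12 * c4 = t + 30 * c6)%N by lia.
have h6 : (c6 <= 2)%N by lia.
have h3 : (c3 <= 3)%N by lia.
have [|[|]] : (c6 = 0 \/ c6 = 1 \/ c6 = 2)%N by lia.
all: move=> E6; have [|[|[|]]] : (c3 = 0 \/ c3 = 1 \/ c3 = 2 \/ c3 = 3)%N by lia.
all: move=> E3; split; lia.
Qed.

Lemma isolated_p2 : p = 2%N ->
  [/\ ndeg f 2 = 0%N, #|inner f| = (q + 1)%N & ndeg f 1 = (2 * q - 2)%N] \/
  [/\ ndeg f 2 = 2%N, #|inner f| = (q + 2)%N, ndeg f 1 = (2 * q - 3)%N &
      forall w, closed3 f w = 0%N].
Proof.
move=> p2; pose s := iota 0 6.
have ds w : deg f w \in s by have := max_deg p1 q3 sif S w; rewrite p2 mem_iota; lia.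
have E := isolated_moments (isT : uniq s) ds.
have := inner_count (isT : uniq s) ds.
have := E 0 0 0 1; have := E 0 0 1 0; have := E 0 1 0 0; have := E 1 0 0 0.
rewrite /s /= !big_cons !big_nil ndeg0 p2.
have ct : (\sum_w closed3 f w = 0 -> forall w, closed3 f w = 0)%N.
  by move=> /eqP; rewrite sum_nat_eq0 => /forallP H w; apply/eqP; have := H w.
move: ct; set c1 := ndeg f 1; set c2 := ndeg f 2; set c3 := ndeg f 3; set c4 := ndeg f 4.
set c5 := ndeg f 5; set t := (\sum_w _)%N => ct e3 e2 e1 e0 eK.
have f0 : (1 + c1 + c2 + c3 + c4 + c5 = 3 * q)%N by lia.
have f1 : (c1 + 2 * c2 + 3 * c3 + 4 * c4 + 5 * c5 = 6 * q)%N by lia.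
have f2 : (c1 + 4 * c2 + 9 * c3 + 16 * c4 + 25 * c5 = 18 * q)%N by lia.
have f3 : (c1 + 8 * c2 + 27 * c3 + 64 * c4 + 125 * c5 + t = 66 * q)%N by lia.
have fK : (#|inner f| = c2 + c3 + c4 + c5)%N by lia.
rewrite fK.
suff [[H1 H2 H3]|[H1 H2 H3 H4]] : [/\ c2 = 0, c2 + c3 + c4 + c5 = q + 1 & c1 = 2 * q - 2]%N \/
    [/\ c2 = 2, c2 + c3 + c4 + c5 = q + 2, c1 = 2 * q - 3 & t = 0]%N.
- by left.
- by right; split=> //; apply: ct.
move: f0 f1 f2 f3; clear; clearbody c1 c2 c3 c4 c5 t => f0 f1 f2 f3.
have g1 : (2 * c2 + 2 * c3 = 4 + 4 * c5)%N by lia.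
have g2 : (4 * c2 + 6 * c3 = t + 20 * c5)%N by lia.
have h5 : (c5 <= 1)%N by lia.
have [|] : (c5 = 0 \/ c5 = 1)%N by lia.
all: move=> E5; have [|[|[|[|]]]] : (c2 = 0 \/ c2 = 1 \/ c2 = 2 \/ c2 = 3 \/ c2 = 4)%N by lia.
all: move=> E2; first [by exfalso; lia|left; split; lia|right; split; lia].
Qed.

(** The moments give c2 = 3 + 3 c4 and t = 6 - 6 c4: one triangle and no vertex of degree 4, or one
    such vertex and no triangle. *)
Lemma isolated_p1 : p = 1%N ->
  [/\ ndeg f 2 = 3%N, ndeg f 3 = (q - 1)%N, ndeg f 1 = (q - 3)%N, ndeg f 4 = 0%N &
      (\sum_w closed3 f w)%N = 6%N] \/
  [/\ ndeg f 2 = 6%N, ndeg f 3 = (q - 4)%N, ndeg f 1 = (q - 4)%N, ndeg f 4 = 1%N &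
      forall w, closed3 f w = 0%N].
Proof.
move=> p1'; pose s := iota 0 5.
have ds w : deg f w \in s by have := max_deg p1 q3 sif S w; rewrite p1' mem_iota; lia.
have E := isolated_moments (isT : uniq s) ds.
have := E 0 0 0 1; have := E 0 0 1 0; have := E 0 1 0 0; have := E 1 0 0 0.
rewrite /s /= !big_cons !big_nil ndeg0 p1'.
have ct : (\sum_w closed3 f w = 0 -> forall w, closed3 f w = 0)%N.
  by move=> /eqP; rewrite sum_nat_eq0 => /forallP H w; apply/eqP; have := H w.
move: ct; set c1 := ndeg f 1; set c2 := ndeg f 2; set c3 := ndeg f 3; set c4 := ndeg f 4.
set t := (\sum_w _)%N => ct e3 e2 e1 e0.
have f0 : (1 + c1 + c2 + c3 + c4 = 2 * q)%N by lia.
have f1 : (c1 + 2 * c2 + 3 * c3 + 4 * c4 = 4 * q)%N by lia.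
have f2 : (c1 + 4 * c2 + 9 * c3 + 16 * c4 = 10 * q)%N by lia.
have f3 : (c1 + 8 * c2 + 27 * c3 + 64 * c4 + t = 28 * q)%N by lia.
suff [[H1 H2 H3 H4 H5]|[H1 H2 H3 H4 H5]] :
   [/\ c2 = 3, c3 = q - 1, c1 = q - 3, c4 = 0 & t = 6]%N \/
   [/\ c2 = 6, c3 = q - 4, c1 = q - 4, c4 = 1 & t = 0]%N.
- by left.
- by right; split=> //; apply: ct.
move: f0 f1 f2 f3; clear; clearbody c1 c2 c3 c4 t => f0 f1 f2 f3.
have g1 : (c2 = 3 + 3 * c4)%N by lia.
have g2 : (2 * c2 = t + 12 * c4)%N by lia.
have [|] : (c4 = 0 \/ c4 = 1)%N by lia.
all: move=> E5; first [left; split; lia|right; split; lia].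
Qed.

End IsolatedCounts.

Lemma exists_subset_card (W : finType) (A : {set W}) n : (n <= #|A|)%N ->
  exists2 B : {set W}, B \subset A & #|B| = n.
Proof.
move=> nA; exists [set x in take n (enum A)].
  by apply/subsetP=> x; rewrite inE => /mem_take; rewrite mem_enum.
rewrite cardsE (card_uniqP _) ?take_uniq ?enum_uniq //.
by rewrite size_take -cardE; case: ltngtP nA => // ->.
Qed.

(** * Exclusion of the patterns with p = 2, 3 *)

Section ExcessCriteria.
Variables (W : finType) (f : rel W).
Hypothesis sif : simple_graph f.
Local Notation nb T v := #|[set z in T | f v z]|.

Let sf : symmetric f := proj1 sif.

Lemma nb_lt (T : {set W}) v : v \in T -> (nb T v < #|T|)%N.
Proof.
move=> vT; rewrite (cardsD1 v T) vT ltnS; apply: subset_leq_card.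
apply/subsetP=> z; rewrite !inE => /andP[-> vz]; rewrite andbT.
by apply: contraTneq vz => ->; have [_ ->] := sif.
Qed.

Lemma excess_ge0 (T : {set W}) y : (forall v, v \in T -> (nb T v < deg f v)%N) ->
  (forall w, w \notin T -> y w = 0) -> 0 <= excess f y.
Proof.
move=> dT y0; suff : 0 <= 2 * excess f y by rewrite pmulr_rge0.
rewrite (excess_supported sf y0); apply: addr_ge0.
  by apply: sumr_ge0 => u _; apply: sumr_ge0 => v _; apply: sqr_ge0.
apply: mulr_ge0 => //; apply: sumr_ge0 => u uT; apply: mulr_ge0; last exact: sqr_ge0.
by have := dT u uT; rewrite -(ler_nat R) -natr1 => H; lra.
Qed.

(** [B] is the support of [y]. The excess is positive once a vertex of [B] has a surplus of degree
    or an edge inside [T] leaves [B], for that edge gives a nonzero square. *)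
Lemma excess_gt0 (T : {set W}) y : (forall v, v \in T -> (nb T v < deg f v)%N) ->
  (forall B : {set W}, B \subset T -> B != set0 -> exists2 v, v \in B &
     ((nb T v).+1 < deg f v)%N \/ exists u, [/\ u \in T, u \notin B & f v u]) ->
  (forall w, w \notin T -> y w = 0) -> (exists w, y w != 0) -> 0 < excess f y.
Proof.
move=> dT sT y0 [w yw]; rewrite lt_neqAle (excess_ge0 dT y0) andbT eq_sym.
apply/negP=> /eqP e0; have := excess_supported sf y0; rewrite e0 mulr0 => /esym/eqP.
have H1 : 0 <= \sum_(u in T) \sum_(v in T | f u v) (y u + y v) ^+ 2.
  by apply: sumr_ge0 => u _; apply: sumr_ge0 => v _; apply: sqr_ge0.
have T2 u : u \in T -> 0 <= ((deg f u)%:R - 1 - (nb T u)%:R) * y u ^+ 2.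
  move=> uT; apply: mulr_ge0; last exact: sqr_ge0.
  by have := dT u uT; rewrite -(ler_nat R) -natr1 => H; lra.
rewrite paddr_eq0 //; last by apply: mulr_ge0 => //; apply: sumr_ge0.
case/andP; rewrite psumr_eq0 => [/allP E1|u _]; last by apply: sumr_ge0 => v _; apply: sqr_ge0.
rewrite mulf_eq0 pnatr_eq0 /= psumr_eq0 // => /allP E2.
pose B := [set v | y v != 0].
have BT : B \subset T.
  by apply/subsetP=> v; rewrite inE; apply: contraNT => /y0->.
have [|v vB [sv|[u [uT uB vu]]]] := sT B BT.
- by apply/set0Pn; exists w; rewrite inE.
- have vT := subsetP BT v vB; have /implyP/(_ vT) := E2 v (mem_index_enum _).
  rewrite mulf_eq0 sqrf_eq0 gt_eqF => [/= yv|]; first by move: vB; rewrite inE yv.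
  by move: sv; rewrite -(ltr_nat R) -natr1 => H; lra.
have vT := subsetP BT v vB; have /implyP/(_ vT) := E1 v (mem_index_enum _).
rewrite psumr_eq0 => [/allP/(_ u (mem_index_enum _))|z _]; last exact: sqr_ge0.
move: uB vB; rewrite !inE negbK uT vu /= => /eqP->.
by rewrite sqrf_eq0 addr0 => /negPf->.
Qed.

End ExcessCriteria.

Lemma bearing_bare (W : finType) (f : rel W) : (#|bearing f| + #|bare f| = #|inner f|)%N.
Proof.
rewrite /bare; have /setIidPr E : bearing f \subset inner f by apply/subsetP=> w; rewrite inE => /andP[].
by rewrite -(cardsID (bearing f) (inner f)) E.
Qed.

Section Isolated.
Variables p q : nat.
Hypotheses (p1 : (1 <= p)%N) (q3 : (3 <= q)%N).
Variables (W : finType) (f : rel W).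
Hypotheses (sif : simple_graph f) (S : Q_isometry (jfg_adj p q) f).
Variable w0 : W.
Hypothesis dw0 : deg f w0 = 0%N.

Lemma bare_deg w : w \in bare f -> (2 <= deg f w)%N.
Proof. by rewrite in_setD => /andP[_]; rewrite inE. Qed.

(** Three bare vertices, each of degree at least 3, violate [nonneg_bound], as p q - 2 + 3 > p q. If
    there are at most two, all of them enter [pos_bound], and the q + 1 inner vertices exceed q. *)
Lemma min_deg3_absurd : ndeg f 2 = 0%N -> #|inner f| = (q + 1)%N ->
  ndeg f 1 = (p * q - 2)%N -> False.
Proof.
move=> c2 cK c1; have le := isolated_leaf_edge q3 sif S dw0.
have d3 w : w \in bare f -> (3 <= deg f w)%N.
  move=> /bare_deg; rewrite leq_eqVlt => /orP[/eqP d2|//].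
  have : w \in [set w | deg f w == 2] by rewrite inE -d2.
  by have /eqP := c2; rewrite cards_eq0 => /eqP->; rewrite inE.
have pq : (2 <= p * q)%N by nia.
case: (leqP 3 #|bare f|) => b3.
  have [T Tb T3] := exists_subset_card b3.
  have := nonneg_bound p1 q3 sif S le Tb _.
  rewrite -[#|leaves f|]/(ndeg f 1) c1 T3 => H.
  suff : (p * q - 2 + 3 <= q * p)%N by rewrite mulnC; lia.
  apply: H => y; apply: excess_ge0 => // v vT.
  have := nb_lt sif vT; have := d3 v (subsetP Tb v vT); rewrite T3; lia.
have : (#|bearing f| + #|bare f| <= q)%N.
  apply: (pos_bound q3 sif S le (subxx _)) => y; apply: excess_gt0 => // [v vT|B BT /set0Pn[v vB]].
    by have := nb_lt sif vT; have := d3 v vT; lia.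
  have vT := subsetP BT v vB; exists v => //.
  by left; have := nb_lt sif vT; have := d3 v vT; lia.
by rewrite bearing_bare cK addn1 ltnn.
Qed.
End Isolated.

(** * The triangle-free pattern with p = 2 *)

Section StarPlus.
Variables (W : finType) (f : rel W).
Hypothesis sif : simple_graph f.
Hypothesis trf : forall w, closed3 f w = 0%N.
Local Notation nb T v := #|[set z in T | f v z]|.

Let sf : symmetric f := proj1 sif.
Let jf : irreflexive f := proj2 sif.

Lemma triangle_free x y z : f x y -> f x z -> f y z = false.
Proof. by move=> xy xz; apply: closed3_eq0 (trf x) xz xy. Qed.

Lemma nbU1 (T : {set W}) t v : t \notin T -> nb (t |: T) v = (f v t + nb T v)%N.
Proof.
move=> tT; case: (boolP (f v t)) => vt.
  have -> : [set z in t |: T | f v z] = t |: [set z in T | f v z].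
    by apply/setP=> z; rewrite !inE; case: eqP => [->|]; rewrite ?vt.
  by rewrite cardsU1 inE (negPf tT).
congr #|pred_of_set _|; apply/setP=> z; rewrite !inE; case: eqP => [->|] //=.
by rewrite (negPf vt) andbF.
Qed.

(* A star with three rays, at most one of them ending at a vertex u of degree two:
   c^2/2 + c^2/2 + c^2 is all that completing the three squares can cost. *)
Lemma star_excess_ge0 (T : {set W}) c u y : #|T| = 4%N -> c \in T ->
  (forall v, v \in T -> v != c -> f c v) -> (3 <= deg f c)%N ->
  (forall v, v \in T -> (2 <= deg f v)%N) -> (forall v, v \in T -> v != u -> (3 <= deg f v)%N) ->
  (forall w, w \notin T -> y w = 0) -> 0 <= excess f y.
Proof.
move=> T4 cT cv dc d2 d3 y0.
have -> : excess f y = ((deg f c)%:R - 1) * y c ^+ 2 +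
   \sum_(v in T :\ c) (((deg f v)%:R - 1) * y v ^+ 2 + 2 * y c * y v).
  rewrite /excess bil_E.
  have -> : \sum_x ((deg f x)%:R - 1) * (y x * y x) = \sum_(x in T) ((deg f x)%:R - 1) * y x ^+ 2.
    rewrite [RHS]big_mkcond; apply: eq_bigr => x _; case: ifPn => // /y0 ->.
    by rewrite mul0r mulr0.
  have nc : \sum_(z | f c z) y z = \sum_(v in T :\ c) y v.
    rewrite big_mkcond [RHS]big_mkcond; apply: eq_bigr => z _; rewrite in_setD1.
    case: (boolP (z \in T)) => [zT|/y0->]; last by rewrite andbF; case: ifP.
    by case: eqP => [->|/eqP zc] /=; rewrite ?jf ?cv.
  have -> : \sum_x y x * (\sum_(z | f x z) y z) = y c * \sum_(v in T :\ c) y v + \sum_(v in T :\ c) y v * y c.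
    rewrite (bigD1 c) //= nc; congr (_ + _).
    rewrite [RHS]big_mkcond [LHS]big_mkcond; apply: eq_bigr => x _; rewrite in_setD1.
    case: ifPn => //= xc; case: ifPn => [xT|/y0->]; last by rewrite mul0r.
    congr (_ * _); rewrite (bigD1 c) 1?sf ?cv //= big1 ?addr0 // => z /andP[xz zc].
    case: (boolP (z \in T)) => [zT|/y0//].
    by have := triangle_free (cv x xT xc) (cv z zT zc); rewrite xz.
  rewrite (bigD1 c) //= (eq_bigl (fun v => v \in T :\ c)) => [|v]; last by rewrite in_setD1 andbC.
  rewrite mulr_sumr -addrA -!big_split /=; congr (_ + _); apply: eq_bigr => v _; ring.
have c3 : 2 * y c ^+ 2 <= ((deg f c)%:R - 1) * y c ^+ 2.
  apply: ler_wpM2r; first exact: sqr_ge0.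
  by move: dc; rewrite -(ler_nat R) => H; lra.
(* From (y_c + y_v)^2 >= 0 at [u], at cost y_c^2, and from (y_c + 2 y_v)^2 / 2 >= 0 elsewhere, at
   half that cost. *)
have low v : v \in T :\ c -> - (1 / 2 + (v == u)%:R / 2) * y c ^+ 2 <= ((deg f v)%:R - 1) * y v ^+ 2 + 2 * y c * y v.
  rewrite in_setD1 => /andP[vc vT]; have yv := sqr_ge0 (y v).
  have [vu|vu] := eqVneq v u.
    have := d2 v vT; rewrite -(ler_nat R) => d2v.
    have := sqr_ge0 (y c + y v); rewrite /= => H.
    have H1 : y v ^+ 2 <= ((deg f v)%:R - 1) * y v ^+ 2 by rewrite -[X in X <= _]mul1r; apply: ler_wpM2r => //; lra.
    nra.
  have := d3 v vT vu; rewrite -(ler_nat R) => d3v.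
  have := sqr_ge0 (y c + 2 * y v); rewrite /= => H.
  have H1 : 2 * y v ^+ 2 <= ((deg f v)%:R - 1) * y v ^+ 2 by apply: ler_wpM2r => //; lra.
  nra.
have H0 : \sum_(v in T :\ c) - (1 / 2 + (v == u)%:R / 2) * y c ^+ 2 <=
    \sum_(v in T :\ c) (((deg f v)%:R - 1) * y v ^+ 2 + 2 * y c * y v) by apply: ler_sum.
have T3 : #|T :\ c| = 3%N by have := cardsD1 c T; rewrite cT T4 => -[].
move: H0; rewrite -mulr_suml sumrN big_split /= -[\sum_(i in T :\ c) (i == u)%:R / 2]mulr_suml sumr_const T3.
have : \sum_(v in T :\ c) (v == u)%:R <= 1 :> R.
  rewrite big_mkcond (bigD1 u) //= big1 ?addr0 => [|v /negPf->]; last by case: ifP.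
  by case: ifP; rewrite ?eqxx.
move: (\sum_(v in T :\ c) (v == u)%:R) => s s1 H.
have H5 : s * y c ^+ 2 <= 1 * y c ^+ 2 by apply: ler_wpM2r; first exact: sqr_ge0.
move: H c3; set z := y c ^+ 2 in H5 *; move=> H c3.
lra.
Qed.

End StarPlus.

Section CaseTwo.
Variable q : nat.
Hypotheses (q3 : (3 <= q)%N).
Variables (W : finType) (f : rel W).
Hypotheses (sif : simple_graph f) (S : Q_isometry (jfg_adj 2 q) f).
Hypothesis trf : forall w, closed3 f w = 0%N.
Variable w0 : W.
Hypothesis dw0 : deg f w0 = 0%N.
Hypotheses (c2 : ndeg f 2 = 2%N) (cK : #|inner f| = (q + 2)%N) (c1 : ndeg f 1 = (2 * q - 3)%N).
Local Notation nb T v := #|[set z in T | f v z]|.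
Local Notation Z := (bare f).
Local Notation U := [set w in Z | deg f w == 2%N].
Local Notation V := [set w in Z | (3 <= deg f w)%N].

Let sf : symmetric f := proj1 sif.
Let jf : irreflexive f := proj2 sif.
Let le := isolated_leaf_edge q3 sif S dw0.
Let tri := triangle_free trf.

(* The difference of two such twins is an eigenvector for 2, and Q has no eigenvalue in (1, 3). *)
Lemma no_twins u u' a b : u != u' -> a != b -> deg f u = 2%N -> deg f u' = 2%N ->
  f u a -> f u b -> f u' a -> f u' b -> False.
Proof.
move=> uu ab du du' ua ub u'a u'b.
have nE t : deg f t = 2%N -> f t a -> f t b -> forall z, f t z = (z \in [set a; b]).
  move=> dt ta tb z; have /eqP : [set a; b] = [set z | f t z].
    apply/eqP; rewrite eqEcard -/(deg f t) dt cards2 ab andbT.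
    by apply/subsetP=> x; rewrite !inE => /orP[]/eqP->.
  by move=> /eqP->; rewrite inE.
have ff z : f u z = f u' z by rewrite (nE u) // (nE u').
pose h v : R := (v == u)%:R - (v == u')%:R.
have Qh : Qop f h =1 fun v => 2 * h v.
  move=> x; rewrite Qop_E /h sumrB.
  have E t : \sum_(y | f x y) (y == t)%:R = (f x t)%:R :> R.
    by rewrite big_mkcond (bigD1 t) //= eqxx big1 ?addr0 => [|v /negPf->]; case: (f x _).
  rewrite !E (sf x u) (sf x u') ff subrr addr0.
  have [->|xu] := eqVneq x u; first by rewrite du.
  have [->|xu'] := eqVneq x u'; first by rewrite du'.
  by rewrite subrr !mulr0.
have := mate_gap_ge0 q3 S h; rewrite /gap_form.
have -> : dot (fun x => Qop f h x - h x) (fun x => Qop f h x - (2 + 1) * h x) = - dot h h.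
  by rewrite /dot -sumrN; apply: eq_bigr => x _; rewrite Qh; ring.
rewrite oppr_ge0 => H; have : 0 < dot h h.
  rewrite /dot (bigD1 u) //=; apply: ltr_pwDl.
    by rewrite /h eqxx (negPf uu) subr0 mulr1.
  by apply: sumr_ge0 => v _; rewrite -expr2 sqr_ge0.
by rewrite ltNge H.
Qed.

(** With the 2 q - 3 leaves, four bare vertices exceed the bound 2 q. *)
Lemma nonneg_four (T : {set W}) : T \subset Z -> #|T| = 4%N ->
  (forall y, (forall w, w \notin T -> y w = 0) -> 0 <= excess f y) -> False.
Proof.
move=> TZ T4 H; have := nonneg_bound (isT : (1 <= 2)%N) q3 sif S le TZ H.
rewrite -[#|leaves f|]/(ndeg f 1) c1 T4; lia.
Qed.

(** There are q + 2 inner vertices, so even with one bare vertex left out the bound q is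
    exceeded. *)
Lemma pos_codim1 (T : {set W}) : T \subset Z -> (#|Z| <= #|T|.+1)%N ->
  (forall y, (forall w, w \notin T -> y w = 0) -> (exists w, y w != 0) -> 0 < excess f y) -> False.
Proof.
move=> TZ TZ1 H; have := pos_bound q3 sif S le TZ H.
have := bearing_bare f; rewrite cK; lia.
Qed.

Lemma U_le2 : (#|U| <= 2)%N.
Proof.
rewrite -[X in (_ <= X)%N]c2; apply: subset_leq_card.
by apply/subsetP=> w; rewrite !inE => /andP[_ ->].
Qed.

Lemma UV : (#|U| + #|V| = #|Z|)%N.
Proof.
have mU w : (w \in U) = (w \in Z) && (deg f w == 2%N) by rewrite in_set.
have mV w : (w \in V) = (w \in Z) && (3 <= deg f w)%N by rewrite in_set.
rewrite -(cardsID U Z); congr (_ + _)%N; apply: eq_card => w.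
  by rewrite in_setI mU; case: (w \in Z).
rewrite in_setD mU mV; case: (boolP (w \in Z)) => [/bare_deg|]; last by rewrite andbF.
by move=> d2; rewrite andbT /= ltn_neqAle d2 andbT eq_sym.
Qed.

Lemma Vdeg v : v \in V -> (3 <= deg f v)%N.
Proof. by rewrite in_set => /andP[_]. Qed.

Lemma Udeg v : v \in U -> deg f v = 2%N.
Proof. by rewrite in_set => /andP[_ /eqP]. Qed.

Lemma UnV t : t \in U -> t \notin V.
Proof. by move=> /Udeg dt; rewrite in_set dt andbF. Qed.

(** A vertex other than [u] adjacent to the three others makes [T] a star, as there are no
    triangles; if there is none, every vertex of [T] has fewer neighbours in [T] than its degree. *)
Lemma four_absurd (T : {set W}) u : T \subset Z -> #|T| = 4%N ->
  (forall v, v \in T -> v != u -> (3 <= deg f v)%N) -> (u \in T -> nb T u < deg f u)%N -> False.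
Proof.
move=> TZ T4 d3 du; apply: (nonneg_four TZ T4) => y y0.
have d2 v : v \in T -> (2 <= deg f v)%N by move=> vT; apply: bare_deg (subsetP TZ v vT).
have [/existsP[c /andP[/andP[cT cu] c3]]|/existsPn H] := boolP [exists c, (c \in T) && (c != u) && (nb T c == 3)].
  have cv v : v \in T -> v != c -> f c v.
    move=> vT vc; apply: contraLR c3 => ncv; rewrite neq_ltn; apply/orP; left.
    have : [set z in T | f c z] \subset T :\ c :\ v.
      apply/subsetP=> z; rewrite !inE => /andP[-> cz]; rewrite andbT; apply/andP; split.
        by apply: contraTneq cz => ->.
      by apply: contraTneq cz => ->; rewrite jf.
    move/subset_leq_card; have := cardsD1 c T; have := cardsD1 v (T :\ c).
    rewrite !inE vc vT cT T4 /=; lia.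
  exact: (star_excess_ge0 sif trf T4 cT cv (d3 c cT cu) d2 d3 y0).
apply: (excess_ge0 sif _ y0) => v vT; have [vu|vu] := eqVneq v u; first by move: vT; rewrite vu; apply: du.
have := H v; rewrite vT vu /= => n3; have := nb_lt sif vT; have := d3 v vT vu; rewrite T4; lia.
Qed.

Lemma three_strict (T : {set W}) v x : (#|T| <= 3)%N -> v \in T -> (2 <= nb T v)%N ->
  x \in T -> f v x -> (nb T x <= 1)%N.
Proof.
move=> T3 vT nv xT vx.
have : [set z in T | f x z] \subset [set v].
  apply/subsetP=> z; rewrite !inE => /andP[zT xz]; apply: contraTT nv => zv.
  have vz : f v z = false.
    by apply/negP=> vz; have := tri vx vz; rewrite xz.
  rewrite -ltnNge ltnS.
  have : [set y in T | f v y] \subset T :\ v :\ z.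
    apply/subsetP=> y; rewrite !inE => /andP[-> vy]; rewrite andbT; apply/andP; split.
      by apply: contraTneq vy => ->; rewrite vz.
    by apply: contraTneq vy => ->; rewrite jf.
  move/subset_leq_card; have := cardsD1 v T; have := cardsD1 z (T :\ v).
  by rewrite !inE zv zT vT /=; lia.
by move/subset_leq_card; rewrite cards1.
Qed.

(** Only the middle vertex of a path on three vertices can lack a surplus of degree, and the ends of
    that path have one. *)
Lemma V_pos y : (#|V| <= 3)%N -> (forall w, w \notin V -> y w = 0) -> (exists w, y w != 0) ->
  0 < excess f y.
Proof.
move=> V3; apply: (excess_gt0 sif) => [v vV|B BV /set0Pn[v vB]].
  by have := nb_lt sif vV; have := Vdeg vV; lia.
have vV := subsetP BV v vB; have dv := Vdeg vV.
case: (leqP 2 (nb V v)) => nv; last by exists v => //; left; lia.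
have /card_gt0P[x] : (0 < nb V v)%N by lia.
rewrite in_set => /andP[xV vx]; have nx := three_strict V3 vV nv xV vx.
have [xB|xB] := boolP (x \in B); last by exists v => //; right; exists x.
by exists x => //; left; apply: leq_trans (Vdeg xV); rewrite !ltnS.
Qed.

Lemma tV_pos t y : t \in U -> (#|V| <= 2)%N -> (nb V t <= 1)%N ->
  (forall w, w \notin t |: V -> y w = 0) -> (exists w, y w != 0) -> 0 < excess f y.
Proof.
move=> tU V2 nt; have tV := UnV tU; have dt := Udeg tU.
have T3 : (#|t |: V| <= 3)%N by rewrite cardsU1 tV; lia.
have ntT : nb (t |: V) t = nb V t by rewrite nbU1 // jf.
apply: (excess_gt0 sif) => [v vT|B BT B0].
  have := nb_lt sif vT; have := vT; rewrite in_setU1 => /orP[/eqP->|/Vdeg]; last by lia.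
  by rewrite ntT dt; lia.
have [/existsP[v /andP[vB vV]]|/existsPn noV] := boolP [exists v, (v \in B) && (v \in V)].
  have vT := subsetP BT v vB; have dv := Vdeg vV.
  case: (leqP 2 (nb (t |: V) v)) => nv; last by exists v => //; left; apply: leq_trans dv; rewrite ltnS.
  have [x [xV vx]] : exists x, x \in V /\ f v x.
    have /card_gt0P[x] : (0 < nb V v)%N by move: nv; rewrite nbU1 //; case: (f v t); case: (nb V v).
    by rewrite in_set => /andP[xV vx]; exists x.
  have xT : x \in t |: V by rewrite in_setU1 xV orbT.
  have nx := three_strict T3 vT nv xT vx.
  have [xB|xB] := boolP (x \in B); last by exists v => //; right; exists x.
  by exists x => //; left; apply: leq_trans (Vdeg xV); rewrite !ltnS.
case/set0Pn: B0 => v vB; have vt : v = t.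
  have := subsetP BT v vB; rewrite in_setU1 => /orP[/eqP//|vV].
  by have := noV v; rewrite vB vV.
exists v => //; rewrite vt ntT dt; case: (posnP (nb V t)) => [->|]; first by left.
case/card_gt0P=> x; rewrite in_set => /andP[xV tx]; right; exists x; split=> //.
  by rewrite in_setU1 xV orbT.
by apply/negP=> xB; have := noV x; rewrite xB xV.
Qed.

Lemma case_two_absurd : False.
Proof.
have ZV : V \subset Z by apply/subsetP=> w; rewrite in_set => /andP[].
have ZU : U \subset Z by apply/subsetP=> w; rewrite in_set => /andP[].
have ZtV t : t \in U -> t |: V \subset Z.
  by move=> tU; rewrite subUset sub1set ZV andbT; apply: subsetP ZU t tU.
have uv := UV; have u2 := U_le2.
case: (leqP 4 #|V|) => V4.
  have [T TV T4] := exists_subset_card V4.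
  (* [w0] is isolated, hence outside [T]: no vertex is exempted from the degree bound. *)
  apply: (four_absurd (u := w0) (subset_trans TV ZV) T4) => [v vT _|wT].
    exact: Vdeg (subsetP TV v vT).
  by have := Vdeg (subsetP TV w0 wT); rewrite dw0.
case: (leqP 2 #|U|) => U2; last first.
  by apply: (pos_codim1 ZV) => [|y]; [lia|apply: V_pos; lia].
have [/existsP[t /andP[tU nt]]|/existsPn nog] := boolP [exists t, (t \in U) && (nb V t <= 1)%N].
  have tV := UnV tU; have cT : #|t |: V| = #|V|.+1 by rewrite cardsU1 tV.
  case: (ltnP #|V| 3) => V3.
    apply: (pos_codim1 (ZtV t tU)) => [|y]; first by rewrite cT; lia.
    by apply: tV_pos; lia.
  apply: (four_absurd (u := t) (ZtV t tU)) => [|v|_]; first by rewrite cT; lia.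
    by rewrite in_setU1 => /orP[/eqP->|vV _]; [rewrite eqxx|apply: Vdeg].
  by rewrite nbU1 // jf (Udeg tU); lia.
have [u [u' [uU u'U uu']]] : exists u u', [/\ u \in U, u' \in U & u != u'].
  by have /card_gt1P[u [u' [? ? ?]]] := U2; exists u, u'.
have nV t : t \in U -> (2 <= nb V t)%N by move=> tU; have := nog t; rewrite tU -ltnNge.
(* Two sets of at least two vertices each meet inside [V], which has at most three. *)
have [b [bV ub u'b]] : exists b, [/\ b \in V, f u b & f u' b].
  have /card_gt0P[b] : (0 < #|[set z in V | f u z] :&: [set z in V | f u' z]|)%N.
    have := cardsUI [set z in V | f u z] [set z in V | f u' z].
    have : (#|[set z in V | f u z] :|: [set z in V | f u' z]| <= #|V|)%N.
      apply: subset_leq_card; apply/subsetP=> z; rewrite in_setU !in_set.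
      by case/orP=> /andP[].
    by have := nV u uU; have := nV u' u'U; lia.
  by rewrite in_setI => /andP[/setIdP[bV ub] /setIdP[_ u'b]]; exists b.
have twin v : v != b -> f u v -> f u' v -> False.
  by move=> vb uv' u'v; apply: (no_twins uu' vb (Udeg uU) (Udeg u'U)).
have nT t (T : {set W}) : t \in U -> f t b -> b \notin T -> (nb T t < deg f t)%N.
  move=> tU tb bT; rewrite /deg; apply: proper_card; apply/properP; split.
    by apply/subsetP=> z; rewrite !in_set => /andP[].
  by exists b; rewrite ?in_set ?tb // (negPf bT).
(* If [V] had only two vertices, [u] and [u'] would both be adjacent to all of it and be twins. *)
have V3 : #|V| = 3%N.
  apply/eqP; rewrite eqn_leq -ltnS V4 /= ltnNge; apply/negP=> V2.
  have full t : t \in U -> [set z in V | f t z] = V.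
    move=> tU; apply/eqP; rewrite eqEcard; apply/andP; split; last exact: leq_trans V2 (nV t tU).
    by apply/subsetP=> z /setIdP[].
  have /card_gt1P[x [y [xV yV xy]]] : (1 < #|V|)%N by rewrite -(full u uU); apply: nV.
  have [v vV vb] : exists2 v, v \in V & v != b.
    by have [xb|xb] := eqVneq x b; [exists y => //; rewrite -xb eq_sym|exists x].
  apply: (twin v vb); first by move: vV; rewrite -{1}(full u uU) => /setIdP[].
  by move: vV; rewrite -{1}(full u' u'U) => /setIdP[].
have bZ := subsetP ZV b bV.
have U2E : #|U| = 2%N by apply/eqP; rewrite eqn_leq u2.
have T4 : #|Z :\ b| = 4%N by have := cardsD1 b Z; rewrite bZ -uv U2E V3 => -[].
(* Outside [b], a vertex of [U] has lost its neighbour [b], and a vertex of [V] misses [u] or [u'],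
   since adjacency to both would, together with [b], make them twins. *)
apply: (nonneg_four (subsetDl Z [set b]) T4) => y; apply: (excess_ge0 sif) => v vT.
have vZ : v \in Z by move: vT; rewrite in_setD1 => /andP[].
have vb : v != b by move: vT; rewrite in_setD1 => /andP[].
have bT : b \notin Z :\ b by rewrite in_setD1 eqxx.
have [vV|vV] := boolP (v \in V).
  have dv := Vdeg vV; apply: leq_trans dv; rewrite ltnS.
  have [z zU vz] : exists2 z, z \in [set u; u'] & f v z = false.
    case: (boolP (f v u)) => [vu|/negPf vu]; last by exists u; rewrite ?in_set2 ?eqxx.
    exists u'; first by rewrite in_set2 eqxx orbT.
    by apply/negP=> vu'; apply: (twin v vb); rewrite sf.
  have {}zU : z \in U by move: zU; rewrite in_set2 => /orP[]/eqP->.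
  have zT : z \in Z :\ b :\ v.
    rewrite !in_setD1 (subsetP ZU z zU) andbT; apply/andP; split.
      by apply: contraTneq vV => <-; apply: UnV.
    by apply: contraTneq bV => <-; apply: UnV.
  have : [set y in Z :\ b | f v y] \subset Z :\ b :\ v :\ z.
    apply/subsetP=> x /setIdP[xT vx]; rewrite in_setD1 in_setD1 xT andbT; apply/andP; split.
      by apply: contraTneq vx => ->; rewrite vz.
    by apply: contraTneq vx => ->; rewrite jf.
  move/subset_leq_card; have := cardsD1 v (Z :\ b); have := cardsD1 z (Z :\ b :\ v).
  by rewrite zT vT T4 !add1n => -> [<-].
have vU : v \in U.
  move: vV; rewrite [v \in V]in_set [v \in U]in_set vZ /= -ltnNge ltnS => d2.
  by rewrite eqn_leq d2; apply: bare_deg.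
have UE : [set u; u'] = U.
  apply/eqP; rewrite eqEcard cards2 uu' u2 andbT.
  by apply/subsetP=> x; rewrite in_set2 => /orP[]/eqP->.
apply: nT => //; move: vU; rewrite -UE in_set2 => /orP[]/eqP->//.
Qed.

End CaseTwo.

(** * Exclusion of the patterns with p = 1 *)

(** Every edge has an end in the core, where the defect is 0. *)
Lemma delta_defect_jfg q : (3 <= q)%N ->
  \sum_x \sum_(y | jfg_adj 1 q x y) defect (jfg_adj 1 q) x * defect (jfg_adj 1 q) y = 0.
Proof.
move=> q3; have dc i : defect (jfg_adj 1 q) (core 1 i) = 0 by rewrite /defect deg_core // subrr.
rewrite sum_jfg big1 // => i _; rewrite [X in X + _]big1 ?add0r => [|y _]; last by rewrite dc mul0r.
by rewrite big1 // => k _; rewrite nbr_leaf dc mulr0.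
Qed.

(* 66 q is the contribution of the degrees of the jellyfish graph itself. *)
Lemma p1_trace q (W : finType) (f : rel W) : (4 <= q)%N ->
  simple_graph f -> Q_cospectral (jfg_adj 1 q) f ->
  \sum_w (((deg f w)%:R ^+ 2 - 5 * (deg f w)%:R) ^+ 2 + (deg f w)%:R ^+ 2 - (deg f w)%:R
          + 2 * (deg f w)%:R * defect f w ^+ 2)
  - 4 * (\sum_w defect f w * (closed3 f w)%:R)
  + 2 * (\sum_x \sum_(y | f x y) defect f x * defect f y) + (excess_codeg f)%:R
  = 66 * q%:R + (excess_codeg (jfg_adj 1 q))%:R :> R.
Proof.
move=> q4 [sf jf] cos; have q3 : (3 <= q)%N by apply: ltnW.
have [se je] := jfg_simple 1 q3; have [S [_ _ _ t4]] := cospectral_isometry se sf cos.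
have := t4 6; rewrite /= trace4_E // trace4_E // delta_defect_jfg // mulr0 addr0.
have c3 x : closed3 (jfg_adj 1 q) x = 0%N.
  case: x => i k; case: (unliftP ord0 k) => [k'|] ->; first exact: closed3_leaf.
  by have := closed3_core 1 q3 i; rewrite gtn_eqF.
have -> : \sum_x (((deg (jfg_adj 1 q) x)%:R ^+ 2 - 5 * (deg (jfg_adj 1 q) x)%:R) ^+ 2
    + (deg (jfg_adj 1 q) x)%:R ^+ 2 - (deg (jfg_adj 1 q) x)%:R
    + 2 * (deg (jfg_adj 1 q) x)%:R * defect (jfg_adj 1 q) x ^+ 2
    - 4 * defect (jfg_adj 1 q) x * (closed3 (jfg_adj 1 q) x)%:R) = 66 * q%:R :> R.
  under eq_bigr do rewrite c3 mulr0 subr0 /defect.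
  rewrite (sum_jfg_deg 1 q3 (fun d => (d%:R ^+ 2 - 5 * d%:R) ^+ 2 + d%:R ^+ 2 - d%:R + 2 * d%:R * (3 - d%:R) ^+ 2)).
  by rewrite muln1 -mulrnDl -[_ *+ q]mulr_natr; congr (_ * _); ring.
move=> <-; congr (_ + _); congr (_ + _).
rewrite mulr_sumr -sumrB; apply: eq_bigr => w _; ring.
Qed.

Section PEqualsOne.
Variable q : nat.
Hypotheses (q4 : (4 <= q)%N).
Variables (W : finType) (f : rel W).
Hypotheses (sif : simple_graph f) (cos : Q_cospectral (jfg_adj 1 q) f)
  (S : Q_isometry (jfg_adj 1 q) f).

Let q3 : (3 <= q)%N := ltnW q4.
Let sf : symmetric f := proj1 sif.
Let jf : irreflexive f := proj2 sif.

(* Twins with equal closed or open neighbourhoods would make 1 an eigenvalue. *)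
Lemma no_eigen1 u v : u != v ->
  (forall x, (deg f x)%:R * ((x == u)%:R - (x == v)%:R) + ((f x u)%:R - (f x v)%:R) = (x == u)%:R - (x == v)%:R :> R) ->
  False.
Proof.
move=> uv H; have H1 : Qop f (fun x => (x == u)%:R - (x == v)%:R) =1 fun x => (x == u)%:R - (x == v)%:R.
  move=> x; rewrite Qop_E sumrB -[RHS]H; congr (_ + _).
  have E t : \sum_(y | f x y) (y == t)%:R = (f x t)%:R :> R.
    by rewrite big_mkcond (bigD1 t) //= eqxx big1 ?addr0 => [|z /negPf->]; case: (f x _).
  by rewrite !E.
have /(_ u) := mate_eigen1_p1 S q3 H1.
by rewrite eqxx (negPf uv) subr0 => /eqP; rewrite oner_eq0.
Qed.

Lemma leaf_twin u v z : deg f u = 1%N -> deg f v = 1%N -> f u z -> f v z -> u = v.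
Proof.
move=> du dv uz vz; apply/eqP; apply: contraT => uv; exfalso.
have nb t x : deg f t = 1%N -> f t z -> f x t = (x == z).
  move=> dt tz; have /eqP/cards1P[z' E] : #|[set y | f t y]| = 1%N := dt.
  have E' y : f t y = (y == z').
    by have := congr1 (fun A : {set W} => y \in A) E; rewrite !inE.
  by rewrite sf E'; move: tz; rewrite E' => /eqP->.
apply: (no_eigen1 uv) => x; rewrite (nb u x du uz) (nb v x dv vz) subrr addr0.
have [->|xu] := eqVneq x u; first by rewrite du mul1r.
have [->|xv] := eqVneq x v; first by rewrite dv mul1r.
by rewrite subrr mulr0.
Qed.

Lemma triangle_twin u v z : u != v -> deg f u = 2%N -> deg f v = 2%N ->
  f u v -> f u z -> f v z -> False.
Proof.
move=> uv du dv fuv uz vz.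
have zu : z != u by apply: contraTneq uz => ->; rewrite jf.
have zv : z != v by apply: contraTneq vz => ->; rewrite jf.
have nE t b : deg f t = 2%N -> f t b -> f t z -> z != b -> forall x, f x t = (x == b) || (x == z).
  move=> dt tb tz zb x; have /eqP : [set b; z] = [set y | f t y].
    apply/eqP; rewrite eqEcard -/(deg f t) dt cards2 eq_sym zb andbT.
    by apply/subsetP=> y; rewrite !inE => /orP[]/eqP->.
  by move=> /eqP/(congr1 (fun A : {set W} => x \in A)); rewrite !inE sf => ->.
apply: (no_eigen1 uv) => x; rewrite (nE u v du fuv uz zv x) (nE v u dv (etrans (sf _ _) fuv) vz zu x).
have [->|xu] := eqVneq x u; first by rewrite du (negPf uv) /= [u == z]eq_sym (negPf zu) /=; ring.
have [->|xv] := eqVneq x v; first by rewrite dv /= [v == z]eq_sym (negPf zv) /=; ring.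
rewrite /=; ring.
Qed.

End PEqualsOne.

(** * The jellyfish graph with p = 1 and q = 4 *)

Section FourCycle.
Local Notation shifted g := (fun x => Qop (jfg_adj 1 4) g x - 2 * g x).

Let m (b : bool) (x : 'I_4 * 'I_2) : R :=
  if x.2 == ord0 then 2 else (odd x.1 == b)%:R.

(** The eigenvalues are 3 + sqrt 5, 3 - sqrt 5, 2 + sqrt 2 and 2 - sqrt 2 twice each, 2 and 0; only
    3 + sqrt 5 and 0 make (Q - 2)^2 - 2 positive, so two equations suffice. On their solutions the
    form is -2 (x0 + x1 + x2 + x3)^2. *)
Lemma jfg4_shifted_le (g : 'I_4 * 'I_2 -> R) : dot (m false) g = 0 -> dot (m true) g = 0 ->
  dot (shifted g) (shifted g) <= 2 * dot g g.
Proof.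
pose o k (H : (k < 4)%N) := Ordinal H.
have s4 (F : 'I_4 -> R) : \sum_i F i = F (o 0%N isT) + F (o 1%N isT) + F (o 2%N isT) + F (o 3%N isT).
  rewrite !big_ord_recl big_ord0 addr0 !addrA.
  by congr (F _ + F _ + F _ + F _); apply: val_inj.
have s1 (F : 'I_1 -> R) : \sum_i F i = F ord0 by rewrite big_ord1.
have [E0 E1 E2 E3] : [/\ ordS (o 0%N isT) = o 1%N isT, ordS (o 1%N isT) = o 2%N isT,
  ordS (o 2%N isT) = o 3%N isT & ordS (o 3%N isT) = o 0%N isT] by split; apply: val_inj.
have [P0 P1 P2 P3] : [/\ ord_pred (o 0%N isT) = o 3%N isT, ord_pred (o 1%N isT) = o 0%N isT,
  ord_pred (o 2%N isT) = o 1%N isT & ord_pred (o 3%N isT) = o 2%N isT] by split; apply: val_inj.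
rewrite !dot_jfg !s4 !s1 /m /= !Qop_core // !Qop_leaf !s1 E0 E1 E2 E3 P0 P1 P2 P3.
set x0 := g (core 1 (o 0%N _)); set x1 := g (core 1 (o 1%N _)).
set x2 := g (core 1 (o 2%N _)); set x3 := g (core 1 (o 3%N _)).
set y0 := g (leaf (o 0%N _) _); set y1 := g (leaf (o 1%N _) _).
set y2 := g (leaf (o 2%N _) _); set y3 := g (leaf (o 3%N _) _).
move=> Ha Hb.
have Ea : y2 = - y0 - 2 * (x0 + x1 + x2 + x3) by apply/eqP; rewrite -subr_eq0 -Ha; apply/eqP; ring.
have Eb : y3 = - y1 - 2 * (x0 + x1 + x2 + x3) by apply/eqP; rewrite -subr_eq0 -Hb; apply/eqP; ring.
rewrite Ea Eb -subr_ge0.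
rewrite [X in 0 <= X](_ : _ = 2 * (x0 + x1 + x2 + x3) ^+ 2); last by ring.
by rewrite mulr_ge0 ?ler0n ?sqr_ge0.
Qed.

Variables (W : finType) (f : rel W).
Hypotheses (sif : simple_graph f) (S : Q_isometry (jfg_adj 1 4) f).
Let sf : symmetric f := proj1 sif.
Let jf : irreflexive f := proj2 sif.

Let k3 (w u v : W) (b : option bool) : W := if b is Some b' then if b' then v else u else w.

(* On three such vertices with at most one common neighbour the form
   |(Q - 2) h|^2 - 2 |h|^2 is positive definite, but it has only two positive eigenvalues. *)
Lemma jfg4_codeg w u v : deg f w = 0%N -> deg f u = 3%N -> deg f v = 3%N -> u != v -> ~~ f u v ->
  (2 <= codeg f u v)%N.
Proof.
move=> dw du dv uv nuv; rewrite leqNgt; apply/negP=> cd.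
have [|c [b cb] H] := pull_constrained S (B := option bool) (J := bool)
  (fun b x => (x == k3 w u v b)%:R) m.
  by rewrite card_option card_bool.
pose h x := \sum_b c b * (x == k3 w u v b)%:R.
have := jfg4_shifted_le (H false) (H true); rewrite -/h.
have so (F : option bool -> R) : \sum_b F b = F None + F (Some false) + F (Some true).
  rewrite (bigD1 None) //= (bigD1 (Some false)) //= (bigD1 (Some true)) //= big1 ?addr0 ?addrA //.
  by case=> [[]|].
have hE : h =1 fun x => c None * (x == w)%:R + c (Some false) * (x == u)%:R + c (Some true) * (x == v)%:R.
  by move=> x; rewrite /h so.
have SE : shifted (S h) =1 S (fun w => Qop f h w - 2 * h w).
  move=> x; rewrite pull_Qop.
  have /(_ x) -> : S (fun w => Qop f h w - 2 * h w) =1 S (fun y => 1 * Qop f h y + (- 2) * h y).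
    by apply: pull_ext => y; ring.
  by rewrite pull_linear; ring.
rewrite (eq_dot SE SE) !pull_dot.
have dwE y : f w y = false.
  by apply/negP=> wy; move: dw => /eqP; rewrite cards_eq0 => /eqP/setP/(_ y); rewrite !inE wy.
have dh G : dot h G = c None * G w + c (Some false) * G u + c (Some true) * G v.
  rewrite -(dot_delta w G) -(dot_delta u G) -(dot_delta v G) /dot !mulr_sumr -!big_split /=.
  by apply: eq_bigr => y _; rewrite hE; ring.
have kh A x : kop A h x = c None * A x w + c (Some false) * A x u + c (Some true) * A x v.
  have -> : kop A h x = dot h (A x) by apply: eq_bigr => y _; rewrite mulrC.
  exact: dh.
have -> : dot (fun y => Qop f h y - 2 * h y) (fun y => Qop f h y - 2 * h y) =
    dot h (fun y => kop (kmul (Qker f) (Qker f)) h y - 4 * Qop f h y + 4 * h y).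
  transitivity (dot (Qop f h) (Qop f h) - 4 * dot h (Qop f h) + 4 * dot h h).
    rewrite /dot !mulr_sumr -sumrB -big_split /=; apply: eq_bigr => y _; ring.
  rewrite Qop_sym // /dot !mulr_sumr -sumrB -big_split /=; apply: eq_bigr => y _.
  rewrite kop_kmul; rewrite /Qop; ring.
have wu : w != u by apply/eqP=> E; move: dw; rewrite E du.
have wv : w != v by apply/eqP=> E; move: dw; rewrite E dv.
have cw y : codeg f w y = 0%N by rewrite /codeg big_pred0.
have cw' y : codeg f y w = 0%N by rewrite codegC.
rewrite !dh /Qop !kh !hE !Qker2_E // /Qker !cw !cw' !dwE.
have cvu : codeg f v u = codeg f u v by rewrite codegC.
have [cu cv] : codeg f u u = deg f u /\ codeg f v v = deg f v by rewrite !codeg_diag.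
have [fuw fvw fuv fvu] : [/\ f u w = false, f v w = false, f u v = false & f v u = false].
  by rewrite [f u w]sf [f v w]sf [f v u]sf !dwE (negPf nuv).
rewrite cvu cu cv fuw fvw fuv fvu !jf !eqxx.
rewrite dw du dv [u == w]eq_sym [v == w]eq_sym [v == u]eq_sym (negPf wu) (negPf wv) (negPf uv) /=.
have [a0 e0] : exists a, c None = a by eexists.
have [a1 e1] : exists a, c (Some false) = a by eexists.
have [a2 e2] : exists a, c (Some true) = a by eexists.
rewrite e0 e1 e2 => Hle.
have lt0 : 0 < a0 ^+ 2 + a1 ^+ 2 + a2 ^+ 2.
  have := sqr_ge0 a0; have := sqr_ge0 a1; have := sqr_ge0 a2.
  have : 0 < c b ^+ 2 by rewrite lt_neqAle sqr_ge0 eq_sym sqrf_eq0 cb.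
  by case: b {cb} => [[]|]; rewrite ?e0 ?e1 ?e2 => *; lra.
(* On the three indicators the form has diagonal entries d^2 - 3 d + 2 = 2, both for d = 0 and for d
   = 3, and a single entry off the diagonal, [codeg f u v], at most 1. *)
have : a0 ^+ 2 + a1 ^+ 2 + a2 ^+ 2 <= 0.
  move: cd Hle; case: (codeg f u v) => [|[|//]] _ Hle; first by lra.
  have := sqr_ge0 (a1 + a2); have := sqr_ge0 a0 => h1 h2; nra.
by rewrite leNgt lt0.
Qed.

End FourCycle.

(** * The fourth-order trace against the two patterns with p = 1 *)

Section PEqualsOneCounts.
Variable q : nat.
Hypotheses (q4 : (4 <= q)%N).
Variables (W : finType) (f : rel W).
Hypotheses (sif : simple_graph f) (cos : Q_cospectral (jfg_adj 1 q) f)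
  (S : Q_isometry (jfg_adj 1 q) f).

Let q3 : (3 <= q)%N := ltnW q4.
Let sf : symmetric f := proj1 sif.
Let jf : irreflexive f := proj2 sif.

(** The coefficients 24, 42, 42, 36 are the values at d = 1, 2, 3, 4 of the degree polynomial in
    [p1_trace]; it vanishes at 0. *)
Lemma p1_count : exists A B : R, [/\ A = \sum_w defect f w * (closed3 f w)%:R,
  B = \sum_x \sum_(y | f x y) defect f x * defect f y &
  24 * (ndeg f 1)%:R + 42 * (ndeg f 2)%:R + 42 * (ndeg f 3)%:R + 36 * (ndeg f 4)%:R
  - 4 * A + 2 * B + (excess_codeg f)%:R <= 66 * q%:R + (8 * (q == 4))%:R].
Proof.
eexists _, _; split; [reflexivity..|].
have le4 w : deg f w \in iota 0 5 by rewrite mem_iota /= ltnS; apply: (max_deg (p := 1) isT q3 sif S).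
have := p1_trace q4 sif cos; rewrite /defect (sum_deg_count (fun d => (d%:R ^+ 2 - 5 * d%:R) ^+ 2 + d%:R ^+ 2 - d%:R + 2 * d%:R * (3 - d%:R) ^+ 2) (iota_uniq 0 5) le4).
rewrite /= !big_cons big_nil => E.
have := excess_codeg_jfg q4; rewrite -(ler_nat R); lra.
Qed.

Lemma nbr_deg_gt0 x y : f x y -> (0 < deg f x)%N.
Proof. by move=> xy; apply/card_gt0P; exists y; rewrite inE. Qed.

Lemma triangle_closed3 x y z : f x y -> f x z -> f y z -> (2 <= closed3 f x)%N.
Proof.
move=> xy xz yz; have c1 u v t : f u v -> f u t -> f v t -> (0 < codeg f u v)%N.
  by move=> uv ut vt; rewrite /codeg (bigD1 t) //= [f t v]sf vt.
have zy : z != y by apply: contraTneq yz => ->; rewrite jf.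
rewrite /closed3 (bigD1 y) //= (bigD1 z) /=; last by rewrite xz zy.
have := c1 x y z xy xz yz; have := c1 x z y xz xy (etrans (sf _ _) yz); lia.
Qed.

Lemma sum_four (F : W -> nat) (u v a b : W) : uniq [:: u; v; a; b] ->
  (F u + F v + F a + F b <= \sum_w F w)%N.
Proof.
move=> un; rewrite [X in (_ <= X)%N](bigID (fun w => w \in [:: u; v; a; b])) /= -big_uniq //.
by rewrite !big_cons big_nil /= addn0 !addnA leq_addr.
Qed.

(** Two common neighbours of [u] and [v] are themselves opposite on a 4-cycle, so four ordered pairs
    contribute at least 2 each. *)
Lemma excess_codeg_ge8 u v : u != v -> (2 <= codeg f u v)%N -> (8 <= excess_codeg f)%N.
Proof.
move=> uv c2.
have cE x y : codeg f x y = #|[set z | f x z && f z y]|.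
  by rewrite /codeg -sum1dep_card [RHS]big_mkcondr.
have /card_gt1P[a [b [aC bC ab]]] : (1 < #|[set z | f u z && f z v]|)%N by rewrite -cE.
move: aC bC; rewrite !inE => /andP[ua av] /andP[ub bv].
have c2' : (2 <= codeg f a b)%N.
  rewrite cE; apply/card_gt1P; exists u, v; rewrite !inE; split=> //.
    by rewrite ub sf ua.
  by rewrite av sf bv.
have F2 x y : x != y -> (2 <= codeg f x y)%N -> (2 <= \sum_(z | z != x) codeg f x z * (codeg f x z).-1)%N.
  move=> xy cxy; rewrite (bigD1 y) 1?eq_sym //=; apply: leq_trans (leq_addr _ _).
  by move: cxy; case: (codeg f x y) => [|[|n]] //= _; apply: (@leq_trans n.+2) => //; apply: leq_pmulr.
have ne x y : f x y -> x != y by apply: contraTneq => ->; rewrite jf.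
have un : uniq [:: u; v; a; b].
  by rewrite /= !inE !negb_or uv ab (ne u a) // (ne u b) // [v == a]eq_sym [v == b]eq_sym (ne a v) // (ne b v).
apply: leq_trans (sum_four _ un).
have h1 := F2 u v uv c2; have h2 := F2 v u; rewrite eq_sym uv codegC // in h2.
have h3 := F2 a b ab c2'; have h4 := F2 b a; rewrite eq_sym ab codegC // in h4.
have {}h2 := h2 isT c2; have {}h4 := h4 isT c2'.
exact: leq_add (leq_add (leq_add h1 h2) h3) h4.
Qed.

Section OneTriangle.
Hypotheses (c2 : ndeg f 2 = 3%N) (c3 : ndeg f 3 = (q - 1)%N) (c1 : ndeg f 1 = (q - 3)%N)
  (c4 : ndeg f 4 = 0%N) (c : (\sum_w closed3 f w)%N = 6%N).

(** The three vertices of one triangle already exhaust the total 6. *)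
Lemma one_triangle x y z : f x y -> f x z -> f y z ->
  forall w, w \notin [:: x; y; z] -> closed3 f w = 0%N.
Proof.
move=> xy xz yz w wn; apply/eqP; rewrite -leqn0 leqNgt; apply/negP=> cw.
have ne u v : f u v -> u != v by apply: contraTneq => ->; rewrite jf.
have un : uniq [:: w; x; y; z] by rewrite cons_uniq wn /= !inE negb_or (ne x y) // (ne x z) // (ne y z).
have := sum_four (closed3 f) un; rewrite c.
have := triangle_closed3 xy xz yz; have := triangle_closed3 (etrans (sf _ _) xy) yz xz.
have := triangle_closed3 (etrans (sf _ _) xz) (etrans (sf _ _) yz) xy; lia.
Qed.

Lemma closed3_triangle w : (0 < closed3 f w)%N -> exists y z, [/\ f w y, f w z & f y z].
Proof.
rewrite /closed3 lt0n sum_nat_eq0 negb_forall => /existsP[y]; rewrite negb_imply => /andP[wy].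
rewrite /codeg sum_nat_eq0 negb_forall => /existsP[z]; rewrite negb_imply => /andP[wz].
by rewrite eqb0 negbK => zy; exists y, z; rewrite wy wz sf zy.
Qed.

Lemma deg2_triangle w : deg f w = 2%N -> (closed3 f w <= 2)%N.
Proof.
move=> dw; rewrite /closed3 -dw /deg -sum1dep_card; apply: leq_sum => y wy.
have : (codeg f w y <= #|[set z | f w z] :\ y|)%N.
  rewrite /codeg -sum1_card [X in (X <= _)%N]big_mkcond [X in (_ <= X)%N]big_mkcond.
  apply: leq_sum => z _; rewrite in_setD1 inE; case: (f w z); last by rewrite andbF.
  by case: eqP => [->|_]; rewrite ?jf ?leq_b1.
move=> H; apply: leq_trans H _; have := cardsD1 y [set z | f w z]; rewrite inE wy.
by rewrite -/(deg f w) dw add1n => -[<-].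
Qed.

Lemma deg_le3 w : (deg f w <= 3)%N.
Proof.
have := max_deg (p := 1) isT q3 sif S w; rewrite leq_eqVlt => /orP[/eqP d|//].
by move/eqP: c4; rewrite cards_eq0 => /eqP/setP/(_ w); rewrite !inE d.
Qed.

Lemma defect_ge0 w : 0 <= defect f w.
Proof. by rewrite /defect subr_ge0 (ler_nat R _ 3) deg_le3. Qed.

Lemma defect_closed3_eq0 w : (deg f w != 2)%N || (closed3 f w == 0)%N ->
  defect f w * (closed3 f w)%:R = 0.
Proof.
case/orP=> [d2|/eqP->]; last by rewrite mulr0.
have [d3|d3] := eqVneq (deg f w) 3%N; first by rewrite /defect d3 subrr mul0r.
have d1 : (deg f w <= 1)%N by have := deg_le3 w; lia.
suff -> : closed3 f w = 0%N by rewrite mulr0.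
apply/eqP; rewrite -leqn0 leqNgt; apply/negP=> /closed3_triangle[y [z [wy wz yz]]].
have : (1 < deg f w)%N.
  by apply/card_gt1P; exists y, z; rewrite !inE; split=> //; apply: contraTneq yz => ->; rewrite jf.
by rewrite ltnNge d1.
Qed.

(** Only vertices of degree 2 on the triangle contribute, 2 each, and two of them would produce the
    eigenvalue 1. *)
Lemma defect_closed3_le : \sum_w defect f w * (closed3 f w)%:R <= 2.
Proof.
have [/existsP[w /andP[/eqP dw cw]]|/existsPn no] := boolP [exists w, (deg f w == 2%N) && (0 < closed3 f w)%N]; last first.
  rewrite big1 // => w _; apply: defect_closed3_eq0.
  by have := no w; rewrite negb_and -eqn0Ngt.
rewrite (bigD1 w) //= [X in _ + X]big1 ?addr0 => [|v vw].
  by rewrite /defect dw; have := deg2_triangle dw; rewrite -(ler_nat R) => H; lra.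
apply: defect_closed3_eq0; apply: contraT; rewrite negb_or negbK -lt0n => /andP[/eqP dv cv].
have [y [z [wy wz yz]]] := closed3_triangle cw.
have : v \in [:: w; y; z] by apply: contraLR cv => /(one_triangle wy wz yz)->.
rewrite !inE (negPf vw) /= => /orP[]/eqP vE; subst v; exfalso.
  by apply: (triangle_twin q4 sif S _ dw dv wy wz yz); rewrite eq_sym.
by apply: (triangle_twin q4 sif S _ dw dv wz wy); rewrite 1?eq_sym // sf.
Qed.

(** The degrees account for 66 q + 12, and 12 - 4 A >= 4 refutes q > 4. If q = 4, there is no room
    for a 4-cycle, so by [jfg4_codeg] the three vertices of degree 3 are pairwise adjacent; they
    form the triangle, whence A = 0 and 12 > 8. *)
Lemma one_triangle_absurd w0 : deg f w0 = 0%N -> False.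
Proof.
move=> dw0; have [A [B [AE BE]]] := p1_count; rewrite c1 c2 c3 c4 !natrB ?(ltnW q4) ?(leq_trans _ q4) // => E.
have P : 0 <= B.
  by rewrite BE; apply: sumr_ge0 => x _; apply: sumr_ge0 => y _; rewrite mulr_ge0 ?defect_ge0.
have D : A <= 2 by rewrite AE defect_closed3_le.
have C0 := ler0n R (excess_codeg f).
have [qE|q5] := eqVneq q 4%N; last by move: E; rewrite (negPf q5) muln0; lra.
move: E; rewrite qE eqxx => E.
have C4 : (excess_codeg f < 8)%N by rewrite -(ltr_nat R); move: E; rewrite muln1; lra.
have : (2 < #|[set w | deg f w == 3%N]|)%N by rewrite -/(ndeg f 3) c3 qE.
case/card_gt2P=> x [y [z [[]]]]; rewrite !inE => /eqP dx /eqP dy /eqP dz [xy yz zx].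
have adj u v : deg f u = 3%N -> deg f v = 3%N -> u != v -> f u v.
  move=> du dv uv; apply: contraT => nuv; move: S; rewrite qE => S4.
  by move: C4; rewrite ltnNge (excess_codeg_ge8 uv) // (jfg4_codeg sif S4 dw0).
have [fxy fxz fyz] : [/\ f x y, f x z & f y z] by split; apply: adj; rewrite // eq_sym.
suff A0 : A = 0 by move: E; rewrite A0 muln1; lra.
rewrite AE big1 // => w _; apply: defect_closed3_eq0; case: (boolP (w \in [:: x; y; z])) => [|/(one_triangle fxy fxz fyz)->].
  by rewrite !inE => /or3P[]/eqP->; rewrite ?dx ?dy ?dz.
by rewrite orbT.
Qed.

End OneTriangle.

Section OneDegreeFour.
Hypotheses (c2 : ndeg f 2 = 6%N) (c3 : ndeg f 3 = (q - 4)%N) (c1 : ndeg f 1 = (q - 4)%N)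
  (c4 : ndeg f 4 = 1%N) (trf : forall w, closed3 f w = 0%N).

(** The degrees account for 66 q + 24 and A = 0. Separating the vertex [h] of degree 4 gives B = P -
    2 T with T <= 5, since at most one neighbour of [h] is a leaf; this refutes q > 4. If q = 4,
    there are no leaves and T <= 4, but some edge joins two vertices of degree 2, which makes P >=
    1. *)
Lemma one_degree_four_absurd : False.
Proof.
have [A [B [AE BE]]] := p1_count; rewrite c1 c2 c3 c4 !natrB // => E.
have C0 := ler0n R (excess_codeg f).
have /eqP/cards1P[h hE] := c4.
have dh x : (deg f x == 4)%N = (x == h) by have := congr1 (fun A : {set W} => x \in A) hE; rewrite !inE.
have dle x : x != h -> (deg f x <= 3)%N.
  by have := max_deg (p := 1) isT q3 sif S x; rewrite leq_eqVlt dh => /orP[->|].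
have hh : deg f h = 4%N by apply/eqP; rewrite dh.
have dh1 : defect f h = -1 by rewrite /defect hh; ring.
have d0 x : x != h -> 0 <= defect f x.
  by move=> /dle dx; rewrite /defect subr_ge0 (ler_nat R _ 3).
pose P := \sum_x \sum_(y | f x y) (x != h)%:R * (y != h)%:R * (defect f x * defect f y).
pose T := \sum_(y | f h y) defect f y.
have PE : B = P - 2 * T.
  rewrite BE.
  have T1 : \sum_x \sum_(y | f x y) (x == h)%:R * defect f y = T.
    rewrite (bigD1 h) //= [X in _ + X]big1 ?addr0 => [|x /negPf xh].
      by apply: eq_bigr => y _; rewrite eqxx mul1r.
    by rewrite big1 // => y _; rewrite xh mul0r.
  have T2 := sum_nbr_sym sf (fun x y => (x == h)%:R * defect f y).
  have -> : P - 2 * T = P - T - T by ring.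
  rewrite -{2}T1 -T1 [X in _ - _ - X]T2 /P -!sumrB; apply: eq_bigr => x _; rewrite -!sumrB.
  apply: eq_bigr => y xy.
  have [xh|xh] := eqVneq x h; have [yh|yh] := eqVneq y h.
  - by move: xy; rewrite xh yh jf.
  - by rewrite xh dh1 /=; ring.
  - by rewrite yh dh1 /=; ring.
  - by rewrite /=; ring.
have P0 x y : 0 <= (x != h)%:R * (y != h)%:R * (defect f x * defect f y).
  have [xh|xh] := eqVneq x h; first by rewrite /= !mul0r.
  have [yh|yh] := eqVneq y h; first by rewrite /= mulr0 !mul0r.
  by rewrite /= !mul1r mulr_ge0 ?d0.
have Pge : 0 <= P by apply: sumr_ge0 => x _; apply: sumr_ge0.
have A0 : A = 0 by rewrite AE big1 // => w _; rewrite trf mulr0.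
have TE : T <= 4 + (\sum_(y | f h y) (deg f y == 1)%N)%:R.
  rewrite -[4]/(4%:R) -hh deg_sum -natrD -big_split /= natr_sum; apply: ler_sum => y hy.
  have : (0 < deg f y)%N by apply: (nbr_deg_gt0 (y := h)); rewrite sf.
  rewrite /defect; case: (deg f y) => [//|[|n]] _ /=; first by rewrite lerBlDr -natrD.
  have : 2%:R <= n.+2%:R :> R by rewrite ler_nat.
  rewrite addn0; lra.
have leaf1 : (\sum_(y | f h y) (deg f y == 1) <= 1)%N.
  have [/existsP[l /andP[hl /eqP dl]]|/existsPn no] := boolP [exists l, f h l && (deg f l == 1)%N].
    rewrite (bigD1 l) //= dl big1 // => y /andP[hy yl]; apply/eqP; rewrite eqb0.
    apply: contra yl => /eqP dy; apply/eqP; apply: (leaf_twin q4 sif S dy dl (z := h)); by rewrite sf.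
  by rewrite big1 // => y hy; have := no y; rewrite hy /= => /negPf->.
have [qE|q5] := eqVneq q 4%N; last first.
  move: E TE; rewrite (negPf q5) muln0 A0 PE; move: (\sum_(y | f h y) _)%N leaf1 => L.
  by rewrite -(ler_nat R); lra.
have [x /andP[/eqP dx nhx]] : exists x, (deg f x == 2%N) && ~~ f h x.
  apply/existsP; apply: contraT => /existsPn no.
  have : ([set x | deg f x == 2%N] \subset [set x | f h x]).
    by apply/subsetP=> x; rewrite !inE => dx; have := no x; rewrite dx /= negbK.
  by move/subset_leq_card; rewrite -/(ndeg f 2) c2 -/(deg f h) hh.
have /card_gt0P[y] : (0 < #|[set y | f x y]|)%N by rewrite -/(deg f x) dx.
rewrite inE => xy.
have yh : y != h by apply: contraTneq xy => ->; rewrite sf.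
have no k : ndeg f k = 0%N -> forall y, deg f y != k.
  by move=> /eqP; rewrite cards_eq0 => /eqP/setP H z; have := H z; rewrite !inE => ->.
have n1 : ndeg f 1 = 0%N by rewrite c1 qE.
have n3 : ndeg f 3 = 0%N by rewrite c3 qE.
have dy : deg f y = 2%N.
  have := dle y yh; have := nbr_deg_gt0 (etrans (sf _ _) xy).
  by have := no 1%N n1 y; have := no 3%N n3 y; lia.
have xh : x != h by apply/eqP=> xE; move: dx; rewrite xE hh.
have P1 : 1 <= P.
  rewrite /P (bigD1 x) //= (bigD1 y) //=.
  rewrite -[X in X <= _]addr0 lerD //; last by apply: sumr_ge0 => z _; apply: sumr_ge0.
  rewrite -[X in X <= _]addr0 lerD //; last by apply: sumr_ge0.
  by rewrite xh yh /defect dx dy /=; lra.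
have no1 : (\sum_(y | f h y) (deg f y == 1))%N = 0%N.
  by rewrite big1 // => z _; rewrite (negPf (no 1%N n1 z)).
by move: E TE; rewrite qE eqxx muln1 A0 PE no1; lra.
Qed.

End OneDegreeFour.
End PEqualsOneCounts.

Theorem theorem3p10 (p q : nat) : (1 <= p)%N -> (3 <= q)%N -> DQS (jfg_adj p q).
Proof.
move=> p1 q3 W f sif cos; have [S _] := cospectral_isometry (proj1 (jfg_simple p q3)) (proj1 sif) cos.
case: (boolP [exists w, deg f w == 0%N]) => [/existsP[w0 /eqP dw0]|/existsPn d0]; last first.
  apply: (two_degrees_iso p1 q3 sif cos); apply: (degrees_no_isolated p1 q3 sif cos) => w.
  by rewrite lt0n d0.
exfalso; have := isolated_small_p p1 q3 sif cos S dw0; have := isolated_even q3 sif S dw0.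
case: p p1 cos S => [//|[|[|[|//]]]] p1 cos S qeven _.
- have q4 : (4 <= q)%N by case: q q3 qeven {cos S} => [|[|[|[|]]]].
  have [[]|[]] := isolated_p1 p1 q3 sif cos S dw0 erefl.
    by move=> c2 c3 c1 c4 c; apply: (one_triangle_absurd q4 sif cos S c2 c3 c1 c4 c dw0).
  exact: (one_degree_four_absurd q4 sif cos S).
- have [[]|[c2 cK c1 trf]] := isolated_p2 p1 q3 sif cos S dw0 erefl.
    exact: (min_deg3_absurd p1 q3 sif S dw0).
  exact: (case_two_absurd q3 sif S trf dw0 c2 cK c1).
- have [] := isolated_p3 p1 q3 sif cos S dw0 erefl; exact: (min_deg3_absurd p1 q3 sif S dw0).
Qed.
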